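(* Let $d\ge 1$ and $G=\mathrm{Res}_{\mathbf F_{p^d}/\mathbf F_p}\mathrm{GL}(2)$, and let $\mu$ be a cocharacter of $G_k$. Assume that the parabolic $P$ of non-positive $\mu$-weights is a Borel subgroup of $G$ and that $r$ is a $k$-subrepresentation of the natural, faithful $2d$-dimensional representation of $G$. Then all the Chern classes of the Griffiths-Hodge vector bundle $\mathrm{Grif}(G\text{-}\mathrm{Zip}^\mu,r)$ are strata-effective, i.e. each of them can be written as $\sum_w a_w[\overline{\mathcal X}_w]$ with all $a_w\in\mathbf Q_{\ge 0}$, where the $\overline{\mathcal X}_w$ are the closures of the zip strata of $G\text{-}\mathrm{Zip}^\mu$; and there is an explicit formula for the coefficients $a_w$.
   Context: $p$ is a prime and $k$ is an algebraic closure of $\mathbf F_p$. For a connected reductive $\mathbf F_p$-group $G$ with Frobenius $\varphi:G\to G$ and a cocharacter $\mu$ of $G_k$: $P$ (resp. $P^+$) is the parabolic subgroup of $G_k$ of non-positive (resp. non-negative) $\mu$-weights, $L=P\cap P^+$ is the centralizer of $\mu$, and $Q=(P^+)^{(p)}$ is the Frobenius twist of $P^+$. It is assumed throughout that $P$ contains a Borel subgroup $B$ of $G$ defined over $\mathbf F_p$. The zip group is $E=\{(a,b)\in P\times Q\mid \varphi(\bar a)=\bar b\}$ (bars denote projections to the Levi factors), acting on $G_k$ by $(a,b)\cdot g=agb^{-1}$, and $G\text{-}\mathrm{Zip}^\mu=[E\backslash G_k]$. The zip strata $\mathcal X_w$ are the finitely many locally closed substacks $[E\backslash O]$, with $O$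 an $E$-orbit in $G_k$. Chern classes and cycle classes are taken in $\mathrm{CH}^*_{\mathbf Q}(G\text{-}\mathrm{Zip}^\mu)$, the (Edidin–Graham) $E$-equivariant Chow ring of $G_k$ with $\mathbf Q$-coefficients. The natural representation of $G=\mathrm{Res}_{\mathbf F_{p^d}/\mathbf F_p}\mathrm{GL}(2)$ is its action on $\mathbf F_{p^d}^2$ viewed as a $2d$-dimensional $\mathbf F_p$-vector space; a $k$-subrepresentation means a subrepresentation of its base change to $k$. Griffiths-Hodge bundle: for a $k$-representation $r:G_k\to\mathrm{GL}(V)$, let $\mathrm{Fil}^\bullet$ be the descending filtration of $V$ associated to $r\circ\mu$ by Deligne's sign convention, in which the $i$-th graded piece is the $(-i)$-weight space of $r\circ\mu$. The Griffiths module is $\mathrm{Grif}(G,\mu,r)=\bigoplus_{n\in\mathbf Z}\mathrm{Fil}^n$ (with only finitely many of the terms equal to $V$ retained); it is an $L$-module. $\mathrm{Grif}(G\text{-}\mathrm{Zip}^\mu,r)$ is the vector bundle on $G\text{-}\mathrm{Zip}^\mu=[E\backslash G_k]$ associated to this $L$-module through the projections $E\to P\to L$. *)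

(* Defs.v *)
(* Varieties are handled classically, over an algebraically closed field k: a
   locally closed subvariety is its set of k-points inside a k-vector space V of
   finite dimension. *)
From HB Require Import structures.
From mathcomp Require Import all_boot all_order all_algebra all_field.
From mathcomp Require Import boolp classical_sets.
From mathcomp Require Import mpoly.

Set Implicit Arguments.
Unset Strict Implicit.
Unset Printing Implicit Defensive.

Import Order.TTheory GRing.Theory Num.Theory.
Local Open Scope classical_set_scope.
Local Open Scope ring_scope.

(** * Zariski topology on a finite dimensional vector space *)
Section Zariski.
Variables (k : closedFieldType) (V : vectType k).

Definition coord_ring := {mpoly k[\dim {:V}]}.

Definition peval (f : coord_ring) (v : V) : k :=
  f.@[fun i => coord (vbasis {:V}) i v].

Definition vanishing (Z : set V) : set coord_ring :=
  [set f | forall v, Z v -> peval f v = 0].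

Definition zclosed (Z : set V) : Prop :=
  exists S : set coord_ring, Z = [set v | forall f, S f -> peval f v = 0].

Definition zclosed_in (X Z : set V) : Prop :=
  exists2 C, zclosed C & Z = X `&` C.

Definition zclosure_in (X A : set V) : set V :=
  X `&` [set v | forall f, vanishing A f -> peval f v = 0].

Definition zconnected (A : set V) : Prop :=
  A !=set0 /\ forall C1 C2, zclosed C1 -> zclosed C2 ->
    A `<=` C1 `|` C2 -> A `&` C1 `&` C2 = set0 -> A `<=` C1 \/ A `<=` C2.

(* Closed integral subschemes of the reduced locally closed X. *)
Definition subvariety (X Z : set V) : Prop :=
  [/\ zclosed_in X Z, Z !=set0 &
      forall Z1 Z2, zclosed_in X Z1 -> zclosed_in X Z2 ->
        Z `<=` Z1 `|` Z2 -> Z `<=` Z1 \/ Z `<=` Z2].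

Definition prime_divisor (X Y D : set V) : Prop :=
  [/\ subvariety X D, D `<` Y &
      forall Z, subvariety X Z -> D `<=` Z -> Z `<=` Y -> Z = D \/ Z = Y].

(* Ideals of the local ring O_{Y,D}, identified with their preimages in the
   coordinate ring of V: the ideals that contain the ideal of Y and are saturated
   with respect to the complement of the prime ideal of D. *)
Definition local_ideal (Y D : set V) (J : set coord_ring) : Prop :=
  [/\ vanishing Y `<=` J,
      forall a b, J a -> J b -> J (a + b),
      forall a b, J b -> J (a * b) &
      forall s a, ~ vanishing D s -> J (s * a) -> J a].

(* length (O_{Y,D} / (f)) >= m *)
Definition ord_ge (Y D : set V) (f : coord_ring) (m : nat) : Prop :=
  exists J : nat -> set coord_ring,
    [/\ forall j, (j <= m)%N -> local_ideal Y D (J j),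
        J 0%N f &
        forall j, (j < m)%N -> J j `<` J j.+1].

(* Fulton's order of vanishing: the length of O_{Y,D} / (f). *)
Definition ord (Y D : set V) (f : coord_ring) : nat :=
  xget 0%N [set m | ord_ge Y D f m /\ ~ ord_ge Y D f m.+1].

End Zariski.

Definition vspace_of (k : fieldType) (T : vectType k) (S : set T) : {vspace T} :=
  xget 0%VS [set U : {vspace T} | forall v, v \in U <-> S v].

(** * Cycles on the quotient of X by a free action

   A connected algebraic group acts on X, freely and with a principal bundle
   quotient X -> X/H; H is its group of k-points.  The subvarieties of X/H are the
   H-invariant subvarieties of X, the rational functions on Y/H are the H-invariant
   rational functions on Y, and the orders of vanishing agree because X -> X/H is
   smooth with irreducible fibres.  So the Chow groups of X/H are written on X. *)
Section Cycles.
Variables (k : closedFieldType) (V : vectType k).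
Variables (X : set V) (H : Type) (act : H -> V -> V).

Definition inv_subvariety (Z : set V) : Prop :=
  subvariety X Z /\ forall h v, Z v -> Z (act h v).

(* Formal Q-linear combinations of subvarieties. *)
Definition cycle := seq (rat * set V).

Definition mult (c : cycle) (Z : set V) : rat :=
  \sum_(x <- c | `[< x.2 = Z >]) x.1.

Record ratfun := RatFun {
  rf_dom : set V;
  rf_num : coord_ring V;
  rf_den : coord_ring V }.

(* A rational function s on an invariant subvariety Y with s(h v) = chi(h) s(v),
   i.e. a rational section over Y/H of the line bundle attached to chi. *)
Definition rat_section (chi : H -> k) (s : ratfun) : Prop :=
  let: RatFun Y f g := s in
  [/\ inv_subvariety Y, ~ vanishing Y f, ~ vanishing Y g &
      forall h v, Y v ->
        peval f (act h v) * peval g v = chi h * peval f v * peval g (act h v)].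

Definition div_mult (s : ratfun) (D : set V) : rat :=
  let: RatFun Y f g := s in
  if `[< prime_divisor X Y D >] then (ord Y D f)%:R - (ord Y D g)%:R else 0.

Definition rat_equiv (a b : cycle) : Prop :=
  exists (m : nat) (q : 'I_m -> rat) (s : 'I_m -> ratfun),
    (forall j, rat_section (fun=> 1) (s j)) /\
    forall D, inv_subvariety D ->
      mult a D = mult b D + \sum_j q j * div_mult (s j) D.

(* The cycle b represents the cap product c_1(L_chi) /\ a. *)
Definition c1_cap (chi : H -> k) (a b : cycle) : Prop :=
  exists (m : nat) (q : 'I_m -> rat) (s : 'I_m -> ratfun),
    [/\ forall j, rat_section chi (s j),
        forall D, inv_subvariety D ->
          mult a D = mult [seq (q j, rf_dom (s j)) | j <- enum 'I_m] D &
        forall D, inv_subvariety D ->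
          mult b D = \sum_j q j * div_mult (s j) D].

End Cycles.

(** * Chern classes of the bundle on X/H attached to an H-module W *)
Section Chern.
Variables (k : closedFieldType) (V : vectType k).
Variables (X : set V) (H : Type) (act : H -> V -> V).
Variables (T : vectType k) (rho : H -> T -> T) (W : {vspace T}).

(* The bundle P(W) of lines in W is the quotient of X x (W \ 0) by H x G_m. *)
Definition proj_total : set (V * T)%type :=
  [set x | [/\ X x.1, x.2 \in W & x.2 != 0]].

Definition proj_group := (H * {l : k | l != 0})%type.

Definition proj_act (h : proj_group) (x : (V * T)%type) : (V * T)%type :=
  (act h.1 x.1, sval h.2 *: rho h.1 x.2).

(* O(1) is the dual of the tautological line bundle: its sections are the
   functions that are homogeneous of degree 1 on W. *)
Definition char_O1 (h : proj_group) : k := sval h.2.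

Definition proj_pull (c : cycle V) : cycle (V * T)%type :=
  [seq (x.1, [set y | [/\ x.2 y.1, y.2 \in W & y.2 != 0]]) | x <- c].

(* c_0 = 1, c_j = 0 for j > r = rank W, and, with xi = c_1(O(1)),
     xi^r + c_1 xi^(r-1) + ... + c_r = 0   on P(W),
   which determines the Chern classes; the left-hand side is evaluated on
   cycles by Horner's rule  b_(j+1) = xi b_j + c_(j+1). *)
Definition chern_classes (c : nat -> cycle V) : Prop :=
  let r := \dim W in
  let equivX := rat_equiv X act in
  let equivP := rat_equiv proj_total proj_act in
  [/\ equivX (c 0%N) [:: (1, X)],
      forall j, (r < j)%N -> equivX (c j) [::] &
      exists b : nat -> cycle (V * T)%type,
        [/\ equivP (b 0%N) (proj_pull (c 0%N)),
            forall j, (j < r)%N ->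
              exists2 b', c1_cap proj_total proj_act char_O1 (b j) b' &
                equivP (b j.+1) (b' ++ proj_pull (c j.+1)) &
            equivP (b r) [::]]].

(* The cycle a represents c_i. *)
Definition is_chern (i : nat) (a : cycle V) : Prop :=
  exists2 c, chern_classes c & rat_equiv X act (c i) a.

End Chern.

(** * Algebraic subgroups of GL_n, on k-points *)
Section LinearGroups.
Variables (k : closedFieldType) (n : nat).
Implicit Types (B : set 'M[k]_n).

Definition subgroup B : Prop :=
  [/\ B 1%:M, forall x y, B x -> B y -> B (x *m y),
      forall x, B x -> x \in unitmx & forall x, B x -> B (invmx x)].

Definition solvable_subgroup B : Prop :=
  exists (m : nat) (D : nat -> set 'M[k]_n),
    [/\ D 0%N = B, D m = [set 1%:M], forall j, subgroup (D j) &
        forall j x y, (j < m)%N -> D j x -> D j y ->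
          D j.+1 (x *m y *m invmx x *m invmx y)].

Definition conn_solvable (G B : set 'M[k]_n) : Prop :=
  [/\ zclosed_in G B, subgroup B, zconnected B & solvable_subgroup B].

Definition borel (G B : set 'M[k]_n) : Prop :=
  conn_solvable G B /\
  forall B', conn_solvable G B' -> B `<=` B' -> B' = B.

(* Only the values at nonzero x are relevant. *)
Definition cocharacter (G : set 'M[k]_n) (mu : k -> 'M[k]_n) : Prop :=
  [/\ forall x, x != 0 -> G (mu x),
      forall x y, x != 0 -> y != 0 -> mu (x * y) = mu x *m mu y &
      exists (N : nat) (A : 'M[{poly k}]_n), forall x, x != 0 ->
        mu x = x ^- N *: map_mx (fun f : {poly k} => f.[x]) A].

Definition ad_weight (mu : k -> 'M[k]_n) (m : int) (A : 'M[k]_n) : Prop :=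
  forall x, x != 0 -> mu x *m A *m invmx (mu x) = x ^ m *: A.

Definition weight (mu : k -> 'M[k]_n) (m : int) (v : 'cV[k]_n) : Prop :=
  forall x, x != 0 -> mu x *m v = x ^ m *: v.

(* For sgn = 1 (resp. -1): g has only non-negative (resp. non-positive)
   mu-weights, and l is its component of weight 0. *)
Definition weight_proj (mu : k -> 'M[k]_n) (sgn : int) (g l : 'M[k]_n) : Prop :=
  exists (N : nat) (A : nat -> 'M[k]_n),
    [/\ forall t, ad_weight mu (sgn * t%:Z) (A t),
        g = \sum_(t < N.+1) A t & l = A 0%N].

Definition parabolic (G : set 'M[k]_n) (mu : k -> 'M[k]_n) (sgn : int) :=
  [set g | G g /\ exists l, weight_proj mu sgn g l].

End LinearGroups.

(** * The group Res_{F/F_p} GL(2) and its zip data *)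
Section Zip.
Variables (k : closedFieldType) (p d : nat).
Variables (F : fieldExtType 'F_p) (e : d.-tuple F).

(* The action of x on F^2 (x) k, in the F_p-basis of F^2 = F (+) F given by two
   copies of the basis e of F. *)
Definition scalar_mx2 (x : F) : 'M[k]_(d + d) :=
  let M := \matrix_(i, j) ((coord e i (x * e`_j) : 'F_p) : nat)%:R in
  block_mx M 0 0 M.

(* Res_{F/F_p} GL(2) is the group of F-linear automorphisms of F^2, inside the
   group of F_p-linear ones. *)
Definition resGL2 : set 'M[k]_(d + d) :=
  [set g | g \in unitmx /\
           forall x, g *m scalar_mx2 x = scalar_mx2 x *m g].

Definition frob m (g : 'M[k]_(d + d, m)) : 'M[k]_(d + d, m) :=
  map_mx (fun c => c ^+ p) g.

Variable mu : k -> 'M[k]_(d + d).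

Definition parP := parabolic resGL2 mu (-1).
Definition parQ := [set frob g | g in parabolic resGL2 mu 1].

Definition levi (a : 'M[k]_(d + d)) : 'M[k]_(d + d) :=
  xget 0 [set l | weight_proj mu (-1) a l].

(* The Levi projection of Q is the Frobenius twist of that of P^+. *)
Definition zip_group (ab : 'M[k]_(d + d) * 'M[k]_(d + d)) : Prop :=
  parP ab.1 /\
  exists b0 bbar, [/\ parabolic resGL2 mu 1 b0, ab.2 = frob b0,
                      weight_proj mu 1 b0 bbar &
                      frob (levi ab.1) = frob bbar].

Definition zipE := {ab | zip_group ab}.

Definition zip_orbit (g : 'M[k]_(d + d)) : set 'M[k]_(d + d) :=
  [set (sval h).1 *m g *m invmx (sval h).2 | h in [set: zipE]].

(* w lists every E-orbit in G exactly once, by representatives. *)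
Definition zip_reps m (w : 'I_m -> 'M[k]_(d + d)) : Prop :=
  [/\ forall j, resGL2 (w j),
      forall j j', zip_orbit (w j) = zip_orbit (w j') -> j = j' &
      forall g, resGL2 g -> exists j, zip_orbit g = zip_orbit (w j)].

(** Edidin-Graham approximation.  GL_n x GL_n, n = 2d, acts freely on the pairs of
    n x (n+N) matrices of rank n, the complement of which has codimension N+1 in the
    space of all pairs.  So for i <= N the i-th E-equivariant Chow group of G is the
    i-th Chow group of the quotient of zip_space N by E. *)
Definition zip_ambient N : vectType k :=
  ('M[k]_(d + d) * ('M[k]_(d + d, d + d + N) * 'M[k]_(d + d, d + d + N)))%type.

Definition zip_space N (Z : set 'M[k]_(d + d)) : set (zip_ambient N) :=
  [set x | [/\ Z x.1, \rank x.2.1 = (d + d)%N & \rank x.2.2 = (d + d)%N]].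

Definition zip_act N (h : zipE) (x : zip_ambient N) : zip_ambient N :=
  let: (a, b) := sval h in
  (a *m x.1 *m invmx b, (a *m x.2.1, b *m x.2.2)).

Definition stratum_closure N (g : 'M[k]_(d + d)) : set (zip_ambient N) :=
  zip_space (zclosure_in resGL2 (zip_orbit g)).

(** Griffiths module of a subrepresentation r of the natural representation. *)
Definition subrep (r : {vspace 'cV[k]_(d + d)}) : Prop :=
  forall g v, resGL2 g -> v \in r -> g *m v \in r.

(* Fil^i is the sum of the weight spaces of weight -j, j >= i. *)
Definition fil (r : {vspace 'cV[k]_(d + d)}) (i : int) :=
  vspace_of [set v | exists (N : nat) (u : nat -> 'cV[k]_(d + d)),
    (forall t, u t \in r /\ weight mu (- (i + t%:Z)) (u t)) /\
    v = \sum_(t < N) u t].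

(* S contains the degrees of all the terms Fil^i other than 0 and r; it may
   contain finitely many others. *)
Definition retained (r : {vspace 'cV[k]_(d + d)}) (S : seq int) : Prop :=
  uniq S /\ forall i, fil r i <> 0%VS -> fil r i <> r -> i \in S.

(* The direct sum of the Fil^i, i in S: column j is the component in Fil^(S_j). *)
Definition grif r (S : seq int) : {vspace 'M[k]_(d + d, size S)} :=
  vspace_of [set w | forall j, col j w \in fil r S`_j].

Definition grif_act m (h : zipE) (w : 'M[k]_(d + d, m)) := levi (sval h).1 *m w.

Definition is_chern_grif r S (N i : nat) (c : cycle (zip_ambient N)) : Prop :=
  is_chern (zip_space resGL2) (@zip_act N) (@grif_act _) (grif r S) i c.

(** The coefficients.  F^2 (x) k is the direct sum over i in Z/d of the planes V_i on
    which F acts through the embedding tau^(p^i). *)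
Variable tau : {rmorphism F -> k}.

Definition plane (i : nat) : {vspace 'cV[k]_(d + d)} :=
  vspace_of [set v | forall x, scalar_mx2 x *m v = tau x ^+ (p ^ i) *: v].

Definition stable_line (A : set 'M[k]_(d + d)) (v : 'cV[k]_(d + d)) : Prop :=
  v != 0 /\ forall a, A a -> exists c, a *m v = c *: v.

(* g maps the line of V_i stable under Q to the line stable under P, i.e. P and
   g Q g^-1 have the same component at i. *)
Definition aligned (g : 'M[k]_(d + d)) (i : nat) : bool :=
  `[< exists v, [/\ v \in plane i, stable_line parQ v &
                    stable_line parP (g *m v)] >].

(* Number of retained Fil^n that meet V_i in a line. *)
Definition grif_mult r (S : seq int) (i : nat) : nat :=
  count (fun n => \dim (fil r n :&: plane i) == 1%N) S.

(* The stratum of g has codimension #|I|, I = {i in Z/d | aligned g i}.  Its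
   coefficient in c_i, for i = #|I| > 0 and m_j = grif_mult r S j, is
     (1 + (-1)^i p^-d)^-1 * prod_(j in I) sum_(1 <= s <= gap j) m_(j-s) p^-s
   where gap j is the least s >= 1 with j - s in I.  Derivation: let l_j be the first
   Chern class of the P-stable line of V_j.  The closed stratum of I is the transverse
   intersection of the divisors D_j, j in I, with [D_j] = p l_(j-1) - l_j, and
   c(Grif) = prod_j (1 + m_j l_j) with l_j^2 = 0.  If j' follows j in the cyclically
   ordered set J, then
     l_j - p^-(j'-j) l_j' = sum_(j < i <= j') p^-(i-j) [D_i],
   and the product of these over j in J is (1 + (-1)^#|J| p^-d) prod_(j in J) l_j. *)
Definition grif_coef r (S : seq int) (i : nat) (g : 'M[k]_(d + d)) : rat :=
  let I := aligned g in
  if count I (iota 0 d) != i then 0 else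
  if i == 0%N then 1 else
  (\prod_(j < d | I j)
     \sum_(1 <= s < d.+1 | all (fun t => ~~ I (j + d - t)%N) (iota 1 s.-1))
       (grif_mult r S (j + d - s))%:R / p%:R ^+ s)
  / (1 + (-1) ^+ i / p%:R ^+ d).

End Zip.

Arguments resGL2 k {p d F} e.

(* Main.v *)
Require Import Defs.
(* Over k, F^2 (x) k is a sum of planes V_i, i in Z/d, and mu splits V_i into two weight
   lines, distinct because P is solvable.  In adapted coordinates g in G has 2 x 2 blocks
   g_i; an E-orbit is the set I of the i at which the entry g_i(2,1) vanishes, and its
   closure is the linear section g_i(2,1) = 0, i in I.  P(Grif) is filtered by the linear
   sections Y I j: the stratum I, the first j coordinates of the bundle being 0.  There
   the j-th coordinate is a section of O(1) twisted by a character y of E.  The entries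
   of g_i invertible on the stratum identify y with the p-th power of another character
   up to a divisor; after 2d steps the divisor of a rational function expresses
   (1 - p^2d) y by smaller strata.  Horner's rule then telescopes to the recursion
   chern_vec.  It is solved in Q[l_i]/(l_i^2), where the coefficients come from the trace
   of a product of 2 x 2 transfer matrices. *)

(* A Chern class is certified here by exhibiting cycles, sections and rational functions. All cycles
   are open parts of linear subspaces, where an order of vanishing is the exponent of a linear form.
   The obstacle: [c1_cap] asks for sections of O(1) itself, whereas a coordinate of the bundle is
   twisted by a character y. The auxiliary matrices of the Edidin-Graham approximation supply a
   section with character y, but its divisor is not made of strata. The Frobenius iteration supplies
   one whose divisor is; comparing the two gives a rational function that exchanges the divisors, at
   the cost of a denominator 1 - p^2d. One turn around Z/d may swap the two lines of V_i, hence two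
   turns. Signs in [chern_vec] hide positivity. But the 2^d classes of strata form a basis of
   Q[l_i]/(l_i^2), so coefficients can be compared in that ring; there the trace identity produces
   (1 + (-1)^m p^-d) c_m in degree m > 0, which is the origin of the denominator in the formula. *)
From HB Require Import structures.
From mathcomp Require Import all_boot all_order all_algebra all_field.
From mathcomp Require Import ring zify.
Set Implicit Arguments.
Unset Strict Implicit.
Unset Printing Implicit Defensive.

Import Order.TTheory GRing.Theory Num.Theory.
Local Open Scope ring_scope.

(* Functions on subsets of T with the product
   (f g)(I) = \sum_(J subset I) f(J) g(I \ J):
   the quotient of Q[l_i, i in T] by the squares l_i^2, in its monomial basis. *)
Definition sqfree (T : finType) := {ffun {set T} -> rat}.
HB.instance Definition _ (T : finType) := GRing.Lmodule.copy (sqfree T) {ffun {set T} -> rat^o}.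
HB.instance Definition _ (T : finType) := Vector.copy (sqfree T) {ffun {set T} -> rat^o}.

(** * The square-zero polynomial algebra and its grading *)

Section SquareFree.
Variable T : finType.
Implicit Types (f g h : sqfree T) (I J K : {set T}).

Definition sqmul f g : sqfree T := [ffun I : {set T} => \sum_(J : {set T} | J \subset I) f J * g (I :\: J)].
Definition sqone : sqfree T := [ffun I : {set T} => (I == set0)%:R].

Lemma sqmulC : commutative sqmul.
Proof.
move=> f g; apply/ffunP => I; rewrite !ffunE.
rewrite (reindex_onto (fun J => I :\: J) (fun J => I :\: J)) /=; last first.
  by move=> J JI; rewrite setDDr setDv set0U; apply/setIidPr.
apply: eq_big => [J|J]; last by rewrite mulrC => /andP[_ /eqP ->].
rewrite subsetDl /=; apply/eqP/idP => [<-|JI]; first exact: subsetDl.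
by rewrite setDDr setDv set0U; apply/setIidPr.
Qed.

Lemma sqmulA : associative sqmul.
Proof.
move=> f g h; apply/ffunP => I; rewrite !ffunE.
under eq_bigr => J _ do rewrite ffunE mulr_sumr.
under [in RHS]eq_bigr => J _ do rewrite ffunE mulr_suml.
rewrite [in RHS](exchange_big_dep (fun K => K \subset I)) /=; last first.
  by move=> J K JI KJ; apply: subset_trans JI.
apply: eq_bigr => K KI.
(* A nested pair K, J with K inside J corresponds to the disjoint pair K, L = J minus K. *)
rewrite [in RHS](reindex_onto (fun L => K :|: L) (fun J => J :\: K)) /=; last first.
  by move=> J /andP[_ KJ]; apply/setP => x; rewrite !inE;
     move/subsetP: KJ => /(_ x); case: (x \in K); case: (x \in J) => //= ->.
apply: eq_big => [L|L].
  apply/idP/andP.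
    rewrite subsetD => /andP[LI dLK]; rewrite subUset KI LI subsetUl; split=> //.
    by rewrite setDUl setDv set0U; apply/eqP/setDidPl.
  move=> [/andP[]]; rewrite subUset => /andP[_ LI] _ /eqP <-.
  by rewrite setDUl setDv set0U; apply: setSD.
rewrite subsetD => /andP[LI dLK].
have -> : (K :|: L) :\: K = L by rewrite setDUl setDv set0U; apply/setDidPl.
by rewrite mulrA setDDl.
Qed.

Lemma sqmul1 : left_id sqone sqmul.
Proof.
move=> f; apply/ffunP => I; rewrite !ffunE (bigD1 set0) ?sub0set //= ffunE eqxx mul1r.
rewrite setD0 big1 ?addr0 // => J /andP[_ J0]; by rewrite ffunE (negPf J0) mul0r.
Qed.

Lemma sqmulDl : left_distributive sqmul +%R.
Proof.
move=> f g h; apply/ffunP => I; rewrite !ffunE -big_split /=.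
by apply: eq_bigr => J _; rewrite ffunE mulrDl.
Qed.

Lemma sqone_neq0 : sqone != 0.
Proof. by apply/eqP => /ffunP/(_ set0); rewrite !ffunE eqxx. Qed.

HB.instance Definition _ := GRing.Zmodule_isComNzRing.Build (sqfree T)
  sqmulA sqmulC sqmul1 sqmulDl sqone_neq0.

Lemma sqaddE f g I : (f + g) I = f I + g I.
Proof. by rewrite ffunE. Qed.
Lemma sqoppE f I : (- f) I = - f I.
Proof. by rewrite ffunE. Qed.
Lemma sqzeroE I : (0 : sqfree T) I = 0.
Proof. by rewrite ffunE. Qed.
Lemma sqscaleE (a : rat) f I : (a *: f) I = a * f I.
Proof. by rewrite ffunE. Qed.

Lemma sqscaleAl (a : rat) f g : a *: (f * g) = (a *: f) * g.
Proof.
apply/ffunP => I; rewrite sqscaleE !ffunE mulr_sumr.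
by apply: eq_bigr => J _; rewrite sqscaleE mulrA.
Qed.
HB.instance Definition _ := GRing.Lmodule_isLalgebra.Build rat (sqfree T) sqscaleAl.
HB.instance Definition _ := GRing.Lalgebra_isComAlgebra.Build rat (sqfree T).

Definition sqvar (i : T) : sqfree T := [ffun J : {set T} => (J == [set i])%:R].

Lemma sqmulE f g I : (f * g) I = \sum_(J : {set T} | J \subset I) f J * g (I :\: J).
Proof. by rewrite ffunE. Qed.
Lemma sqoneE I : (1 : sqfree T) I = (I == set0)%:R.
Proof. by rewrite ffunE. Qed.

Lemma sqvar_mulE i f J : (sqvar i * f) J = if i \in J then f (J :\ i) else 0.
Proof.
rewrite sqmulE; case: ifP => iJ.
  rewrite (bigD1 [set i]) ?sub1set //= ffunE eqxx mul1r big1 ?addr0 // => K /andP[_ Ki].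
  by rewrite ffunE (negPf Ki) mul0r.
rewrite big1 // => K KJ; rewrite ffunE; case: eqP => [Ki|]; last by rewrite mul0r.
by move: KJ; rewrite Ki sub1set iJ.
Qed.

Lemma sqvar2 i : sqvar i * sqvar i = 0.
Proof.
apply/ffunP => J; rewrite sqvar_mulE !ffunE; case: ifP => // iJ.
by case: eqP => // E; have := set11 i; rewrite -E !inE eqxx.
Qed.

Lemma prod_sqvarE I J : (\prod_(i in I) sqvar i) J = (J == I)%:R.
Proof.
have [n] := ubnP #|I|; elim: n I J => // n IH I J cI.
case: (set_0Vmem I) => [->|[i iI]]; first by rewrite big_set0 sqoneE.
rewrite (big_setD1 i) //= sqvar_mulE IH; last by move: cI; rewrite (cardsD1 i) iI.
case: ifP => iJ; last by case: eqP => // E; rewrite E iI in iJ.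
congr (_ %:R); congr (nat_of_bool _); apply/eqP/eqP => [E|->//].
by rewrite -(setD1K iJ) E setD1K.
Qed.

Lemma sqfree_decomp f : f = \sum_(I : {set T}) f I *: \prod_(i in I) sqvar i.
Proof.
apply/ffunP => J; rewrite sum_ffunE (bigD1 J) //= sqscaleE prod_sqvarE eqxx mulr1.
by rewrite big1 ?addr0 // => I IJ; rewrite sqscaleE prod_sqvarE eq_sym (negPf IJ) mulr0.
Qed.

Definition sqhom m f : sqfree T := [ffun J : {set T} => if #|J| == m then f J else 0].
Definition homog m f := forall J, f J != 0 -> #|J| = m.

Lemma sqhom_var0 i f : sqhom 0 (sqvar i * f) = 0.
Proof.
apply/ffunP => J; rewrite !ffunE -[in LHS]sqmulE sqvar_mulE cards_eq0.
by case: eqP => // ->; rewrite inE.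
Qed.

Lemma sqhom_varS m i f : sqhom m.+1 (sqvar i * f) = sqvar i * sqhom m f.
Proof.
apply/ffunP => J; rewrite ffunE !sqvar_mulE ffunE; case: (boolP (i \in J)) => iJ.
  by rewrite (cardsD1 i J) iJ eqSS.
by rewrite if_same.
Qed.

Lemma sqhom_sum m (I : finType) (P : pred I) (F : I -> sqfree T) :
  sqhom m (\sum_(i | P i) F i) = \sum_(i | P i) sqhom m (F i).
Proof.
apply/ffunP => J; rewrite !ffunE !sum_ffunE; case: ifP => cJ.
  by apply: eq_bigr => i _; rewrite ffunE cJ.
by rewrite big1 // => i _; rewrite ffunE cJ.
Qed.

Lemma sqhomD m f g : sqhom m (f + g) = sqhom m f + sqhom m g.
Proof. by apply/ffunP => J; rewrite sqaddE !ffunE; case: (_ == m); rewrite ?addr0. Qed.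

Lemma sqhomZ m a f : sqhom m (a *: f) = a *: sqhom m f.
Proof. by apply/ffunP => J; rewrite ffunE !sqscaleE ffunE; case: ifP; rewrite ?mulr0. Qed.

Lemma sqhom_homog m n f : homog n f -> sqhom m f = if m == n then f else 0.
Proof.
move=> hf; apply/ffunP => J; rewrite ffunE.
case: (eqVneq (f J) 0) => [fJ|/hf ->]; first by rewrite fJ; case: ifP; case: ifP; rewrite ?ffunE.
by rewrite eq_sym; case: ifP; rewrite ?ffunE.
Qed.

Lemma homogM m n f g : homog m f -> homog n g -> homog (m + n) (f * g).
Proof.
move=> hf hg J; rewrite sqmulE => /eqP nz.
have /existsP[K /andP[KJ /eqP fgK]] :
    [exists K : {set T}, (K \subset J) && (f K * g (J :\: K) != 0)].
  apply: contra_notT nz => /existsPn H; apply: big1 => K KJ.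
  by have := H K; rewrite KJ /= negbK => /eqP.
have fK : f K != 0 by apply: contra_not_neq fgK => ->; rewrite mul0r.
have gK : g (J :\: K) != 0 by apply: contra_not_neq fgK => ->; rewrite mulr0.
by rewrite -(hf K fK) -(hg _ gK) -(cardsID K J) (setIidPr KJ).
Qed.

Lemma homog_prod (I : {set T}) (F : T -> sqfree T) :
  (forall i, homog 1 (F i)) -> homog #|I| (\prod_(i in I) F i).
Proof.
move=> hF; have [n] := ubnP #|I|; elim: n I => // n IH I cI.
case: (set_0Vmem I) => [->|[i iI]].
  by rewrite big_set0 cards0 => J; rewrite sqoneE; case: (eqVneq J set0) => // ->; rewrite cards0.
rewrite (big_setD1 i) //= (cardsD1 i) iI; apply: homogM => //; apply: IH.
by move: cI; rewrite (cardsD1 i) iI.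
Qed.

(** The automorphism sending each l_i to -l_i. It acts on degree m by (-1)^m, which becomes the sign
    in the denominator of [gap_coef]. *)
Definition sqsign f : sqfree T := [ffun J : {set T} => (-1) ^+ #|J| * f J].

Lemma sqsignM : {morph sqsign : f g / f * g}.
Proof.
move=> f g; apply/ffunP => J; rewrite ffunE !sqmulE mulr_sumr; apply: eq_bigr => K KJ.
rewrite !ffunE mulrACA -exprD; congr (_ ^+ _ * _).
by rewrite -(cardsID K J) (setIidPr KJ).
Qed.
Lemma sqsign1 : sqsign 1 = 1.
Proof.
apply/ffunP => J; rewrite ffunE sqoneE; case: eqP => [->|]; last by rewrite mulr0.
by rewrite cards0 expr0 mulr1.
Qed.
Lemma sqsign_var a i : sqsign (1 + a *: sqvar i) = 1 - a *: sqvar i.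
Proof.
apply/ffunP => J; rewrite ffunE !sqaddE sqoppE sqscaleE sqoneE /sqvar ffunE.
case: (eqVneq J set0) => [->|J0].
  have -> : (set0 == [set i]) = false by rewrite eq_sym -cards_eq0 cards1.
  by rewrite cards0 expr0 mul1r mulr0 ?oppr0 ?addr0.
case: (eqVneq J [set i]) => [->|_]; last by rewrite !mulr0 ?oppr0 ?addr0 ?mulr0.
by rewrite cards1 !add0r expr1 mulN1r.
Qed.
Lemma sqhom_sign m f : sqhom m (sqsign f) = (-1) ^+ m *: sqhom m f.
Proof.
apply/ffunP => J; rewrite sqscaleE !ffunE; case: eqP => [->|]; first by [].
by rewrite mulr0.
Qed.

End SquareFree.

(** * Classes of line bundles and of strata, and the recursion for Chern classes *)

Section CyclicStrata.
Variables (p d : nat).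
Hypothesis p_gt1 : (1 < p)%N.
Local Notation R := (sqfree 'I_d).
Implicit Types (I J : {set 'I_d}) (y : 'I_d * bool) (x : R).

(** The two lines of a plane have opposite classes: the determinant of g_i is nowhere zero and
    identifies the determinant of V_i with p times the preceding one, so that it is torsion after
    one turn around Z/d. *)
Definition line_class y : R := if y.2 then - sqvar y.1 else sqvar y.1.
(** Class of the entry g_i(2,1), a section for the character of (i, true) divided by the p-th power
    of the character of (i - 1, true). *)
Definition divisor_class i : R := p%:R *: sqvar (ord_pred i) - sqvar i.
Definition stratum_class I : R := \prod_(i in I) divisor_class i.
Definition stratum_basis I : R := [ffun J : {set 'I_d} => (J == I)%:R].
(** The type [R] has two uses: the argument is a vector of coefficients on the strata, the value an
    element of the ring. Only the latter is ever multiplied. *)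
Definition realize x : R := \sum_(I : {set 'I_d}) x I *: stratum_class I.

(* On the stratum I there is a section of the line bundle with class
   y - p * prev_line I y and divisor line_step I y.  As prev_line I has order dividing
   2d, the sum of the p^s times these divisors represents (1 - p^2d) y. *)
Definition prev_line I y := (ord_pred y.1, y.2 (+) (y.1 \in I)).
Definition line_step I y : R :=
  if y.1 \in I then 0 else (-1) ^+ (~~ y.2) *: stratum_basis (y.1 |: I).
Definition cap_basis y I : R := (1 - p%:R ^+ (d + d))^-1 *:
  \sum_(s < d + d) p%:R ^+ s *: line_step I (iter s (prev_line I) y).
Definition cap_line y x : R := \sum_(I : {set 'I_d}) x I *: cap_basis y I.

Lemma combination_linear (F : {set 'I_d} -> R) :
  linear (fun x : R => \sum_(I : {set 'I_d}) x I *: F I : R).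
Proof.
move=> a x x'; rewrite scaler_sumr -big_split /=; apply: eq_bigr => I _.
by rewrite sqaddE sqscaleE scalerDl scalerA; congr (_ + _).
Qed.
HB.instance Definition _ :=
  GRing.isLinear.Build rat R R *:%R realize (combination_linear stratum_class).
HB.instance Definition _ y :=
  GRing.isLinear.Build rat R R *:%R (cap_line y) (combination_linear (cap_basis y)).

Lemma sum_stratum_basis (F : {set 'I_d} -> R) I :
  \sum_(J : {set 'I_d}) stratum_basis I J *: F J = F I.
Proof.
rewrite (bigD1 I) //= ffunE eqxx scale1r big1 ?addr0 // => J JI.
by rewrite ffunE (negPf JI) scale0r.
Qed.
Lemma realize_basis I : realize (stratum_basis I) = stratum_class I.
Proof. exact: sum_stratum_basis. Qed.
(** The product is p^2 l_(i-1)^2 - l_i^2. Geometrically, for i in I the diagonal entries of g_i are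
    invertible and identify a line of V_i with p times the opposite line one index earlier. *)
Lemma divisor_rel i : divisor_class i * (p%:R *: sqvar (ord_pred i) + sqvar i) = 0.
Proof.
rewrite /divisor_class mulrDr !mulrBl -!scalerAl -!scalerAr !sqvar2 !scaler0.
by rewrite sub0r subr0 [sqvar i * _]mulrC addNr.
Qed.

(** For i outside I the bracket is plus or minus [divisor_class i], the factor that the larger
    stratum has in addition. For i in I that factor is already present in [stratum_class I], and
    [divisor_rel] annihilates the product. *)
Lemma realize_step I y :
  realize (line_step I y) =
  (line_class y - p%:R *: line_class (prev_line I y)) * stratum_class I.
Proof.
case: y => i b; rewrite /line_step /prev_line /line_class /=; case: ifP => iI /=.
  rewrite raddf0 /stratum_class (big_setD1 i) //= mulrA [X in X * _](_ : _ = 0) ?mul0r //.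
  case: b => /=; first by rewrite addrC -opprD mulNr mulrC divisor_rel oppr0.
  by rewrite scalerN opprK addrC mulrC divisor_rel.
rewrite linearZ /= realize_basis /stratum_class big_setU1 ?iI //= /divisor_class.
case: b => /=; first by rewrite expr0 scale1r scalerN opprK addrC.
by rewrite expr1 scaleN1r -mulNr opprB.
Qed.

Lemma iter_ord_pred n (i : 'I_d) :
  iter n (@ord_pred d) i = ((i + n * d.-1) %% d)%N :> nat.
Proof.
elim: n => [|n IH] /=; first by rewrite mul0n addn0 modn_small.
rewrite IH; move: i {IH}; case: d => [[]//|d'] i /=.
by rewrite addnS /= modnDml mulSn -addnA [(n * _ + _)%N]addnC.
Qed.

Lemma iter_ord_predd (i : 'I_d) : iter d (@ord_pred d) i = i.
Proof. by apply: ord_inj; rewrite iter_ord_pred addnC mulnC modnMDl modn_small. Qed.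

(** One turn returns to the same index and adds a boolean that does not depend on the line; the
    second turn cancels it. *)
Lemma iter_prev_line I y : iter (d + d) (prev_line I) y = y.
Proof.
have H n i : exists c, forall b,
    iter n (prev_line I) (i, b) = (iter n (@ord_pred d) i, b (+) c).
  elim: n => [|n [c IH]]; first by exists false => b; rewrite addbF.
  exists (c (+) (iter n (@ord_pred d) i \in I)) => b.
  by rewrite iterS IH /prev_line /= addbA.
case: y => i b; have [c Hc] := H d i.
by rewrite iterD !Hc iter_ord_predd Hc iter_ord_predd -addbA addbb addbF.
Qed.


Hypothesis d_gt0 : (0 < d)%N.

Lemma cap_norm_neq0 : (1 - p%:R ^+ (d + d) : rat) != 0.
Proof.
rewrite subr_eq0 eq_sym -natrX pnatr_eq1 -[1%N](expn0 p) eqn_exp2l //.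
by rewrite -lt0n addn_gt0 d_gt0.
Qed.

(** By [realize_step] the sum telescopes to u_0 - p^2d u_2d, and u_2d = u_0 by periodicity, so the
    prefactor cancels 1 - p^2d. *)
Lemma realize_cap_basis y I : realize (cap_basis y I) = line_class y * stratum_class I.
Proof.
rewrite linearZ linear_sum /=.
pose u s := line_class (iter s (prev_line I) y) * stratum_class I.
have E s : realize (p%:R ^+ s *: line_step I (iter s (prev_line I) y)) =
    p%:R ^+ s *: u s - p%:R ^+ s.+1 *: u s.+1.
  by rewrite linearZ /= realize_step mulrBl scalerBr -scalerAl scalerA exprSr.
under eq_bigr => s _ do rewrite E.
rewrite -(big_mkord xpredT (fun s => p%:R ^+ s *: u s - p%:R ^+ s.+1 *: u s.+1)).
rewrite -[X in _ *: X]opprK -sumrN.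
under eq_bigr => s _ do rewrite opprB.
rewrite (telescope_sumr (fun s => p%:R ^+ s *: u s)) // opprB expr0 scale1r.
rewrite {2}/u iter_prev_line -[line_class y * _]/(u 0%N) -{1}[u 0%N]scale1r -scalerBl scalerA.
by rewrite mulVf ?scale1r // cap_norm_neq0.
Qed.

Lemma realize_cap y x : realize (cap_line y x) = line_class y * realize x.
Proof.
rewrite /cap_line linear_sum mulr_sumr; apply: eq_bigr => I _.
by rewrite linearZ /= realize_cap_basis -scalerAr.
Qed.

Lemma sqvar_realize i x : exists x', sqvar i * realize x = realize x'.
Proof. by exists (cap_line (i, false) x); rewrite realize_cap. Qed.

(** The image contains 1 and is stable under multiplication by each l_i, thanks to [cap_line]; so it
    contains all monomials. *)
Lemma realize_surj f : exists x, realize x = f.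
Proof.
suff [F EF] : exists F, forall I : {set 'I_d}, realize (F I) = \prod_(i in I) sqvar i.
  exists (\sum_(I : {set 'I_d}) f I *: F I); rewrite [RHS]sqfree_decomp linear_sum.
  by apply: eq_bigr => I _; rewrite linearZ /= EF.
suff H I : exists x, realize x == \prod_(i in I) sqvar i.
  by exists (fun I => xchoose (H I)) => I; apply/eqP/(xchooseP (H I)).
have [n] := ubnP #|I|; elim: n I => // n IH I cI.
case: (set_0Vmem I) => [->|[i iI]].
  by exists (stratum_basis set0); rewrite realize_basis /stratum_class !big_set0.
rewrite (big_setD1 i) //=; have [|x /eqP <-] := IH (I :\ i).
  by move: cI; rewrite (cardsD1 i) iI.
by have [x' ->] := sqvar_realize i x; exists x'.
Qed.

(** A surjective endomorphism of a finite-dimensional space is injective. This permits identities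
    between coefficients on strata to be checked in the ring. *)
Lemma realize_inj : injective realize.
Proof.
pose f : 'End(R) := linfun realize.
have /lker0P fI : lker f == 0%VS.
  rewrite -dimv_eq0; have := limg_ker_dim f fullv; rewrite capfv.
  have -> : limg f = fullv.
    apply/eqP; rewrite eqEsubv subvf; apply/subvP => x _.
    by have [x' <-] := realize_surj x; rewrite -[realize x']lfunE memv_img ?memvf.
  by move=> /eqP; rewrite -[X in _ == X]add0n eqn_add2r.
by move=> x x' E; apply: fI; rewrite !lfunE.
Qed.

(** The recursion of elementary symmetric functions, with multiplication by a line class replaced by
    its lift [cap_line] to coefficients on strata. *)
Fixpoint chern_vec (ys : seq ('I_d * bool)) (m : nat) : R :=
  match ys, m with
  | [::], 0 => stratum_basis set0
  | [::], _.+1 => 0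
  | y :: ys', 0 => chern_vec ys' 0
  | y :: ys', m'.+1 => chern_vec ys' m'.+1 + cap_line y (chern_vec ys' m')
  end.

Lemma chern_vec0 ys : chern_vec ys 0 = stratum_basis set0.
Proof. by elim: ys. Qed.

Lemma chern_vec_oversize ys m : (size ys < m)%N -> chern_vec ys m = 0.
Proof.
elim: ys m => [|y ys IH] [|m] //= sm.
by rewrite !IH ?linear0 ?addr0 // ltnW.
Qed.

Lemma realize_chern_vec ys m :
  realize (chern_vec ys m) = sqhom m (\prod_(y <- ys) (1 + line_class y)).
Proof.
elim: ys m => [|y ys IH] m.
  rewrite big_nil; have h1 : homog 0 (1 : R).
    by move=> J; rewrite sqoneE; case: (eqVneq J set0) => // ->; rewrite cards0.
  rewrite (sqhom_homog _ h1); case: m => [|m] /=; last by rewrite raddf0.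
  by rewrite realize_basis /stratum_class big_set0.
have hN f n : sqhom n (- f : R) = - sqhom n f by rewrite -!scaleN1r sqhomZ.
rewrite big_cons mulrDl mul1r sqhomD -IH; case: m => [|m] /=.
  have -> : sqhom 0 (line_class y * \prod_(j <- ys) (1 + line_class j)) = 0.
    by rewrite /line_class; case: y.2; rewrite ?mulNr ?hN sqhom_var0 ?oppr0.
  by rewrite addr0.
rewrite linearD /= realize_cap IH; congr (_ + _); set X := \prod_(_ <- _) _.
by rewrite IH /line_class; case: y.2; rewrite ?mulNr ?hN sqhom_varS ?mulNr.
Qed.

End CyclicStrata.

(** * Transfer matrices and the trace identity *)

Section TwoByTwo.
Variable A : comNzRingType.
Definition mat2 (a b c e : A) : 'M[A]_2 :=
  \matrix_(i, j) if i == 0 then (if j == 0 then a else b) else (if j == 0 then c else e).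

Lemma mat2M a b c e a' b' c' e' : mat2 a b c e * mat2 a' b' c' e' =
  mat2 (a * a' + b * c') (a * b' + b * e') (c * a' + e * c') (c * b' + e * e').
Proof.
apply/matrixP => i j; rewrite !mxE !big_ord_recl big_ord0 !mxE /= addr0.
by case: i j => [[|[|//]] ?] [[|[|//]] ?].
Qed.
Lemma mat2D a b c e a' b' c' e' : mat2 a b c e + mat2 a' b' c' e' =
  mat2 (a + a') (b + b') (c + c') (e + e').
Proof. by apply/matrixP => i j; rewrite !mxE; case: ifP; case: ifP. Qed.
Lemma mat2Z x a b c e : x *: mat2 a b c e = mat2 (x * a) (x * b) (x * c) (x * e).
Proof. by apply/matrixP => i j; rewrite !mxE; case: ifP; case: ifP. Qed.
Lemma mat2_1 : 1 = mat2 1 0 0 1.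
Proof. by apply/matrixP => i j; rewrite !mxE; case: i j => [[|[|//]] ?] [[|[|//]] ?]. Qed.
Lemma mat2_tr a b c e : \tr (mat2 a b c e) = a + e.
Proof. by rewrite /mxtrace !big_ord_recl big_ord0 addr0 !mxE. Qed.
End TwoByTwo.
Lemma map_mat2 (A B : comNzRingType) (f : {rmorphism A -> B}) a b c e :
  map_mx f (mat2 a b c e) = mat2 (f a) (f b) (f c) (f e).
Proof. by apply/matrixP => i j; rewrite !mxE; case: ifP; case: ifP. Qed.

(** The conjugating unipotents cancel between neighbouring factors, and also at the two ends since
    [lam d = lam 0] and the trace is cyclic. What remains is triangular, and its two diagonal
    entries are the two products. *)
Lemma transfer_trace (A : comNzRingType) (lam c : nat -> A) (P q : A) (d : nat) :
  P * q = 1 -> (forall n, lam n * lam n = 0) -> lam d = lam 0%N ->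
  \tr (\prod_(0 <= i < d) mat2 1 (c i) (P * (q * lam i - lam i.+1))
      (P + P * (q * lam i - lam i.+1) * c i)) =
  \prod_(0 <= i < d) (1 + c i * lam i.+1) +
  P ^+ d * \prod_(0 <= i < d) (1 - c i * lam i.+1).
Proof.
move=> Pq lam2 lamd.
pose L n := mat2 1 0 (lam n) 1; pose L' n := mat2 1 0 (- lam n) 1.
pose U n := mat2 (1 + c n * lam n.+1) (c n) 0 (P * (1 - c n * lam n.+1)).
(* Conjugation by the unipotents L n makes the factors upper triangular. *)
have TE n : mat2 1 (c n) (P * (q * lam n - lam n.+1))
      (P + P * (q * lam n - lam n.+1) * c n) = L n * U n * L' n.+1.
  rewrite !mat2M; have l2 := lam2 n.+1; congr mat2.
  - by ring.
  - by ring.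
  - transitivity ((P * q) * lam n - P * lam n.+1); first by ring.
    rewrite Pq; transitivity (lam n - P * lam n.+1 +
      P * c n * (lam n.+1 * lam n.+1)); last by ring.
    by rewrite l2; ring.
  - transitivity (P + (P * q) * lam n * c n - P * lam n.+1 * c n); first by ring.
    by rewrite Pq; ring.
have LL n : L' n * L n = 1 by rewrite mat2M mat2_1; congr mat2; ring.
have LL' n : L n * L' n = 1 by rewrite mat2M mat2_1; congr mat2; ring.
have prodT n : \prod_(0 <= i < n) (L i * U i * L' i.+1) =
    L 0%N * (\prod_(0 <= i < n) U i) * L' n.
  elim: n => [|n IH]; first by rewrite !big_nil mulr1 LL'.
  by rewrite !big_nat_recr //= IH -!mulrA (mulrA (L' n)) LL mul1r.
have prodU n : exists b, \prod_(0 <= i < n) U i =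
   mat2 (\prod_(0 <= i < n) (1 + c i * lam i.+1)) b 0
        (P ^+ n * \prod_(0 <= i < n) (1 - c i * lam i.+1)).
  elim: n => [|n [b Eb]]; first by exists 0; rewrite !big_nil mat2_1 expr0 mulr1.
  rewrite !big_nat_recr //= Eb mat2M; eexists; congr mat2; try by ring.
  by rewrite exprS; ring.
rewrite (eq_bigr _ (fun i _ => TE i)) prodT /L' lamd -/(L' 0%N).
have trC (X Y : 'M[A]_2) : \tr (X * Y) = \tr (Y * X) by exact: mxtrace_mulC.
rewrite -mulrA trC -mulrA LL mulr1.
by have [b ->] := prodU d; rewrite mat2_tr.
Qed.

(** * The closed formula for the coefficients and its positivity *)

Section GapFormula.
Variables (p d : nat).
Hypotheses (p_gt1 : (1 < p)%N) (d_gt0 : (0 < d)%N).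
Local Notation R := (sqfree 'I_d).
Variable mu : nat -> nat.
Hypothesis mu_per : forall j, mu (j + d)%N = mu j.

Definition gap_sum (J : nat -> bool) (j : nat) : rat :=
  \sum_(1 <= s < d.+1 | all (fun t => ~~ J (j + d - t)%N) (iota 1 s.-1))
    (mu (j + d - s))%:R / p%:R ^+ s.

Definition gap_coef (J : nat -> bool) (m : nat) : rat :=
  if count J (iota 0 d) != m then 0 else
  if m == 0%N then 1 else
  (\prod_(j < d | J j) gap_sum J j) / (1 + (-1) ^+ m / p%:R ^+ d).

Let P : rat := p%:R^-1.
(** Constant term and coefficient of the divisor class in the i-th factor of [transfer_trace]:
    expanding the product over subsets I places [mdiv] at the indices in I and [mstep] at the
    others. *)
Let mstep x : 'M[rat]_2 := mat2 1 (mu x)%:R 0 P.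
Let mdiv x : 'M[rat]_2 := mat2 0 0 P (P * (mu x)%:R).

Lemma P_neq0 : (p%:R : rat) != 0.
Proof. by rewrite pnatr_eq0; case: p p_gt1. Qed.

(** Passing from j to j + 1 lengthens the gap by one, unless j lies in J, where the gap has length
    one and only the term s = 1 survives. *)
Lemma gap_sumS (J : nat -> bool) j :
  (forall j, J (j + d)%N = J j) -> (exists2 j, (j < d)%N & J j) ->
  gap_sum J j.+1 = P * ((mu j)%:R + (if J j then 0 else gap_sum J j)).
Proof.
move=> Jper [j0 j0d Jj0]; rewrite /gap_sum big_ltn_cond //=.
rewrite addSn subn1 /= mu_per expr1 mulrDr; congr (_ + _); first exact: mulrC.
have E s : (0 < s)%N -> all (fun t => ~~ J ((j + d).+1 - t)%N) (iota 1 s) =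
   ~~ J j && all (fun t => ~~ J (j + d - t)%N) (iota 1 s.-1).
  case: s => [//|s] _ /=; rewrite subn1 /= Jper; congr (_ && _).
  by rewrite (iotaDl 1 1) all_map; apply: eq_all => t /=; rewrite add1n subSS.
case: ifP => Jj.
  rewrite mulr0 big_nat_cond big_pred0 // => -[|[|s]] //.
  by rewrite -[s.+2.-1]/s.+1 E // Jj andbF.
have Jmul n q : J (n + q * d)%N = J n.
  by elim: q => [|q IH]; rewrite ?mul0n ?addn0 // mulSnr addnA Jper.
rewrite big_mkcond [in RHS]big_mkcond big_add1 /= [in RHS]big_nat_recr //=.
(* The term s = d for j vanishes: its condition says that J misses the d - 1 residues before j, and
   it misses j too, but j0 lies in J. *)
rewrite [X in _ + X](_ : _ = 0) ?addr0; last first.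
  case: ifP => // /allP H; have Ej := divn_eq j d; set a := (j %% d)%N in Ej.
  have ad : (a < d)%N by rewrite ltn_mod.
  set q := (j %/ d)%N in Ej.
  have Ja : ~~ J a by rewrite -(Jmul a q) addnC -Ej Jj.
  case: (ltngtP a j0) => [aj|aj|aj]; last by move: Ja; rewrite aj Jj0.
    have : ~~ J (j + d - (a + d - j0))%N by apply: H; rewrite mem_iota; lia.
    have -> : (j + d - (a + d - j0) = j0 + q * d)%N by lia.
    by rewrite Jmul Jj0.
  have : ~~ J (j + d - (a - j0))%N by apply: H; rewrite mem_iota; lia.
  have -> : (j + d - (a - j0) = j0 + q.+1 * d)%N by rewrite mulSn; lia.
  by rewrite Jmul Jj0.
rewrite mulr_sumr !big_nat; apply: eq_bigr => s /andP[s0 sd]; rewrite E //.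
rewrite Jj /=; case: ifP => _; last by rewrite mulr0.
by rewrite subSS exprS invfM mulrCA.
Qed.

(** For empty J the product is upper triangular with diagonal 1, P^d. Otherwise a factor [mdiv]
    makes it singular, and the trace can be read off from a single row vector. *)
Lemma trace_strata (J : nat -> bool) :
  (forall j, J (j + d)%N = J j) ->
  \tr (\prod_(i < d) (if J i then mdiv i else mstep i)) =
  if [exists i : 'I_d, J i] then \prod_(j < d | J j) gap_sum J j else 1 + P ^+ d.
Proof.
move=> Jper; rewrite -(big_mkord xpredT (fun i => if J i then mdiv i else mstep i)).
pose M n := \prod_(0 <= i < n) (if J i then mdiv i else mstep i).
rewrite -/(M d); have MS n : M n.+1 = M n * (if J n then mdiv n else mstep n).
  by rewrite /M big_nat_recr.
have M0 : M 0%N = mat2 1 0 0 1 by rewrite /M big_nil mat2_1.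
case: existsP => [[j0 Jj0]|nJ]; last first.
  suff [b ->] : exists b, M d = mat2 1 b 0 (P ^+ d) by rewrite mat2_tr.
  have : (d <= d)%N by []; elim: {-2}d => [|n IH] nd; first by exists 0; rewrite M0.
  have [b Eb] := IH (ltnW nd); rewrite MS Eb.
  have -> : J n = false by apply/negP => Jn; apply: nJ; exists (Ordinal nd).
  by rewrite mat2M !mulr0 !mul0r !mulr1 !addr0 add0r exprSr; eexists.
have ex : exists2 j, (j < d)%N & J j by exists j0.
(* The row vector (1, p * gap_sum J n) is an eigenvector of the n-th partial
   product up to the shift in n; the product has rank 1. *)
pose h n := p%:R * gap_sum J n.
have hS n : h n.+1 = (mu n)%:R + (if J n then 0 else gap_sum J n).
  by rewrite /h gap_sumS // mulrA divff ?mul1r // P_neq0.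
have hP n : h n * P = gap_sum J n by rewrite /h mulrAC divff ?mul1r // P_neq0.
have hd : h d = h 0%N.
  rewrite /h /gap_sum; congr (_ * _); rewrite [LHS]big_nat_cond [RHS]big_nat_cond.
  have E n : (n <= d)%N -> (d + d - n = 0 + d - n + d)%N by lia.
  apply: eq_big => [s|s /andP[sd _]]; last by rewrite E ?mu_per //; lia.
  case: (boolP (0 < s < d.+1)%N) => //= sd; apply: eq_in_all => t.
  by rewrite mem_iota => td; rewrite E ?Jper //; lia.
pose g n := if J n then gap_sum J n else 1.
have row0 n : exists a b c e, M n = mat2 a b c e /\
   (a + h 0%N * c = \prod_(0 <= j < n) g j /\
    b + h 0%N * e = (\prod_(0 <= j < n) g j) * h n).
  elim: n => [|n [a [b [c [e [EM [E1 E2]]]]]]].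
    by exists 1, 0, 0, 1; rewrite M0 big_nil mulr0 addr0 mul1r mulr1 add0r.
  rewrite MS EM big_nat_recr //= hS /g; case: ifP => Jn; rewrite mat2M; do 4 eexists; (split; first by []).
    rewrite !mulr0 !add0r addr0 -hP; split.
      by transitivity ((b + h 0%N * e) * P); [ring | rewrite E2; ring].
    by transitivity ((b + h 0%N * e) * P * (mu n)%:R); [ring | rewrite E2; ring].
  rewrite -hP !mulr0 !mulr1 !addr0 E1; split=> //.
  transitivity ((a + h 0%N * c) * (mu n)%:R + (b + h 0%N * e) * P); first by ring.
  by rewrite E1 E2; ring.
(* Once an index of J has occurred, the second row is proportional to (1, h n). So the trace a + e
   is a + c h(d), and h(d) = h(0) turns it into the first entry of the row vector in [row0]. *)
have row1 n : exists a b c e, M n = mat2 a b c e /\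
   ((exists2 j, (j < n)%N & J j) -> e = c * h n) /\
   (~ (exists2 j, (j < n)%N & J j) -> c = 0).
  elim: n => [|n [a [b [c [e [EM [E1 E2]]]]]]].
    by exists 1, 0, 0, 1; rewrite M0; split=> //; split=> // -[].
  rewrite MS EM hS; case: ifP => Jn; rewrite mat2M; do 4 eexists; (split; first by []).
    by split=> [_|[]]; [ring | exists n].
  rewrite !mulr0 !addr0 !mulr1; split=> [[j jn Jj]|nj].
    have jn' : (j < n)%N by rewrite ltn_neqAle -ltnS jn andbT; apply: contraFneq Jn => <-.
    by rewrite E1; [rewrite -mulrA hP mulrDr | exists j].
  by rewrite E2 // => -[j jn Jj]; apply: nj; exists j => //; apply: ltnW.
have [a [b [c [e [EM [E1 E2]]]]]] := row0 d.
have [a' [b' [c' [e' [EM' [E1' _]]]]]] := row1 d.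
have [Ec Ee] : c = c' /\ e = e'.
  have := EM; rewrite EM' => /matrixP H; have := H 1 0; have := H 1 1.
  by rewrite !mxE.
rewrite EM mat2_tr Ee E1' // -Ec hd mulrC E1 big_mkord [RHS]big_mkcond /=.
by apply: eq_bigr.
Qed.

Let ordd n : 'I_d := Ordinal (ltn_pmod n d_gt0).
(** The offset makes [lam n] the variable l_(n-1), so that the i-th factor involves l_(i-1) and
    l_i. *)
Let lam n : R := sqvar (ordd (n + d.-1)).

Lemma lam_sq n : lam n * lam n = 0. Proof. exact: sqvar2. Qed.
Lemma lamS (i : 'I_d) : lam i.+1 = sqvar i.
Proof.
rewrite /lam; congr sqvar; apply: ord_inj => /=.
by rewrite addSnnS prednK // modnDr modn_small.
Qed.
Lemma lam_pred (i : 'I_d) : lam i = sqvar (ord_pred i).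
Proof.
rewrite /lam; congr sqvar; apply: ord_inj => /=.
by case: d d_gt0 i => [//|d'] _ i /=; rewrite addnS.
Qed.
Lemma lam_d : lam d = lam 0.
Proof. by rewrite /lam; congr sqvar; apply: ord_inj; rewrite /= add0n modnDl. Qed.

(** Both sides are the trace of one product of matrices over the ring: the left one expands it in
    the divisor classes, the right one evaluates it by [transfer_trace]. The second product is the
    first with all l_i negated. *)
Lemma trace_transfer :
  \sum_(I : {set 'I_d}) \tr (\prod_(i < d) (if i \in I then mdiv i else mstep i))
     *: stratum_class p I =
  \prod_(i < d) (1 + (mu i)%:R *: sqvar i) +
  P ^+ d *: \prod_(i < d) (1 - (mu i)%:R *: sqvar i) :> R.
Proof.
pose f : {rmorphism rat -> R} := in_alg R.
pose dc n : R := p%:R *: lam n - lam n.+1.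
pose T n := map_mx f (mstep n) + dc n *: map_mx f (mdiv n).
transitivity (\tr (\prod_(i < d) T i)).
  rewrite /T [in RHS](eq_bigr (fun i : 'I_d => dc i *: map_mx f (mdiv i) + map_mx f (mstep i))); last first.
    by move=> i _; rewrite addrC.
  rewrite bigA_distr linear_sum; apply: eq_bigr => I _ /=.
  rewrite (eq_bigr (fun i => (if i \in I then dc i else 1) *:
      map_mx f (if i \in I then mdiv i else mstep i))); last first.
    by move=> i _; case: ifP => // _; rewrite scale1r.
  rewrite scaler_prod mxtraceZ -big_mkcond -rmorph_prod /= trace_map_mx.
  rewrite /stratum_class mulrC /f /= -scalerAl mul1r; congr (_ *: _).
  by apply: eq_bigr => i _; rewrite /divisor_class /dc lamS lam_pred.
pose c n : R := f (mu n)%:R.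
have fP : f P * f p%:R = 1 by rewrite -rmorphM mulVf ?P_neq0 // rmorph1.
have fE (a : rat) (x : R) : a *: x = f a * x by rewrite /f /= -scalerAl mul1r.
have TE n : T n = mat2 1 (c n) (f P * (f p%:R * lam n - lam n.+1))
      (f P + f P * (f p%:R * lam n - lam n.+1) * c n).
  rewrite /T /mstep /mdiv !map_mat2 mat2Z mat2D rmorph1 rmorph0 rmorphM -/(c n) /dc fE.
  rewrite !mulr0 !addr0 add0r; congr mat2; first exact: mulrC.
  by rewrite mulrA [_ * f P]mulrC.
rewrite -(big_mkord xpredT T) (eq_bigr _ (fun i _ => TE i)).
rewrite transfer_trace ?lam_d //; last exact: lam_sq.
rewrite !big_mkord; congr (_ + _); last rewrite fE rmorphXn; last congr (_ * _).
  by apply: eq_bigr => i _; rewrite fE lamS.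
by apply: eq_bigr => i _; rewrite fE lamS.
Qed.

(** The degree m part of [trace_transfer] expresses (1 + (-1)^m p^-d) times the m-th Chern class by
    strata with m elements; [realize_inj] then identifies the coefficients. *)
Lemma gap_coef_expansion (J : {set 'I_d} -> nat -> bool) (ys : seq ('I_d * bool)) m
    (I : {set 'I_d}) :
  (forall I j, J I (j + d)%N = J I j) -> (forall I (i : 'I_d), J I i = (i \in I)) ->
  \prod_(y <- ys) (1 + line_class y) = \prod_(i < d) (1 + (mu i)%:R *: sqvar i) :> R ->
  chern_vec p ys m I = gap_coef (J I) m.
Proof.
move=> Jper JI Eys.
suff -> : chern_vec p ys m = [ffun I => gap_coef (J I) m] by rewrite ffunE.
have cnt K : count (J K) (iota 0 d) = #|K|.
  rewrite -val_enum_ord count_map enumT cardE /enum_mem size_filter.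
  by apply: eq_count => i /=; apply: JI.
(* Degree 0 is separate, as in the definition of [gap_coef]: the general formula would divide the
   empty product by 1 + p^-d. *)
case: m => [|m].
  rewrite chern_vec0.
  apply/ffunP => K; rewrite !ffunE /gap_coef cnt cards_eq0.
  by case: (K == set0).
apply: (realize_inj p_gt1 d_gt0); rewrite realize_chern_vec // Eys.
set V := \prod_(i < d) _; pose N : rat := 1 + (-1) ^+ m.+1 * P ^+ d.
have N0 : N != 0.
  (* If N were 0, squaring would give p^-2d = 1, which [cap_norm_neq0] excludes. *)
  rewrite /N addrC addr_eq0; apply/eqP => E.
  have : ((-1) ^+ m.+1 * P ^+ d) ^+ 2 = 1 by rewrite E expr2 mulrNN mulr1.
  rewrite exprMn -exprM mulnC exprM sqrrN !expr1n mul1r -exprM muln2 -addnn.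
  rewrite /P exprVn => E2; have := cap_norm_neq0 p_gt1 d_gt0.
  by rewrite -[X in 1 - X]invrK E2 invr1 subrr eqxx.
apply: (scalerI N0); rewrite /N scalerDl scale1r -scalerA scalerA mulrC -scalerA.
have := congr1 (sqhom m.+1) trace_transfer.
have -> : \prod_(i < d) (1 - (mu i)%:R *: sqvar i) = sqsign V.
  rewrite (big_morph _ (@sqsignM _) (@sqsign1 _)); apply: eq_bigr => i _.
  by rewrite sqsign_var.
rewrite sqhomD sqhomZ sqhom_sign => <-; rewrite sqhom_sum /realize scaler_sumr.
apply: eq_bigr => K _; rewrite sqhomZ ffunE (sqhom_homog _ (_ : homog #|K| _)); last first.
  apply: homog_prod => i L; rewrite /divisor_class sqaddE sqoppE sqscaleE !ffunE.
  case: (eqVneq L [set ord_pred i]) => [->|_]; first by rewrite cards1.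
  case: (eqVneq L [set i]) => [->|_]; first by rewrite cards1.
  by rewrite mulr0 subr0 eqxx.
rewrite /gap_coef cnt eq_sym; case: eqP => [cK|]; last by rewrite scaler0 scale0r scaler0.
have NE : 1 + (-1) ^+ m.+1 / p%:R ^+ d = N by rewrite /N /P exprVn.
rewrite NE scalerA; congr (_ *: _).
rewrite [P ^+ d * _]mulrC -/N mulrCA divff // mulr1.
have := @trace_strata (J K) (Jper K).
rewrite (eq_bigr (fun i : 'I_d => if i \in K then mdiv i else mstep i)); last by move=> i _; rewrite JI.
move=> ->; case: existsP => // nK; case: (set_0Vmem K) => [K0|[i iK]].
  by move: cK; rewrite K0 cards0.
by case: nK; exists i; rewrite JI.
Qed.

(** All terms of the gap sums are nonnegative; the denominator is at least 1 - p^-d, which is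
    nonnegative as well. *)
Lemma gap_coef_ge0 (J : nat -> bool) m : 0 <= gap_coef J m.
Proof.
rewrite /gap_coef; case: ifP => // _; case: ifP => // _.
have ge0 : 0 <= \prod_(j < d | J j) gap_sum J j.
  by apply: prodr_ge0 => j _; apply: sumr_ge0 => s _; rewrite divr_ge0 ?exprn_ge0.
rewrite divr_ge0 //; case: (boolP (odd m)) => om; last first.
  by rewrite -signr_odd (negPf om) expr0 addr_ge0 ?divr_ge0 ?exprn_ge0.
rewrite -signr_odd om expr1 mulN1r subr_ge0 invf_le1 -natrX ?ler1n ?ltr0n expn_gt0;
  by rewrite (ltnW p_gt1).
Qed.

End GapFormula.

From mathcomp Require Import boolp classical_sets.
From mathcomp Require Import mpoly.
Local Open Scope classical_set_scope.
Local Open Scope ring_scope.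

(** * Polynomial functions on a vector space and on its linear subspaces *)

Section PolynomialFunctions.
Variables (k : closedFieldType).

(** If q were nonzero, q X + 1 would be nonconstant and have a root t, but its value there is q(t) t
    + 1 = 1. This is the form in which infinity of k is used. *)
Lemma horner_fun0 (q : {poly k}) : (forall t, q.[t] = 0) -> q = 0.
Proof.
move=> q0; apply/eqP; apply/negPn/negP=> qn0.
have sz : size (q * 'X + 1%:P) != 1%N.
  rewrite size_MXaddC (negPf qn0) /=.
  by rewrite eqSS size_poly_eq0.
have [t] := elimT (closed_rootP _) sz.
by rewrite /root !hornerE q0 mul0r add0r oner_eq0.
Qed.

Variable V : vectType k.
Implicit Types (f g : coord_ring V) (L : {vspace V}) (x y v : V).

Lemma pevalD f g v : peval (f + g) v = peval f v + peval g v.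
Proof. exact: mevalD. Qed.
Lemma pevalM f g v : peval (f * g) v = peval f v * peval g v.
Proof. exact: mevalM. Qed.
Lemma pevalC c v : peval (c%:MP : coord_ring V) v = c.
Proof. exact: mevalC. Qed.
Lemma pevalN f v : peval (- f) v = - peval f v.
Proof. exact: mevalN. Qed.
Lemma pevalB f g v : peval (f - g) v = peval f v - peval g v.
Proof. by rewrite pevalD pevalN. Qed.
Lemma peval1 v : peval (1 : coord_ring V) v = 1.
Proof. exact: meval1. Qed.
Lemma pevalX f n v : peval (f ^+ n) v = peval f v ^+ n.
Proof. exact: rmorphXn. Qed.
Lemma peval_prod (I : Type) (s : seq I) (P : pred I) (F : I -> coord_ring V) v :
  peval (\prod_(i <- s | P i) F i) v = \prod_(i <- s | P i) peval (F i) v.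
Proof. exact: rmorph_prod. Qed.
Lemma peval_sum (I : Type) (s : seq I) (P : pred I) (F : I -> coord_ring V) v :
  peval (\sum_(i <- s | P i) F i) v = \sum_(i <- s | P i) peval (F i) v.
Proof. exact: raddf_sum. Qed.

Lemma coord_ring_ind (P : coord_ring V -> Prop) :
  (forall c, P c%:MP) -> (forall i, P 'X_i) ->
  (forall f g, P f -> P g -> P (f + g)) ->
  (forall f g, P f -> P g -> P (f * g)) -> forall f, P f.
Proof.
move=> PC PX PD PM; apply: mpolyind => [|c m f _ _ Pf]; first by rewrite -mpolyC0; apply: PC.
apply: (PD _ _ _ Pf); rewrite -mul_mpolyC; apply: (PM _ _ (PC c)).
have PXn i n : P ('X_i ^+ n).
  by elim: n => [|n IH]; rewrite ?expr0 ?exprS -?mpolyC1; [exact: PC | exact: PM].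
by rewrite mpolyXE_id; apply: big_ind => //; rewrite -mpolyC1; apply: PC.
Qed.

Definition lin_poly (phi : 'Hom(V, k^o)) : coord_ring V :=
  \sum_(i < \dim {:V}) (phi (vbasis {:V})`_i : k)%:MP * 'X_i.

Lemma peval_lin phi v : peval (lin_poly phi) v = phi v.
Proof.
rewrite [in RHS](coord_vbasis (memvf v)) linear_sum /= peval_sum.
by apply: eq_bigr => i _; rewrite pevalM pevalC /peval mevalXU linearZ /= mulrC.
Qed.

Definition polyfun (F : V -> k) := exists f, forall v, peval f v = F v.

Lemma polyfun_const c : polyfun (fun=> c).
Proof. by exists c%:MP => v; rewrite pevalC. Qed.
Lemma polyfun_lin (phi : 'Hom(V, k^o)) : polyfun phi.
Proof. by exists (lin_poly phi) => v; rewrite peval_lin. Qed.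
Lemma polyfunD F G : polyfun F -> polyfun G -> polyfun (fun v => F v + G v).
Proof. by move=> [f fE] [g gE]; exists (f + g) => v; rewrite pevalD fE gE. Qed.
Lemma polyfunM F G : polyfun F -> polyfun G -> polyfun (fun v => F v * G v).
Proof. by move=> [f fE] [g gE]; exists (f * g) => v; rewrite pevalM fE gE. Qed.
Lemma polyfun_sum (I : Type) (s : seq I) (P : pred I) (F : I -> V -> k) :
  (forall i, polyfun (F i)) -> polyfun (fun v => \sum_(i <- s | P i) F i v).
Proof.
move=> PF; have [f fE] := choice PF; exists (\sum_(i <- s | P i) f i) => v.
by rewrite peval_sum; apply: eq_bigr.
Qed.
Lemma polyfun_prod (I : Type) (s : seq I) (P : pred I) (F : I -> V -> k) :
  (forall i, polyfun (F i)) -> polyfun (fun v => \prod_(i <- s | P i) F i v).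
Proof.
move=> PF; have [f fE] := choice PF; exists (\prod_(i <- s | P i) f i) => v.
by rewrite peval_prod; apply: eq_bigr.
Qed.
Lemma polyfun_det n (M : V -> 'M[k]_n) :
  (forall i j, polyfun (fun v => M v i j)) -> polyfun (fun v => \det (M v)).
Proof.
move=> PM; apply: polyfun_sum => s; apply: polyfunM; first exact: polyfun_const.
by apply: polyfun_prod => i.
Qed.
Lemma linear_lfun (F : V -> k) : linear (F : V -> k^o) ->
  exists phi : 'Hom(V, k^o), forall v, phi v = F v.
Proof.
move=> lF; pose LF := GRing.isLinear.Build k V k^o *:%R F lF.
pose F' : {linear V -> k^o} := HB.pack F LF.
by exists (linfun F') => v; rewrite lfunE.
Qed.
Lemma polyfun_linear (F : V -> k) : linear (F : V -> k^o) -> polyfun F.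
Proof.
by move=> /linear_lfun[phi E]; have [f fE] := polyfun_lin phi; exists f => v; rewrite fE E.
Qed.

Lemma peval_comp f (A : 'End(V)) : polyfun (fun v => peval f (A v)).
Proof.
elim/coord_ring_ind: f => [c|i|f g [f' Ef] [g' Eg]|f g [f' Ef] [g' Eg]].
- by exists c%:MP => v; rewrite !pevalC.
- apply: polyfun_linear => a u v; rewrite /peval !mevalXU.
  by rewrite !linearP.
- by exists (f' + g') => v; rewrite !pevalD Ef Eg.
- by exists (f' * g') => v; rewrite !pevalM Ef Eg.
Qed.

Lemma peval_line f x y : exists q : {poly k}, forall t, q.[t] = peval f (x + t *: y).
Proof.
elim/coord_ring_ind: f => [c|i|f g [f' Ef] [g' Eg]|f g [f' Ef] [g' Eg]].
- by exists c%:P => v; rewrite pevalC hornerC.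
- exists ((coord (vbasis {:V}) i x)%:P + coord (vbasis {:V}) i y *: 'X) => t.
  by rewrite /peval mevalXU !hornerE linearD linearZ /= mulrC.
- by exists (f' + g') => v; rewrite !pevalD hornerD Ef Eg.
- by exists (f' * g') => v; rewrite !pevalM hornerM Ef Eg.
Qed.

(** Points where f, respectively g, does not vanish are joined by a line in L; on it both are
    nonzero polynomials in one variable, with nonzero product. *)
Lemma peval_lin_irred L f g :
  (forall v, v \in L -> peval f v * peval g v = 0) ->
  (forall v, v \in L -> peval f v = 0) \/ (forall v, v \in L -> peval g v = 0).
Proof.
move=> fg0; apply: contrapT => /not_orP[/existsNP[x /not_implyP[xL fx]]].
move=> /existsNP[y /not_implyP[yL gy]].
have [qf Ef] := peval_line f x (y - x); have [qg Eg] := peval_line g x (y - x).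
have /eqP : qf * qg = 0.
  apply: horner_fun0 => t; rewrite hornerM Ef Eg fg0 //.
  by rewrite memvD // memvZ // memvB.
rewrite mulf_eq0 => /orP[/eqP q0|/eqP q0].
  by apply: fx; rewrite -[x]addr0 -(scale0r (y - x)) -Ef q0 horner0.
by apply: gy; rewrite -[y](subrK x) addrC -[y - x]scale1r -Eg q0 horner0.
Qed.

(** The forms tested are the coordinates of u minus its projection to L; they vanish on L, and
    together only there. *)
Lemma memv_lin L v : (forall phi : 'Hom(V, k^o),
   (forall u, u \in L -> phi u = 0) -> phi v = 0) -> v \in L.
Proof.
move=> H; suff -> : v = projv L v by rewrite memv_proj.
apply/eqP; rewrite -subr_eq0; set w := v - _.
rewrite (coord_vbasis (memvf w)) big1 // => i _.
pose F := (fun u : V => coord (vbasis {:V}) i (u - projv L u)) : V -> k^o.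
have lF : linear F.
  by move=> a u u'; rewrite /F linearP opprD addrACA -scalerN -scalerDr linearP.
have [phi phiE] := linear_lfun lF.
have Fv : F v = 0.
  by rewrite -phiE; apply: H => u uL; rewrite phiE /F projv_id // subrr linear0.
by rewrite [coord _ i w]Fv scale0r.
Qed.

(* Taylor expansion to first order along a complement of the hyperplane. *)
Lemma peval_divide L (lam : 'Hom(V, k^o)) f :
  (exists2 v, v \in L & lam v != 0) ->
  (forall v, v \in (L :&: lker lam)%VS -> peval f v = 0) ->
  exists g, forall v, v \in L -> peval f v = lam v * peval g v.
Proof.
move=> [v0 v0L lv0] f0.
have lpi : linear (fun v : V => ((lam v0)^-1 * lam v : k) *: v0).
  by move=> a u v; rewrite linearP /= mulrDr scalerDl mulrCA -scalerA.
pose LF := GRing.isLinear.Build k V V *:%R _ lpi.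
pose F' : {linear V -> V} := HB.pack (fun v : V => ((lam v0)^-1 * lam v : k) *: v0) LF.
pose Pi : 'End(V) := (\1 - linfun F')%VF.
have PiE v : Pi v = v - ((lam v0)^-1 * lam v : k) *: v0.
  by rewrite !lfun_simp.
suff [g Eg] : exists g, forall v, peval f v - peval f (Pi v) = lam v * peval g v.
  exists g => v vL; rewrite -Eg (f0 (Pi v)) ?subr0 // PiE memv_cap memv_ker.
  rewrite memvB ?memvZ //= linearB linearZ /=.
  by rewrite /GRing.scale /= mulrAC mulVf // mul1r subrr.
elim/coord_ring_ind: f {f0} => [c|i|f g [f' Ef] [g' Eg]|f g [f' Ef] [g' Eg]].
- by exists (0%:MP) => v; rewrite !pevalC mulr0 subrr.
- exists ((lam v0)^-1 * coord (vbasis {:V}) i v0)%:MP => v.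
  rewrite /peval !mevalXU mevalC PiE linearB linearZ /= opprB addrCA subrr addr0.
  by rewrite mulrA [lam v * _]mulrC.
- by exists (f' + g') => v; rewrite !pevalD mulrDr -Ef -Eg opprD addrACA.
- have [h Eh] := peval_comp g Pi.
  exists (f * g' + f' * h) => v; rewrite !pevalD !pevalM Eh.
  rewrite mulrDr [X in _ = _ + X]mulrA -Ef [X in _ = X + _]mulrCA -Eg.
  by rewrite mulrBl mulrBr addrA subrK.
Qed.

(** Restriction to a line through a point with f nonzero, in a direction where lam is nonzero,
    bounds the exponent by the size of a polynomial. At the maximal exponent, [peval_divide]
    prevents the cofactor from vanishing on the hyperplane. *)
Lemma peval_lin_order L (lam : 'Hom(V, k^o)) f :
  (exists2 v, v \in L & lam v != 0) -> ~ (forall v, v \in L -> peval f v = 0) ->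
  exists e g, (forall v, v \in L -> peval f v = lam v ^+ e * peval g v) /\
    ~ (forall v, v \in (L :&: lker lam)%VS -> peval g v = 0).
Proof.
move=> Hlam fn0.
pose P e := `[< exists g, forall v, v \in L -> peval f v = lam v ^+ e * peval g v >].
have P0 : exists e, P e.
  by exists 0%N; apply/asboolP; exists f => v _; rewrite expr0 mul1r.
have [x xL fx] : exists2 x, x \in L & peval f x <> 0.
  by apply: contrapT => H; apply: fn0 => v vL; apply: contrapT => fv; apply: H; exists v.
have [v0 v0L lv0] := Hlam.
have [q Eq] := peval_line f x v0.
have qn0 : q != 0.
  by apply/eqP => q0; apply: fx; rewrite -[x]addr0 -(scale0r v0) -Eq q0 horner0.
have Pb e : P e -> (e <= size q)%N.
  move=> /asboolP[g Eg]; have [q' Eq'] := peval_line g x v0.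
  have qE : q = ((lam x : k)%:P + (lam v0 : k) *: 'X) ^+ e * q'.
    apply/eqP; rewrite -subr_eq0; apply/eqP; apply: horner_fun0 => t.
    have El : lam (x + t *: v0) = lam x + lam v0 * t :> k.
      by rewrite linearD linearZ /= /GRing.scale /= [t * _]mulrC.
    by rewrite !hornerE Eq Eg ?memvD ?memvZ // Eq' El subrr.
  have sl : size ((lam x : k)%:P + (lam v0 : k) *: 'X) = 2%N.
    rewrite addrC -mul_polyC size_MXaddC polyC_eq0 (negPf lv0) /= size_polyC.
    by rewrite lv0.
  have q'0 : q' != 0 by apply: contraNneq qn0 => q'0; rewrite qE q'0 mulr0.
  have l0 : (lam x : k)%:P + (lam v0 : k) *: 'X != 0 by rewrite -size_poly_eq0 sl.
  rewrite qE size_mul ?expf_neq0 //.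
  have := size_exp ((lam x : k)%:P + (lam v0 : k) *: 'X) e.
  rewrite sl mul1n => se; rewrite -{1}se -!subn1; apply: leq_sub2r; exact: leq_addr.
case: (ex_maxnP P0 Pb) => e /asboolP[g Eg] emax; exists e, g; split=> // g0.
have [h Eh] := peval_divide Hlam g0.
suff : (e.+1 <= e)%N by rewrite ltnn.
apply: emax; apply/asboolP; exists h => v vL.
by rewrite Eg // Eh // mulrA exprSr.
Qed.

End PolynomialFunctions.

(** * Prime divisors and orders of vanishing on open parts of linear subspaces *)

Section LinearSections.
Variables (k : closedFieldType) (V : vectType k).
Variable Om : set V.
Hypothesis Om_open :
  exists S : set (coord_ring V), forall v, Om v <-> exists2 f, S f & peval f v != 0.
Variable L0 : {vspace V}.
Implicit Types (L : {vspace V}) (D : set V).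

Definition lin_sect L : set V := [set v | v \in L /\ Om v].
Let X := lin_sect L0.

(** If h is nonzero at a point of the section and nonzero only on the open set, f h vanishes on L;
    since h does not, f does. *)
Lemma lin_sect_dense L f : lin_sect L !=set0 ->
  (forall v, lin_sect L v -> peval f v = 0) -> forall v, v \in L -> peval f v = 0.
Proof.
move=> [x [xL Ox]] f0; have [S OS] := Om_open.
have [h Sh hx] := (OS x).1 Ox.
have fh v : v \in L -> peval f v * peval h v = 0.
  move=> vL; case: (eqVneq (peval h v) 0) => [->|hv]; first by rewrite mulr0.
  by rewrite f0 ?mul0r //; split=> //; apply/OS; exists h.
by have [//|h0] := peval_lin_irred fh; move: hx; rewrite h0 // eqxx.
Qed.

Lemma lin_sect_irred L f g :
  (forall v, lin_sect L v -> peval f v * peval g v = 0) ->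
  (forall v, lin_sect L v -> peval f v = 0) \/
  (forall v, lin_sect L v -> peval g v = 0).
Proof.
move=> fg; have [nn|nn] := pselect (lin_sect L !=set0); last by left=> v Lv; case: nn; exists v.
have fg0 v : v \in L -> peval f v * peval g v = 0.
  by rewrite -pevalM; apply: lin_sect_dense => // u Lu; rewrite pevalM fg.
by have [H|H] := peval_lin_irred fg0; [left | right] => v [vL _]; apply: H.
Qed.

Lemma vanishing_lin_sect L f : lin_sect L !=set0 ->
  vanishing (lin_sect L) f <-> forall v, v \in L -> peval f v = 0.
Proof.
by move=> nn; split=> [|f0 v [vL _]]; [exact: lin_sect_dense | exact: f0].
Qed.

Lemma zclosed_vspace L : zclosed [set v | v \in L].
Proof.
exists [set f | forall v, v \in L -> peval f v = 0].
rewrite predeqE => v; split=> [vL f|H]; first by apply.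
apply: memv_lin => phi phi0; rewrite -peval_lin; apply: H => u uL.
by rewrite peval_lin phi0.
Qed.

Lemma closed_irred (T Z : set V) :
  (forall f g, (forall v, Z v -> peval f v * peval g v = 0) ->
     (forall v, Z v -> peval f v = 0) \/ (forall v, Z v -> peval g v = 0)) ->
  forall Z1 Z2, zclosed_in T Z1 -> zclosed_in T Z2 ->
    Z `<=` Z1 `|` Z2 -> Z `<=` Z1 \/ Z `<=` Z2.
Proof.
move=> irr Z1 Z2 [_ [S1 ->] ->] [_ [S2 ->] ->] Z12.
apply: contrapT => /not_orP[/existsNP[x /not_implyP[Zx xZ1]]].
move=> /existsNP[y /not_implyP[Zy yZ2]].
have ZT v : Z v -> T v by move=> /Z12[[]|[]].
have [f S1f fx] : exists2 f, S1 f & peval f x <> 0.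
  apply: contrapT => H; apply: xZ1; split=> [|f Sf]; first exact: ZT.
  by apply: contrapT => fx; apply: H; exists f.
have [g S2g gy] : exists2 g, S2 g & peval g y <> 0.
  apply: contrapT => H; apply: yZ2; split=> [|g Sg]; first exact: ZT.
  by apply: contrapT => gy; apply: H; exists g.
have [v Zv|H|H] := irr f g; last 2 first.
- by apply: fx; apply: H.
- by apply: gy; apply: H.
- by have [[_ H]|[_ H]] := Z12 v Zv; rewrite ?(H f S1f) ?(H g S2g) ?mul0r ?mulr0.
Qed.

Lemma subvariety_irred (T Z : set V) : subvariety T Z ->
  forall f g, (forall v, Z v -> peval f v * peval g v = 0) ->
    (forall v, Z v -> peval f v = 0) \/ (forall v, Z v -> peval g v = 0).
Proof.
move=> [[C Cc ZC] _ irr] f g fg.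
have ZT v : Z v -> T v by rewrite ZC => -[].
pose Zf h := T `&` [set v | forall f, f = h -> peval f v = 0].
have cl h : zclosed_in T (Zf h).
  by exists [set v | forall f, f = h -> peval f v = 0] => //; exists [set h].
have [v Zv|H|H] := irr (Zf f) (Zf g) (cl f) (cl g).
- have /eqP := fg v Zv; rewrite mulf_eq0 => /orP[] /eqP E; [left|right].
    by split=> [|_ ->]; [exact: ZT|].
  by split=> [|_ ->]; [exact: ZT|].
- by left=> v /H[_]; apply.
- by right=> v /H[_]; apply.
Qed.

Lemma subvariety_lin_sect L : (L <= L0)%VS -> lin_sect L !=set0 ->
  subvariety X (lin_sect L).
Proof.
move=> LL0 nn; split=> //; last exact/closed_irred/lin_sect_irred.
exists [set v | v \in L]; first exact: zclosed_vspace.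
rewrite predeqE => v; split=> [[vL Ov]|[[_ Ov] vL]] //.
by split=> //; split=> //; apply: subvP vL.
Qed.

(** * Hyperplane sections *)
Variable L : {vspace V}.
Hypothesis LL0 : (L <= L0)%VS.
Hypothesis Ln0 : lin_sect L !=set0.

Section Hyperplane.
Variable lam : 'Hom(V, k^o).
Hypothesis lam_n0 : exists2 v, v \in L & lam v != 0.
Let L' := (L :&: lker lam)%VS.
Hypothesis L'n0 : lin_sect L' !=set0.

Lemma lin_sect_hyperE v : lin_sect L' v <-> lin_sect L v /\ lam v = 0 :> k.
Proof.
rewrite /lin_sect /= memv_cap memv_ker; split=> [[/andP[-> /eqP ->] ?]//|].
by move=> [[-> ?] ->]; rewrite eqxx.
Qed.

(** For maximality, take f vanishing on Z but not on the section of L and write f = lam^e g with g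
    not vanishing on the hyperplane. As Z is irreducible, lam or g vanishes on Z; the latter is
    impossible because Z contains the hyperplane section. *)
Lemma prime_divisor_hyper : prime_divisor X (lin_sect L) (lin_sect L').
Proof.
have L'L v : lin_sect L' v -> lin_sect L v by move=> /lin_sect_hyperE[].
split.
- by apply: subvariety_lin_sect => //; apply: subv_trans LL0; apply: capvSl.
- split=> [v /L'L//|H]; have [v0 v0L /negP[]] := lam_n0.
  have := @lin_sect_dense L (lin_poly lam) Ln0; rewrite -peval_lin.
  by move=> -> // v Lv; rewrite peval_lin; have /H/lin_sect_hyperE[] := Lv.
move=> Z vZ DZ ZY; have [->|ZnY] := pselect (Z = lin_sect L); [by right|left].
have [[C [S EC] EZ] _ _] := vZ.
have [f fZ [y Ly fy]] : exists2 f, vanishing Z f & exists2 y, lin_sect L y & peval f y <> 0.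
  apply: contrapT => H; apply: ZnY; rewrite predeqE => v; split=> [/ZY//|Lv].
  rewrite EZ EC; split; first by case: Lv => vL Ov; split=> //; apply: subvP vL.
  move=> f Sf; have [//|fv] := pselect (peval f v = 0).
  case: H; exists f; last by exists v.
  by move=> u; rewrite EZ EC => -[_]; apply.
have [e [g [Eg gn0]]] := @peval_lin_order _ _ L lam f lam_n0 (fun H => fy (H y Ly.1)).
have [v Zv|H|H] := subvariety_irred vZ (f := lin_poly lam) (g := g).
- have [Lv _] := ZY v Zv; have /eqP := fZ v Zv.
  rewrite Eg // mulf_eq0 expf_eq0 peval_lin => /orP[/andP[_ /eqP ->]|/eqP ->].
    by rewrite mul0r.
  by rewrite mulr0.
- rewrite predeqE => v; split=> [Zv|/DZ//]; apply/lin_sect_hyperE; split; first exact: ZY.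
  by rewrite -peval_lin H.
- by case: gn0; apply: lin_sect_dense => // v /DZ/H.
Qed.

(** This is the n-th power of the maximal ideal of the discrete valuation ring of the hyperplane.
    For saturation, let a have exact order e < n with cofactor h: cancelling lam^e in s a = lam^n g
    shows that s h vanishes on the hyperplane, hence s does. *)
Lemma local_ideal_divisible n : local_ideal (lin_sect L) (lin_sect L')
  [set f | exists g, forall v, v \in L -> peval f v = lam v ^+ n * peval g v].
Proof.
split.
- move=> f /(vanishing_lin_sect _ Ln0) f0; exists (0%:MP) => v vL.
  by rewrite f0 // pevalC mulr0.
- by move=> f g [f' Ef] [g' Eg]; exists (f' + g') => v vL; rewrite !pevalD Ef // Eg // mulrDr.
- by move=> f g [g' Eg]; exists (f * g') => v vL; rewrite !pevalM Eg // mulrCA.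
move=> s a sD [g Eg]; have [a0|/existsNP[y /not_implyP[yL ay]]] :=
    pselect (forall v, v \in L -> peval a v = 0).
  by exists (0%:MP) => v vL; rewrite a0 // pevalC mulr0.
have [e [h [Eh hn0]]] := peval_lin_order lam_n0 (fun H => ay (H y yL)).
case: (leqP n e) => ne.
  by exists (lin_poly lam ^+ (e - n) * h) => v vL;
     rewrite Eh // pevalM pevalX peval_lin mulrA -exprD subnKC.
have shg : forall v, v \in L -> peval (lin_poly lam ^+ e) v *
    peval (s * h - lin_poly lam ^+ (n - e) * g) v = 0.
  move=> v vL; rewrite pevalX peval_lin pevalB !pevalM pevalX peval_lin mulrBr.
  rewrite mulrCA -Eh // mulrA -exprD subnKC; last exact: ltnW.
  by rewrite -Eg // pevalM subrr.
have [H|H] := peval_lin_irred shg.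
  have [v vL /eqP lv] := lam_n0; case: lv; have /eqP := H v vL.
  by rewrite pevalX peval_lin expf_eq0 => /andP[_ /eqP].
have sh0 v : v \in L' -> peval s v * peval h v = 0.
  rewrite memv_cap memv_ker => /andP[vL /eqP lv]; have /eqP := H v vL.
  rewrite pevalB !pevalM pevalX peval_lin lv expr0n subn_eq0 leqNgt ne /=.
  by rewrite mul0r subr0 => /eqP.
have [s0|//] := peval_lin_irred sh0.
by case: sD => v [vL _]; apply: s0.
Qed.

(** The powers of lam form a chain of length n. Conversely, [step] shows that any strict chain
    starting from an ideal containing f becomes the unit ideal after at most n steps. *)
Lemma ord_hyper n u f : ~ (forall v, lin_sect L' v -> peval u v = 0) ->
  (forall v, v \in L -> peval f v = lam v ^+ n * peval u v) ->
  ord (lin_sect L) (lin_sect L') f = n.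
Proof.
move=> un0 Ef.
have lge m : ord_ge (lin_sect L) (lin_sect L') f m <-> (m <= n)%N.
  split=> [[J [Jl Jf Js]]|mn]; last first.
    exists (fun j => [set f | exists g, forall v, v \in L ->
              peval f v = lam v ^+ (n - j) * peval g v]); split.
    - by move=> j _; apply: local_ideal_divisible.
    - by exists u => v vL; rewrite subn0 Ef.
    move=> j jm; have jn : (j < n)%N by exact: leq_trans mn.
    split=> [h [g Eg]|H].
      by exists (lin_poly lam * g) => v vL; rewrite Eg // pevalM peval_lin mulrA -exprSr -subSn.
    have [g Eg] : exists g, forall v, v \in L ->
        peval (lin_poly lam ^+ (n - j.+1)) v = lam v ^+ (n - j) * peval g v.
      by apply: H; exists (1%:MP) => v vL; rewrite pevalX peval_lin pevalC mulr1.
    have [w Lw] := L'n0.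
    have E0 : forall v, v \in L -> peval (lin_poly lam ^+ (n - j.+1)) v *
        peval (1%:MP - lin_poly lam * g) v = 0.
      move=> v vL; rewrite pevalB pevalC mulrBr mulr1 {1}Eg // pevalM pevalX !peval_lin.
      by rewrite mulrA -exprSr -subSn // subSS subrr.
    have [H1|H1] := peval_lin_irred E0.
      have [v vL /eqP lv] := lam_n0; case: lv; have /eqP := H1 v vL.
      by rewrite pevalX peval_lin expf_eq0 => /andP[_ /eqP].
    have [[wL _] lw] := (lin_sect_hyperE w).1 Lw.
    have /eqP := H1 w wL; rewrite pevalB pevalC pevalM peval_lin lw mul0r subr0.
    by rewrite oner_eq0.
  (* The ideal J (j+1) contains an h outside J j. The order of h is less than n - j, since J j
     contains lam^(n-j); saturation then puts lam^(n-j-1) into J (j+1). *)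
  have step j : (j <= m)%N -> J j (lin_poly lam ^+ (n - j)).
    elim: j => [_|j IH jm].
      have [J1 J2 J3 J4] := Jl 0%N isT; rewrite subn0.
      apply: (J4 u); first exact: un0.
      have -> : u * lin_poly lam ^+ n = f + (u * lin_poly lam ^+ n - f) by rewrite addrC subrK.
      apply: J2 => //; apply: J1 => v [vL _].
      by rewrite pevalB pevalM pevalX peval_lin Ef // mulrC subrr.
    have [J1 J2 J3 J4] := Jl j.+1 jm.
    have [sub nsub] := Js j jm.
    have [h Jh Jnh] : exists2 h, J j.+1 h & ~ J j h.
      by apply: contrapT => H; apply: nsub => h Jh; apply: contrapT => Jn; apply: H; exists h.
    have Jj := Jl j (ltnW jm).
    have [h0|/existsNP[y /not_implyP[yL hy]]] :=
        pselect (forall v, v \in L -> peval h v = 0).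
      by case: Jnh; have [K1 _ _ _] := Jj; apply: K1 => v [vL _]; apply: h0.
    have [e [g [Eg gn0]]] := peval_lin_order lam_n0 (fun H => hy (H y yL)).
    case: (leqP (n - j) e) => ne.
      case: Jnh; have [K1 K2 K3 K4] := Jj.
      have -> : h = (lin_poly lam ^+ (e - (n - j)) * g) * lin_poly lam ^+ (n - j) +
         (h - (lin_poly lam ^+ (e - (n - j)) * g) * lin_poly lam ^+ (n - j)).
        by rewrite addrC subrK.
      apply: K2; first by apply: K3; apply: IH; apply: ltnW.
      apply: K1 => v [vL _]; rewrite pevalB !pevalM !pevalX peval_lin Eg //.
      by rewrite mulrAC -exprD subnK // subrr.
    have -> : lin_poly lam ^+ (n - j.+1) = lin_poly lam ^+ (n - j.+1 - e) * lin_poly lam ^+ e.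
      by rewrite -exprD subnK // subnS; move: ne; case: (n - j)%N.
    apply: J3; apply: (J4 g); first by move=> g0; apply: gn0; apply: lin_sect_dense g0.
    have -> : g * lin_poly lam ^+ e = h + (g * lin_poly lam ^+ e - h) by rewrite addrC subrK.
    apply: J2 => //; apply: J1 => v [vL _].
    by rewrite pevalB pevalM pevalX peval_lin Eg // mulrC subrr.
  rewrite leqNgt; apply/negP => nm.
  have [J1 J2 J3 J4] := Jl n (ltnW nm).
  have := step n (ltnW nm); rewrite subnn expr0 => J1n.
  have [_ nsub] := Js n nm; apply: nsub => h _.
  by rewrite -[h]mulr1; apply: J3.
rewrite /ord; case: xgetP => [m -> [/lge mn /lge]|]; last first.
  by move=> /(_ n)[]; split; [apply/lge | move=> /lge; rewrite ltnn].
by move=> /negP; rewrite -leqNgt => nm; apply/eqP; rewrite eqn_leq mn nm.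
Qed.

End Hyperplane.

Lemma ord_unit D f : ~ vanishing D f -> ord (lin_sect L) D f = 0%N.
Proof.
move=> fD.
have lge m : ord_ge (lin_sect L) D f m <-> m = 0%N.
  split=> [[J [Jl Jf Js]]|->]; last first.
    exists (fun _ => setT); split=> //.
  case: m Jl Js => // m Jl Js; have [J1 J2 J3 J4] := Jl 0%N isT.
  have [_ nsub] := Js 0%N isT; case: nsub => h _; rewrite -[h]mulr1; apply: J3.
  by apply: (J4 f) => //; rewrite mulr1.
rewrite /ord; case: xgetP => [m -> [/lge -> //]|].
by move=> /(_ 0%N)[]; split; [apply/lge | move=> /lge].
Qed.

End LinearSections.

(** * Divisors of monomials in linear forms and units *)

Section MonomialSections.
Variables (k : closedFieldType) (V : vectType k).
Variable Om : set V.
Hypothesis Om_open :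
  exists S : set (coord_ring V), forall v, Om v <-> exists2 f, S f & peval f v != 0.
Variables (L0 L : {vspace V}).
Hypothesis LL0 : (L <= L0)%VS.
Hypothesis Ln0 : lin_sect Om L !=set0.
Variables (A : finType) (P : A -> coord_ring V) (isl : pred A).
Variable lam : A -> 'Hom(V, k^o).
Hypothesis lin_atom : forall a, isl a -> forall v, v \in L -> peval (P a) v = lam a v.
Hypothesis lin_atom_n0 : forall a, isl a -> exists2 v, v \in L & lam a v != 0.
Hypothesis unit_atom : forall a, ~~ isl a -> forall v, lin_sect Om L v -> peval (P a) v != 0.
Let Y := lin_sect Om L.
Let X := lin_sect Om L0.
Let H a := (L :&: lker (lam a))%VS.

Definition monomial (n : A -> nat) : coord_ring V := \prod_a P a ^+ n a.

Lemma peval_monomial n v : peval (monomial n) v = \prod_a peval (P a) v ^+ n a.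
Proof. by rewrite peval_prod; apply: eq_bigr => a _; rewrite pevalX. Qed.

Lemma atom_nonvanishing D a : subvariety X D -> D `<=` Y ->
  ~ (isl a /\ D `<=` [set v | lam a v = 0 :> k]) -> ~ vanishing D (P a).
Proof.
move=> [_ [x Dx] _] DY na; case: (boolP (isl a)) => [la Pa|ua Pa].
  apply: na; split=> // v Dv; have [vL _] := DY v Dv.
  by rewrite /= -lin_atom // Pa.
by have := unit_atom ua (DY x Dx); rewrite Pa // eqxx.
Qed.

Lemma prod_nonvanishing D n (Q : pred A) : subvariety X D -> D `<=` Y ->
  (forall a, Q a -> n a != 0%N -> ~ vanishing D (P a)) ->
  ~ vanishing D (\prod_(a | Q a) P a ^+ n a).
Proof.
move=> vD DY H0; apply: (big_ind (fun f => ~ vanishing D f)).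
- have [_ [x Dx] _] := vD => /(_ x Dx); rewrite peval1 => /eqP.
  by rewrite oner_eq0.
- move=> f g fD gD fg; have [v Dv|//|//] := subvariety_irred vD (f := f) (g := g).
  by rewrite -pevalM fg.
move=> a Qa; case: (eqVneq (n a) 0%N) => [-> | na].
  have [_ [x Dx] _] := vD => /(_ x Dx); rewrite expr0 peval1 => /eqP.
  by rewrite oner_eq0.
move=> Pn; apply: (H0 a Qa na) => v Dv; have /eqP := Pn v Dv.
by rewrite pevalX expf_eq0 => /andP[_ /eqP].
Qed.

Lemma sub_hyper_eq D a : isl a -> prime_divisor X Y D ->
  D `<=` [set v | lam a v = 0 :> k] -> D = lin_sect Om (H a).
Proof.
move=> la [vD DY Dmax] Da; have sub : D `<=` lin_sect Om (H a).
  move=> v Dv; apply/lin_sect_hyperE; split; last exact: Da.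
  by case: DY => DY _; exact: DY.
have [x Dx] : D !=set0 by case: vD.
have n0 : lin_sect Om (H a) !=set0 by exists x; exact: sub.
have [vH HY _] := prime_divisor_hyper Om_open LL0 Ln0 (lin_atom_n0 la) n0.
case: (Dmax _ vH sub) => //; first by case: HY.
by move=> E; case: HY => _ []; rewrite E.
Qed.

(** Atoms not vanishing on D contribute units of the local ring. The others all cut out the
    hyperplane D and contribute powers of one linear form. *)
Lemma ord_monomial n D : prime_divisor X Y D ->
  ord Y D (monomial n) = (\sum_(a | isl a && `[< D = lin_sect Om (H a) >]) n a)%N.
Proof.
move=> pD; have [vD [DY nDY] Dmax] := pD.
set Q := fun a => isl a && `[< D = lin_sect Om (H a) >].
have QP a : reflect (isl a /\ D `<=` [set v | lam a v = 0 :> k]) (Q a).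
  apply: (iffP andP) => -[la Da]; split=> //.
    by move/asboolP: Da => -> v /lin_sect_hyperE[].
  by apply/asboolP; apply: sub_hyper_eq.
have nv (R : pred A) : (forall a, R a -> ~~ Q a) ->
    ~ vanishing D (\prod_(a | R a) P a ^+ n a).
  move=> RQ; apply: prod_nonvanishing => // a /RQ /QP na _.
  exact: atom_nonvanishing.
case: (pickP Q) => [a0 Qa0|Q0]; last first.
  rewrite big_pred0 //; apply: ord_unit.
  by apply: nv => a _; rewrite Q0.
have [la0 /asboolP Da0] := andP Qa0.
have n0 : lin_sect Om (H a0) !=set0 by rewrite -Da0; case: vD.
have [v0 v0L lv0] := lin_atom_n0 la0.
(* Two atoms with the same zero hyperplane are proportional on L; [c a] is the ratio to the chosen
   atom [a0]. *)
have cE a : exists c : k, Q a -> c != 0 /\ forall v, v \in L -> lam a v = c * lam a0 v.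
  case: (boolP (Q a)) => Qa; last by exists 0.
  have [la Da] := QP a Qa.
  have ker v : v \in H a0 -> lam a v = 0 :> k.
    move=> vH; rewrite -peval_lin.
    apply: (lin_sect_dense Om_open n0) vH => u Hu.
    by rewrite peval_lin; apply: Da; rewrite Da0.
  have E v : v \in L -> lam a v = ((lam a0 v0)^-1 * lam a v0 : k) * lam a0 v.
    move=> vL; pose c := ((lam a0 v0)^-1 * lam a0 v : k).
    have : v - c *: v0 \in H a0.
      rewrite memv_cap memv_ker memvB ?memvZ //= linearB linearZ /= /GRing.scale /=.
      by rewrite /c mulrAC mulVf // mul1r subrr.
    move/ker; rewrite linearB linearZ /= /GRing.scale /= => /eqP; rewrite subr_eq0.
    by move/eqP => ->; rewrite /c mulrAC.
  eexists => _; split; last exact: E.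
  have [w wL lw] := lin_atom_n0 la.
  by apply: contraNneq lw => c0; rewrite E // c0 mul0r.
have [c cP] := choice cE.
rewrite [in LHS]Da0; apply: (ord_hyper Om_open Ln0 (lin_atom_n0 la0) n0
  (u := (\prod_(a | Q a) c a ^+ n a)%:MP * \prod_(a | ~~ Q a) P a ^+ n a)).
- rewrite -Da0 => u0; apply: (nv (fun a => ~~ Q a)) => // v Dv.
  have /eqP := u0 v Dv; rewrite pevalM pevalC mulf_eq0 => /orP[|/eqP //].
  rewrite prodf_seq_eq0 => /hasP[a _ /andP[Qa]]; rewrite expf_eq0 => /andP[_ /eqP ca].
  by have [] := cP a Qa; rewrite ca eqxx.
move=> v vL; rewrite peval_monomial pevalM pevalC peval_prod (bigID Q) /= mulrA.
congr (_ * _); last by apply: eq_bigr => a _; rewrite pevalX.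
rewrite -prodrXr -big_split /=; apply: eq_bigr => a Qa.
have [la _] := andP Qa; have [_ ca] := cP a Qa.
by rewrite lin_atom // ca // exprMn mulrC.
Qed.

Definition pos_part (z : int) : nat := if (0 <= z) then `|z|%N else 0%N.

Lemma pos_partB z : (pos_part z)%:R - (pos_part (- z))%:R = z%:~R :> rat.
Proof.
by case: z => [[|n]|n]; rewrite /pos_part ?subr0 ?subrr // NegzE opprK mulrNz sub0r.
Qed.

Lemma expfz_pos_part (x : k) z : x != 0 -> x ^ z * x ^+ pos_part (- z) = x ^+ pos_part z.
Proof.
move=> x0; rewrite !exprnP -expfzDr //; congr (_ ^ _).
by case: z => [[|n]|n]; rewrite /pos_part ?addr0 // NegzE opprK addNr.
Qed.

(** Integer exponents are split into positive and negative parts because a rational function is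
    given by two polynomials. *)
Definition monomial_section (z : A -> int) : ratfun V :=
  RatFun Y (monomial (fun a => pos_part (z a))) (monomial (fun a => pos_part (- z a))).

Definition monomial_div (z : A -> int) (D : set V) : rat :=
  \sum_(a | isl a && `[< D = lin_sect Om (H a) >]) (z a)%:~R.

Lemma div_monomial_section z D : subvariety X D ->
  div_mult X (monomial_section z) D = monomial_div z D.
Proof.
move=> vD; rewrite /div_mult /=; case: asboolP => pD.
  rewrite !ord_monomial // !natr_sum -sumrB; apply: eq_bigr => a _.
  exact: pos_partB.
rewrite /monomial_div big_pred0 // => a; apply/negP => /andP[la /asboolP Da].
apply: pD; rewrite Da; apply: prime_divisor_hyper => //; first exact: lin_atom_n0.
by rewrite -Da; case: vD.
Qed.

Lemma vanishing_monomial n : ~ vanishing Y (monomial n).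
Proof.
apply: prod_nonvanishing => // [|a _ _]; first exact: subvariety_lin_sect.
case: (boolP (isl a)) => la; last first.
  have [x Yx] := Ln0 => Pa; have := unit_atom la Yx.
  by rewrite Pa // eqxx.
move=> Pa; have [v vL /eqP[]] := lin_atom_n0 la.
rewrite -lin_atom //.
by apply: (lin_sect_dense Om_open Ln0) vL.
Qed.

Variables (G : Type) (act : G -> V -> V) (om : A -> G -> k).
Hypothesis act_Y : forall h v, Y v -> Y (act h v).
Hypothesis om_n0 : forall a h, om a h != 0.
Hypothesis atom_act : forall a h v, Y v -> peval (P a) (act h v) = om a h * peval (P a) v.

Lemma rat_section_monomial z (chi : G -> k) :
  (forall h, chi h = \prod_a om a h ^ z a) ->
  rat_section X act chi (monomial_section z).
Proof.
move=> chiE; split; try exact: vanishing_monomial.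
  by split=> //; apply: subvariety_lin_sect.
move=> h v Yv; rewrite !peval_monomial chiE -!big_split /=; apply: eq_bigr => a _.
rewrite atom_act // !exprMn mulrA -(expfz_pos_part (z a) (om_n0 a h)).
by ring.
Qed.

End MonomialSections.

(** * The embeddings of F into k and the diagonalisation of multiplication *)

Section Embeddings.
Variables (p : nat) (p_prime : prime p) (k : closedFieldType) (k_char : p \in [pchar k]).
Variable d : nat.
Variables (F : fieldExtType 'F_p) (e : d.-tuple F) (e_basis : basis_of fullv e).
Variable tau : {rmorphism F -> k}.

Definition emb (i : nat) (x : F) : k := tau x ^+ (p ^ i).

Lemma frobD (x y : k) n : (x + y) ^+ (p ^ n) = x ^+ (p ^ n) + y ^+ (p ^ n).
Proof.
apply: exprDn_pchar; rewrite pnatX; apply/orP; left; apply/andP; split.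
  exact: prime_gt0.
by apply/allP => q; rewrite primes_prime // inE => /eqP ->.
Qed.

Lemma frob_natr (m n : nat) : (m%:R : k) ^+ (p ^ n) = m%:R.
Proof.
elim: m => [|m IH]; first by rewrite expr0n expn_eq0 -leqn0 leqNgt prime_gt0.
by rewrite -addn1 natrD frobD IH expr1n.
Qed.

Lemma embD i x y : emb i (x + y) = emb i x + emb i y.
Proof. by rewrite /emb rmorphD frobD. Qed.
Lemma embM i x y : emb i (x * y) = emb i x * emb i y.
Proof. by rewrite /emb rmorphM exprMn. Qed.
Lemma emb0 i : emb i 0 = 0.
Proof. by rewrite /emb rmorph0 expr0n expn_eq0 -leqn0 leqNgt prime_gt0. Qed.
Lemma emb_sum i (I : finType) (G : I -> F) : emb i (\sum_j G j) = \sum_j emb i (G j).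
Proof. exact: (big_morph _ (embD i) (emb0 i)). Qed.
Lemma embZ i (c : 'F_p) x : emb i (c *: x) = (c : nat)%:R * emb i x.
Proof.
have -> : c *: x = (c : nat)%:R * x by rewrite -{1}[c]natr_Zp scaler_nat mulr_natl.
by rewrite embM {1}/emb rmorph_nat frob_natr.
Qed.
Lemma embS i x : emb i.+1 x = emb i x ^+ p.
Proof. by rewrite /emb expnSr exprM. Qed.

Let fF := finvect_type F.
Lemma card_F : #|{: fF}| = (p ^ d)%N.
Proof.
have dF : \dim {:F} = d by apply: vector.size_basis e_basis.
have := card_vspace (fullv : {vspace fF}); rewrite card_vspacef card_Fp // => ->.
by congr (_ ^ _)%N; rewrite -[RHS]dF.
Qed.

Lemma expF_pd (x : F) : x ^+ (p ^ d) = x.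
Proof. by have := expf_card (x : fF); rewrite card_F. Qed.

Lemma emb_per i x : emb (i + d) x = emb i x.
Proof. by rewrite /emb addnC expnD exprM -rmorphXn expF_pd. Qed.

Lemma emb_pred (i : 'I_d) x : emb (ord_pred i) x ^+ p = emb i x.
Proof.
rewrite -embS /=; case: i => [[|i] id] /=; last first.
  by rewrite modnDr modn_small // ltnW.
by rewrite add0n modn_small ?prednK // -[d]add0n emb_per.
Qed.

(** A relation is a polynomial in the X^(p^i), i < d, of degree less than p^d, that vanishes at the
    p^d elements of the image of F. *)
Lemma emb_indep (c : 'I_d -> k) : (forall x, \sum_i c i * emb i x = 0) -> forall i, c i = 0.
Proof.
move=> c0; pose q : {poly k} := \sum_i c i *: 'X^(p ^ i).
have qE x : q.[tau x] = 0.
  rewrite -[RHS](c0 x) horner_sum; apply: eq_bigr => i _.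
  by rewrite hornerZ hornerXn.
have coefq (i : 'I_d) : q`_(p ^ i) = c i.
  rewrite coef_sum (bigD1 i) //= coefZ coefXn eqxx mulr1 big1 ?addr0 // => j ji.
  rewrite coefZ coefXn eqn_exp2l ?prime_gt1 // eq_sym.
  by rewrite [_ == _ :> nat](negPf ji) mulr0.
suff q0 : q = 0 by move=> i; rewrite -coefq q0 coef0.
apply/eqP/negPn/negP => qn0.
have [s us ss] : exists2 s : seq F, uniq s & size s = (p ^ d)%N.
  exists (enum (pred_of_simpl (@predT fF))); first exact: enum_uniq.
  by have := card_F; rewrite cardE.
have := max_poly_roots (rs := [seq tau x | x <- s]) qn0.
rewrite size_map ss => H; have : (p ^ d < size q)%N.
  apply: H; last by rewrite map_inj_uniq //; exact: fmorph_inj.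
  by apply/allP => _ /mapP[x _ ->]; rewrite rootE qE.
rewrite ltnNge (leq_trans (size_sum _ _ _)) //; apply/bigmax_leqP => i _.
rewrite (leq_trans (size_scale_leq _ _)) // size_polyXn.
by rewrite ltn_exp2l ?prime_gt1.
Qed.

(** Its rows are common left eigenvectors of the multiplication matrices, so the columns of its
    inverse are common eigenvectors. *)
Definition emb_mx : 'M[k]_d := \matrix_(i, j) emb i e`_j.
Definition scal_mx (x : F) : 'M[k]_d :=
  \matrix_(i, j) ((coord e i (x * e`_j) : 'F_p) : nat)%:R.

Lemma emb_coord i y : \sum_j (coord e j y : nat)%:R * emb i e`_j = emb i y.
Proof.
rewrite [in RHS](coord_basis e_basis (memvf y)) emb_sum; apply: eq_bigr => j _.
by rewrite embZ.
Qed.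

Lemma emb_mx_unit : emb_mx \in unitmx.
Proof.
rewrite -row_free_unit; apply: inj_row_free => v /rowP v0.
suff v00 : forall i, v 0 i = 0 by apply/rowP => i; rewrite v00 mxE.
apply: emb_indep => x.
under eq_bigr => i _ do rewrite -emb_coord mulr_sumr.
rewrite exchange_big big1 // => j _.
under eq_bigr => i _ do rewrite mulrCA.
rewrite -mulr_sumr; have := v0 j; rewrite !mxE => E.
by rewrite [X in _ * X](_ : _ = 0) ?mulr0 // -[RHS]E; apply: eq_bigr => i _; rewrite mxE.
Qed.

Lemma emb_mx_scal i x : row i emb_mx *m scal_mx x = emb i x *: row i emb_mx.
Proof.
apply/rowP => j; rewrite !mxE -embM -emb_coord; apply: eq_bigr => a _.
by rewrite !mxE mulrC.
Qed.

Lemma scal_emb_mx i x : scal_mx x *m col i (invmx emb_mx) = emb i x *: col i (invmx emb_mx).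
Proof.
have E : emb_mx *m scal_mx x = diag_mx (\row_j emb j x) *m emb_mx.
  apply/row_matrixP => j; rewrite row_mul emb_mx_scal.
  by apply/rowP => a; rewrite mul_diag_mx !mxE.
have E2 : scal_mx x *m invmx emb_mx = invmx emb_mx *m diag_mx (\row_j emb j x).
  by rewrite -[LHS](mulKmx emb_mx_unit) (mulmxA emb_mx) E -(mulmxA _ emb_mx) mulmxV ?emb_mx_unit // mulmx1.
apply/colP => a; have /matrixP/(_ a i) := E2; rewrite mul_mx_diag !mxE => E3.
rewrite mulrC -E3; apply: eq_bigr => b _; by rewrite !mxE.
Qed.

Lemma scalar_mx2E (x : F) : scalar_mx2 k e x = block_mx (scal_mx x) 0 0 (scal_mx x).
Proof. by []. Qed.
End Embeddings.

Lemma det2_neq0 (k : fieldType) (V : lmodType k) (x y : V) (a b c e : k) :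
  (forall t u : k, t *: (a *: x + b *: y) + u *: (c *: x + e *: y) = 0 -> t = 0 /\ u = 0) ->
  a * e - c * b != 0.
Proof.
move=> ind; apply/eqP => D0.
have E t u : t * a + u * c = 0 -> t * b + u * e = 0 -> t = 0 /\ u = 0.
  by move=> E1 E2; apply: ind; rewrite !scalerDr !scalerA addrACA -!scalerDl E1 E2 !scale0r addr0.
have [||e0 /eqP] := E e (- b); [by rewrite -[RHS]D0; ring | by ring |].
rewrite oppr_eq0 => /eqP b0.
have [||c0 /eqP] := E c (- a); [by ring | by rewrite e0 b0 !mulr0 addr0 |].
rewrite oppr_eq0 => /eqP a0; have [||/eqP] := E 1 0; last by rewrite oner_eq0.
  by rewrite a0 mulr0 mul0r addr0.
by rewrite b0 mulr0 mul0r addr0.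
Qed.

(** * Dual bases, and those adapted to the planes V_i *)

Section Frames.
Variables (k : fieldType) (n : nat) (Ix : finType).
Implicit Types (u : 'rV[k]_n) (v : 'cV[k]_n) (g h : 'M[k]_n).

Definition dot u v : k := (u *m v) 0 0.

Lemma dotE u v : u *m v = (dot u v)%:M.
Proof. exact: mx11_scalar. Qed.
Lemma dotDr u v v' : dot u (v + v') = dot u v + dot u v'.
Proof. by rewrite /dot mulmxDr mxE. Qed.
Lemma dotDl u u' v : dot (u + u') v = dot u v + dot u' v.
Proof. by rewrite /dot mulmxDl mxE. Qed.
Lemma dotZr u v a : dot u (a *: v) = a * dot u v.
Proof. by rewrite /dot -scalemxAr mxE. Qed.
Lemma dotZl u v a : dot (a *: u) v = a * dot u v.
Proof. by rewrite /dot -scalemxAl mxE. Qed.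
Lemma dot0r u : dot u 0 = 0.
Proof. by rewrite /dot mulmx0 mxE. Qed.
Lemma dotNl u v : dot (- u) v = - dot u v.
Proof. by rewrite -scaleN1r dotZl mulN1r. Qed.
Lemma dot_sumr u (I : finType) (P : pred I) (f : I -> 'cV[k]_n) :
  dot u (\sum_(i | P i) f i) = \sum_(i | P i) dot u (f i).
Proof. by rewrite /dot mulmx_sumr summxE. Qed.
Lemma dotMA u g v : dot (u *m g) v = dot u (g *m v).
Proof. by rewrite /dot mulmxA. Qed.

Lemma dot_mul (u : 'rV[k]_n) (c : 'cV[k]_n) u' v : dot u (c *m u' *m v) = dot u c * dot u' v.
Proof. by rewrite -mulmxA [u' *m v]dotE mul_mx_scalar dotZr mulrC. Qed.

Definition dual_frame (c : Ix -> 'cV[k]_n) (r : Ix -> 'rV[k]_n) :=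
  (forall a b, dot (r a) (c b) = (a == b)%:R) /\ \sum_a c a *m r a = 1%:M.

Section OneFrame.
Variables (c : Ix -> 'cV[k]_n) (r : Ix -> 'rV[k]_n).
Hypothesis cr : dual_frame c r.

Lemma frame_dual a b : dot (r a) (c b) = (a == b)%:R. Proof. by have [] := cr. Qed.

Lemma frame_decomp v : v = \sum_a dot (r a) v *: c a.
Proof.
rewrite -[LHS]mul1mx; have [_ <-] := cr; rewrite mulmx_suml; apply: eq_bigr => a _.
by rewrite -mulmxA [r a *m v]dotE mul_mx_scalar.
Qed.
Lemma frame_decompl u : u = \sum_a dot u (c a) *: r a.
Proof.
rewrite -[LHS]mulmx1; have [_ <-] := cr; rewrite mulmx_sumr; apply: eq_bigr => a _.
by rewrite mulmxA [u *m c a]dotE mul_scalar_mx.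
Qed.
Lemma frame_extv v w : (forall a, dot (r a) v = dot (r a) w) -> v = w.
Proof. by move=> E; rewrite [v]frame_decomp [w]frame_decomp; apply: eq_bigr => a _; rewrite E. Qed.

Lemma frame_colI a : c a != 0.
Proof. by apply/eqP => c0; have := frame_dual a a; rewrite c0 dot0r eqxx => /esym/eqP; rewrite oner_eq0. Qed.
End OneFrame.

Section TwoFrames.
Variables (c : Ix -> 'cV[k]_n) (r : Ix -> 'rV[k]_n) (q : Ix -> 'cV[k]_n) (rq : Ix -> 'rV[k]_n).
Hypotheses (cr : dual_frame c r) (qrq : dual_frame q rq).

Lemma frame_ext g h :
  (forall a b, dot (r a) (g *m q b) = dot (r a) (h *m q b)) -> g = h.
Proof.
move=> E; rewrite -[g]mulmx1 -[h]mulmx1; have [_ <-] := qrq.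
rewrite !mulmx_sumr; apply: eq_bigr => b _; rewrite !mulmxA; congr (_ *m _).
by apply: (frame_extv cr) => a.
Qed.

Definition frame_mx (A : Ix -> Ix -> k) : 'M[k]_n := \sum_a \sum_b A a b *: (c a *m rq b).
Lemma frame_mxE A a b : dot (r a) (frame_mx A *m q b) = A a b.
Proof.
rewrite mulmx_suml dot_sumr (bigD1 a) //= [X in _ + X]big1 ?addr0.
  rewrite mulmx_suml dot_sumr (bigD1 b) //= [X in _ + X]big1 ?addr0.
    by rewrite -scalemxAl dotZr dot_mul (frame_dual cr) (frame_dual qrq) !eqxx !mulr1.
  by move=> b' bb; rewrite -scalemxAl dotZr dot_mul (frame_dual qrq) (negPf bb) !mulr0.
move=> a' aa; rewrite mulmx_suml dot_sumr big1 // => b' _.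
by rewrite -scalemxAl dotZr dot_mul (frame_dual cr) eq_sym (negPf aa) mul0r mulr0.
Qed.
End TwoFrames.

Lemma entry_mul (c : Ix -> 'cV[k]_n) (r : Ix -> 'rV[k]_n) : dual_frame c r ->
  forall u g v, dot u (g *m v) = \sum_x dot u (g *m c x) * dot (r x) v.
Proof.
move=> cr u g v; rewrite {1}[v](frame_decomp cr) mulmx_sumr dot_sumr.
by apply: eq_bigr => x _; rewrite -scalemxAr dotZr mulrC.
Qed.
End Frames.

(** Duality says that one square matrix is a left inverse of another, after identifying the index
    set with the d + d coordinates; it is then also a right inverse. *)
Lemma dual_complete (k : fieldType) d (c : 'I_d * bool -> 'cV[k]_(d + d))
    (r : 'I_d * bool -> 'rV[k]_(d + d)) :
  (forall a b, dot (r a) (c b) = (a == b)%:R) -> dual_frame c r.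
Proof.
move=> cr; split=> //.
pose ix (s : 'I_(d + d)) : 'I_d * bool :=
  match fintype.split s with inl i => (i, false) | inr i => (i, true) end.
pose xi (a : 'I_d * bool) : 'I_(d + d) := if a.2 then rshift d a.1 else lshift d a.1.
have xiK : cancel xi ix.
  by case=> i [] /=; rewrite /ix /xi /= ?(unsplitK (inl i)) ?(unsplitK (inr i)).
have ixK : cancel ix xi.
  by move=> s; rewrite /ix; case: splitP => j Ej; apply: ord_inj; rewrite /xi /= Ej.
pose R := \matrix_(s, t) r (ix s) 0 t; pose C := \matrix_(s, t) c (ix t) s 0.
have RC : R *m C = 1%:M.
  apply/matrixP => s t; rewrite !mxE; have := cr (ix s) (ix t); rewrite (can_eq ixK).
  by rewrite /dot mxE => <-; apply: eq_bigr => u _; rewrite !mxE.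
rewrite -(mulmx1C RC); apply/matrixP => s t; rewrite summxE mxE.
rewrite (reindex ix) /=; last by exists xi => a _.
by apply: eq_bigr => u _; rewrite !mxE big_ord1.
Qed.

Section PlanarFrames.
Variables (p : nat) (p_prime : prime p) (k : closedFieldType) (k_char : p \in [pchar k]).
Variable d : nat.
Variables (F : fieldExtType 'F_p) (e : d.-tuple F) (e_basis : basis_of fullv e).
Variable tau : {rmorphism F -> k}.
Local Notation Ix := ('I_d * bool)%type.
Local Notation em := (emb tau).
Local Notation sc := (scalar_mx2 k e).

Definition planar (c : Ix -> 'cV[k]_(d + d)) (r : Ix -> 'rV[k]_(d + d)) :=
  [/\ dual_frame c r, forall x a, sc x *m c a = em a.1 x *: c a &
      forall x a, r a *m sc x = em a.1 x *: r a].

Definition std_col (a : Ix) : 'cV[k]_(d + d) :=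
  let v := col a.1 (invmx (emb_mx e tau)) in if a.2 then col_mx 0 v else col_mx v 0.
Definition std_row (a : Ix) : 'rV[k]_(d + d) :=
  let u := row a.1 (emb_mx e tau) in if a.2 then row_mx 0 u else row_mx u 0.

Lemma planar_std : planar std_col std_row.
Proof.
split.
- apply: dual_complete => -[i b] [j b'].
  have E : (row i (emb_mx e tau) *m col j (invmx (emb_mx e tau))) 0 0 = (i == j)%:R.
    have /matrixP/(_ i j) := mulmxV (emb_mx_unit p_prime k_char e_basis tau).
    by rewrite !mxE => <-; apply: eq_bigr => l _; rewrite !mxE.
  rewrite /dot /std_row /std_col xpair_eqE /=.
  by case: b b' => [] [] /=; rewrite mul_row_col ?mul0mx ?mulmx0 ?add0r ?addr0 ?E ?andbT ?andbF // mxE.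
- move=> x [i b]; rewrite scalar_mx2E /std_col /=; case: b;
  by rewrite mul_block_col ?mul0mx ?mulmx0 ?addr0 ?add0r ?(scal_emb_mx p_prime k_char e_basis) //
     scale_col_mx scaler0.
- move=> x [i b]; rewrite scalar_mx2E /std_row /=; case: b;
  by rewrite mul_row_block ?mul0mx ?mulmx0 ?addr0 ?add0r ?(emb_mx_scal p_prime k_char e_basis) //
     scale_row_mx scaler0.
Qed.

Lemma emb_sep (i j : 'I_d) (t : k) : i != j -> (forall x, em i x * t = em j x * t) -> t = 0.
Proof.
move=> ij E; pose c (l : 'I_d) : k := (l == i)%:R * t - (l == j)%:R * t.
have c0 : forall l, c l = 0.
  apply: (emb_indep p_prime e_basis (tau := tau)) => x.
  under eq_bigr => l _ do rewrite /c mulrBl -!mulrA.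
  rewrite sumrB (bigD1 i) //= (bigD1 (P := xpredT) j) //= !eqxx !mul1r.
  rewrite !big1 ?addr0; try by move=> l /negPf ->; rewrite mul0r.
  by rewrite ![t * _]mulrC E subrr.
have := c0 i; rewrite /c eqxx (negPf ij) mul1r mul0r subr0; exact: id.
Qed.

(** The scalars of F act on the planes by distinct embeddings, so their commutant consists of the
    matrices that are block diagonal for the planes. *)
Lemma planar_commute c r q rq (g : 'M[k]_(d + d)) : planar c r -> planar q rq ->
  (forall x, g *m sc x = sc x *m g) <->
  (forall a b, a.1 != b.1 -> dot (r a) (g *m q b) = 0).
Proof.
move=> [cr cc rr] [qq qc qr]; split=> [com a b ab|E x].
  apply: (emb_sep ab) => x.
  by rewrite -dotZl -rr dotMA mulmxA -com -mulmxA qc -scalemxAr dotZr.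
apply: (frame_ext cr qq) => a b.
rewrite -!mulmxA qc -scalemxAr dotZr -[in RHS]dotMA rr dotZl.
by case: (eqVneq a.1 b.1) => [->//|ab]; rewrite E // !mulr0.
Qed.

Lemma map_frob_mul m1 m2 m3 (A : 'M[k]_(m1, m2)) (B : 'M[k]_(m2, m3)) :
  map_mx (fun c => c ^+ p) (A *m B) = map_mx (fun c => c ^+ p) A *m map_mx (fun c => c ^+ p) B.
Proof.
have E a b (M : 'M[k]_(a, b)) : map_mx (fun c => c ^+ p) M = map_mx (pFrobenius_aut k_char) M.
  by apply/matrixP => i j; rewrite !mxE.
by rewrite !E map_mxM.
Qed.

Lemma frobM m (A : 'M[k]_(d + d)) (B : 'M[k]_(d + d, m)) :
  frob p (A *m B) = frob p A *m frob p B.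
Proof. exact: map_frob_mul. Qed.

Lemma frob_scal x : frob p (sc x) = sc x.
Proof.
rewrite scalar_mx2E /frob map_block_mx.
have E : map_mx (fun c => c ^+ p) (scal_mx k e x) = scal_mx k e x.
  by apply/matrixP => i j; rewrite !mxE -[p in _ ^+ p]expn1 frob_natr.
have E0 : map_mx (fun c => c ^+ p) (0 : 'M[k]_d) = 0.
  by apply/matrixP => i j; rewrite !mxE expr0n -leqn0 leqNgt prime_gt0.
by rewrite E E0.
Qed.

Definition frob_row (u : 'rV[k]_(d + d)) : 'rV[k]_(d + d) := map_mx (fun c => c ^+ p) u.
(** Frobenius carries the plane i - 1 to the plane i. The boolean is negated because Q is the twist
    of the opposite parabolic: in this way the label [false] denotes the P-stable line in one frame
    and the Q-stable line in the other. *)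
Definition frob_cols (c : Ix -> 'cV[k]_(d + d)) (a : Ix) : 'cV[k]_(d + d) :=
  frob p (c (ord_pred a.1, ~~ a.2)).
Definition frob_rows (r : Ix -> 'rV[k]_(d + d)) (a : Ix) : 'rV[k]_(d + d) :=
  frob_row (r (ord_pred a.1, ~~ a.2)).

Lemma dot_frob u v : dot (frob_row u) (frob p v) = dot u v ^+ p.
Proof. by rewrite /dot -map_frob_mul mxE. Qed.

Lemma planar_frob c r : planar c r -> planar (frob_cols c) (frob_rows r).
Proof.
move=> [cr cc rr]; split.
- apply: dual_complete => -[i b] [j b']; rewrite dot_frob (frame_dual cr).
  rewrite !xpair_eqE /= (inj_eq (can_inj (@ord_predK d))) (inj_eq negb_inj).
  by case: (_ && _); rewrite ?expr1n // expr0n -leqn0 leqNgt prime_gt0.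
- move=> x [i b]; rewrite /frob_cols -{1}frob_scal -frobM cc /= -(emb_pred p_prime e_basis).
  by apply/matrixP => l m; rewrite !mxE exprMn.
- move=> x [i b]; rewrite /frob_rows /frob_row -{1}frob_scal -map_frob_mul rr /=.
  rewrite -(emb_pred p_prime e_basis).
  by apply/matrixP => l m; rewrite !mxE exprMn.
Qed.

End PlanarFrames.

(** * Weight decomposition of a cocharacter *)

Section WeightSpaces.
Variables (k : closedFieldType) (n : nat) (mu : k -> 'M[k]_n).
Hypothesis mu_unit : forall x, x != 0 -> mu x \in unitmx.
Hypothesis muM : forall x y, x != 0 -> y != 0 -> mu (x * y) = mu x *m mu y.
Variables (N : nat) (A : 'M[{poly k}]_n).
Hypothesis muA : forall x, x != 0 -> mu x = x ^- N *: map_mx (fun f : {poly k} => f.[x]) A.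

Lemma powers_indep M (a : nat -> k) :
  (forall x, x != 0 -> \sum_(i < M) a i * x ^+ i = 0) -> forall i, (i < M)%N -> a i = 0.
Proof.
move=> a0 i iM; pose q := \poly_(j < M) a j.
suff q0 : q = 0 by have := coef_poly M a i; rewrite iM -/q q0 coef0.
have qX : q * 'X = 0.
  apply: horner_fun0 => t; rewrite hornerM hornerX.
  case: (eqVneq t 0) => [->|t0]; first by rewrite mulr0.
  by rewrite horner_poly a0 ?mul0r.
by apply/eqP; move/eqP: qX; rewrite mulf_eq0 polyX_eq0 orbF.
Qed.

Let M := \max_i \max_j size (A i j).
(** The coefficient of x^s in the polynomial matrix x^N mu(x), which turns out to be the projector
    onto the weight space of weight s - N. *)
Definition weight_mx (s : nat) : 'M[k]_n := \matrix_(i, j) (A i j)`_s.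
Local Notation C := weight_mx.

Lemma mu_weights x : x != 0 -> mu x = x ^- N *: \sum_(s < M) x ^+ s *: C s.
Proof.
move=> x0; rewrite muA //; congr (_ *: _); apply/matrixP => i j.
rewrite mxE summxE; have sz : (size (A i j) <= M)%N.
  by rewrite (leq_trans _ (leq_bigmax i)) // (leq_bigmax j).
rewrite (horner_coef_wide _ sz); apply: eq_bigr => s _.
by rewrite !mxE mulrC.
Qed.

Lemma powers_indep_mx m1 m2 (B : nat -> 'M[k]_(m1, m2)) :
  (forall x, x != 0 -> \sum_(s < M) x ^+ s *: B s = 0) -> forall s, (s < M)%N -> B s = 0.
Proof.
move=> B0 s sM; apply/matrixP => i j; rewrite mxE.
apply: (powers_indep (a := fun s => B s i j)) sM => x /B0/matrixP/(_ i j).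
by rewrite summxE [in RHS]mxE => E; rewrite -[RHS]E; apply: eq_bigr => t _; rewrite mxE mulrC.
Qed.

(** Comparison of the coefficients of x^s y^t in mu(x y) = mu(x) mu(y). *)
Lemma weight_mxM s t : (s < M)%N -> (t < M)%N -> C s *m C t = (s == t)%:R *: C t.
Proof.
move=> sM tM.
have K x y : x != 0 -> y != 0 ->
    \sum_(s < M) x ^+ s *: (\sum_(t < M) y ^+ t *: (C s *m C t - (s == t :> nat)%:R *: C t)) = 0.
  move=> x0 y0; have xy0 : x * y != 0 by rewrite mulf_neq0.
  have := muM x0 y0; rewrite !mu_weights // -scalemxAl -scalemxAr scalerA exprMn invfM.
  move/(scalerI _) => E.
  have {}E : \sum_(s < M) (x * y) ^+ s *: C s =
     (\sum_(s < M) x ^+ s *: C s) *m (\sum_(s < M) y ^+ s *: C s).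
    by apply: E; rewrite mulf_neq0 ?invr_eq0 ?expf_neq0.
  rewrite mulmx_suml in E.
  transitivity ((\sum_(s < M) (x ^+ s *: C s) *m (\sum_(s < M) y ^+ s *: C s)) -
      \sum_(s < M) (x * y) ^+ s *: C s); last by rewrite E subrr.
  rewrite -sumrB; apply: eq_bigr => i _.
  rewrite -scalemxAl exprMn -scalerA -scalerBr; congr (_ *: _).
  rewrite mulmx_sumr -[X in _ - X](_ : \sum_(t < M) y ^+ t *: ((i == t)%:R *: C t) = _).
    by rewrite -sumrB; apply: eq_bigr => j _; rewrite -scalemxAr scalerBr.
  rewrite (bigD1 i) //= eqxx scale1r big1 ?addr0 // => j ji.
  by rewrite eq_sym (negPf ji) scale0r scaler0.
have H : \sum_(t < M) 0 = 0 :> 'M[k]_n by rewrite big1.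
apply/eqP; rewrite -subr_eq0; apply/eqP.
apply: (powers_indep_mx (B := fun t => C s *m C t - (s == t)%:R *: C t)) tM => y y0.
by apply: (powers_indep_mx (B := fun s => \sum_(t < M) y ^+ t *: (C s *m C t - (s == t :> nat)%:R *: C t))) sM => x x0; apply: K.
Qed.

Lemma weight_mx_sum : \sum_(s < M) C s = 1%:M.
Proof.
have n1 : (1 : k) != 0 by exact: oner_neq0.
have E : mu 1 = \sum_(s < M) C s.
  rewrite mu_weights // expr1n invr1 scale1r; apply: eq_bigr => s _.
  by rewrite expr1n scale1r.
rewrite -E; have := muM n1 n1; rewrite mulr1 => E1.
by rewrite -[mu 1](mulmxK (mu_unit n1)) -E1 mulmxV // mu_unit.
Qed.

Lemma mu_weight_mx s x : (s < M)%N -> x != 0 -> mu x *m C s = x ^ (s%:Z - N%:Z) *: C s.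
Proof.
move=> sM x0; rewrite mu_weights // -scalemxAl mulmx_suml (bigD1 (Ordinal sM)) //=.
rewrite big1 ?addr0; last first.
  by move=> t ts; rewrite -scalemxAl weight_mxM // [_ == _ :> nat](negPf ts) scale0r scaler0.
rewrite -scalemxAl weight_mxM // eqxx scale1r scalerA expfzDr // mulrC.
by rewrite -exprnN exprnP.
Qed.

Lemma weight_mx_comm s B : (s < M)%N -> (forall x, x != 0 -> mu x *m B = B *m mu x) ->
  C s *m B = B *m C s.
Proof.
move=> sM com; apply/eqP; rewrite -subr_eq0; apply/eqP.
apply: (powers_indep_mx (B := fun s => C s *m B - B *m C s)) sM => x x0.
have := com x x0; rewrite mu_weights // -scalemxAl -scalemxAr.
move/(scalerI _) => E; have {}E := E (_ : _ != 0).
rewrite (eq_bigr (fun s : 'I_M => (x ^+ s *: C s) *m B - B *m (x ^+ s *: C s))).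
  by rewrite sumrB -mulmx_suml -mulmx_sumr E ?subrr // invr_eq0 expf_neq0.
by move=> t _; rewrite -scalemxAl -scalemxAr scalerBr.
Qed.

(** Either both vectors lie in one weight space, or nonzero components of two different weights
    occur among them. Applied to a basis of a plane, the first case says that mu is scalar there. *)
Lemma two_weights (v w : 'cV[k]_n) : v != 0 ->
  (exists s : int, forall x, x != 0 -> mu x *m v = x ^ s *: v /\ mu x *m w = x ^ s *: w) \/
  exists (s t : nat) (u u' : 'cV[k]_n), [/\ (s < M)%N, (t < M)%N, s != t,
    (u = C s *m v \/ u = C s *m w) & ((u' = C t *m v \/ u' = C t *m w) /\ u != 0 /\ u' != 0)].
Proof.
move=> v0.
have nz (u : 'cV[k]_n) : u != 0 -> exists s : 'I_M, C s *m u != 0.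
  move=> u0; apply/existsP; apply: contraNT u0 => /existsPn H.
  rewrite -[u]mul1mx -weight_mx_sum mulmx_suml big1 // => s _.
  by apply/eqP; have := H s; rewrite negbK.
have [s sv] := nz v v0.
have split_off (z : 'cV[k]_n) : C s *m z != z -> exists t : 'I_M, s != t :> nat /\ (C t *m z != 0).
  move=> zs; have [|t tz] := nz (z - C s *m z); first by rewrite subr_eq0 eq_sym.
  exists t; move: tz; rewrite mulmxBr mulmxA weight_mxM //; case: (eqVneq t s) => [->|ts].
    by rewrite eqxx scale1r subrr eqxx.
  by rewrite [_ == _ :> nat](negPf ts) scale0r mul0mx subr0 => tz; split; rewrite ?(eq_sym (s : nat)).
have [Ev|Ev] := eqVneq (C s *m v) v; last first.
  have [t [st tv]] := split_off v Ev.
  right; exists s, t, (C s *m v), (C t *m v).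
  by split=> //; [left | split; [left|]].
have [Ew|Ew] := eqVneq (C s *m w) w.
  left; exists (s%:Z - N%:Z) => x x0.
  by rewrite -Ev -Ew !mulmxA !mu_weight_mx // -!scalemxAl Ev Ew.
have [t [st tv]] := split_off w Ew.
right; exists s, t, (C s *m v), (C t *m w).
by split=> //; [left | split; [right|]].
Qed.
End WeightSpaces.

(** * Solvability of P forces two distinct weights on each plane *)

Section Regularity.
Variables (p : nat) (p_prime : prime p) (k : closedFieldType) (k_char : p \in [pchar k]).
Variable d : nat.
Variables (F : fieldExtType 'F_p) (e : d.-tuple F) (e_basis : basis_of fullv e).
Variable tau : {rmorphism F -> k}.
Variables (mu : k -> 'M[k]_(d + d)).
Local Notation Ix := ('I_d * bool)%type.
Local Notation sc := (scalar_mx2 k e).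

Lemma frame_ext_col (c : Ix -> 'cV[k]_(d + d)) r (g h : 'M[k]_(d + d)) : dual_frame c r ->
  (forall b, g *m c b = h *m c b) -> g = h.
Proof. by move=> cr E; apply: (frame_ext cr cr) => a b; rewrite E. Qed.

Lemma plane_decomp (c : Ix -> 'cV[k]_(d + d)) r i v : dual_frame c r ->
  (forall a, a.1 != i -> dot (r a) v = 0) ->
  v = dot (r (i, false)) v *: c (i, false) + dot (r (i, true)) v *: c (i, true).
Proof.
move=> cr v0; have ft : (i, true) != (i, false) by rewrite xpair_eqE andbF.
rewrite {1}(frame_decomp cr v) (bigD1 (i, false)) //= (bigD1 (i, true)) //=.
rewrite big1 ?addr0 // => -[j b] /andP[]; case: (eqVneq j i) => [->|ji]; first by case: b; rewrite eqxx.
by rewrite v0 //= scale0r.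
Qed.

Section Central.
Variables (c : Ix -> 'cV[k]_(d + d)) (r : Ix -> 'rV[k]_(d + d)).
Hypothesis pl : planar e tau c r.
Variables (i : 'I_d) (s : int).
Hypothesis mu_unit : forall x, x != 0 -> mu x \in unitmx.
Hypothesis mu_sc : forall x y, y != 0 -> mu y *m sc x = sc x *m mu y.
Hypothesis central : forall x b, x != 0 -> mu x *m c (i, b) = x ^ s *: c (i, b).

(** Acts on V_i by the matrix with rows (w, x) and (y, z), and trivially on the other planes. *)
Definition plane_mx (w x y z : k) : 'M[k]_(d + d) :=
  1%:M + ((w - 1) *: (c (i, false) *m r (i, false)) + x *: (c (i, false) *m r (i, true)) +
          y *: (c (i, true) *m r (i, false)) + (z - 1) *: (c (i, true) *m r (i, true))).

Lemma plane_mxE w x y z a : plane_mx w x y z *m c a =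
  if a.1 == i then
    if a.2 then x *: c (i, false) + z *: c (i, true) else w *: c (i, false) + y *: c (i, true)
  else c a.
Proof.
have [cr _ _] := pl.
have D b : c (i, b) *m r (i, b) *m c a = (a == (i, b))%:R *: c (i, b).
  by rewrite -mulmxA dotE (frame_dual cr) mul_mx_scalar eq_sym.
have D' b b' : c (i, b) *m r (i, b') *m c a = (a == (i, b'))%:R *: c (i, b).
  by rewrite -mulmxA dotE (frame_dual cr) mul_mx_scalar eq_sym.
rewrite /plane_mx mulmxDl mul1mx !mulmxDl -!scalemxAl !D'.
case: a {D D'} => j b; rewrite !xpair_eqE /=; case: (eqVneq j i) => [->|_] /=; last first.
  by rewrite !scale0r !scaler0 !addr0.
case: b => /=; rewrite !scale1r !scale0r !scaler0 !addr0 ?add0r.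
  by rewrite scalerBl scale1r addrCA [c _ + _]addrC subrK.
by rewrite scalerBl scale1r addrA [c _ + _]addrC subrK.
Qed.

Lemma plane_mxM w x y z w' x' y' z' : plane_mx w x y z *m plane_mx w' x' y' z' =
  plane_mx (w * w' + x * y') (w * x' + x * z') (y * w' + z * y') (y * x' + z * z').
Proof.
have [cr _ _] := pl; apply: (frame_ext_col cr) => a; rewrite -mulmxA !plane_mxE.
case: eqP => [_|ai]; last by rewrite plane_mxE; case: eqP.
by case: a.2; rewrite mulmxDr -!scalemxAr !plane_mxE /= !eqxx /= !scalerDr !scalerA addrACA -!scalerDl;
  congr (_ *: _ + _ *: _); ring.
Qed.

Lemma eq_plane_mx w x y z w' x' y' z' : w = w' -> x = x' -> y = y' -> z = z' ->
  plane_mx w x y z = plane_mx w' x' y' z'.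
Proof. by move=> -> -> -> ->. Qed.

Lemma plane_mx1 : plane_mx 1 0 0 1 = 1%:M.
Proof. by rewrite /plane_mx subrr !scale0r !addr0. Qed.

Lemma plane_mxV w x y z : w * z - x * y = 1 ->
  invmx (plane_mx w x y z) = plane_mx z (- x) (- y) w /\ plane_mx w x y z \in unitmx.
Proof.
move=> det1; have E : plane_mx w x y z *m plane_mx z (- x) (- y) w = 1%:M.
  rewrite plane_mxM -plane_mx1; apply: eq_plane_mx.
  - by rewrite -[RHS]det1; ring.
  - by ring.
  - by ring.
  - by rewrite -[RHS]det1; ring.
have [U _] := mulmx1_unit E; split=> //.
by rewrite -[LHS]mulmx1 -E mulKmx.
Qed.

Lemma plane_mx_G w x y z : w * z - x * y = 1 -> resGL2 k e (plane_mx w x y z).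
Proof.
move=> det1; have [_ U] := plane_mxV det1; have [cr cc rr] := pl.
split=> // t; apply: (frame_ext_col cr) => -[j b].
rewrite -!mulmxA cc -scalemxAr !plane_mxE /=; case: eqP => [->|_]; last by rewrite cc.
by case: b; rewrite mulmxDr -!scalemxAr !cc /= scalerDr !scalerA ![emb tau i t * _]mulrC.
Qed.

Lemma plane_mx_parP w x y z : w * z - x * y = 1 -> parP e mu (plane_mx w x y z).
Proof.
move=> det1; have [_ U] := plane_mxV det1; have [cr cc rr] := pl.
split; first exact: plane_mx_G.
exists (plane_mx w x y z), 0%N, (fun t => if t == 0%N then plane_mx w x y z else 0).
split=> //; last by rewrite big_ord1.
move=> [|t] u u0; last by rewrite mulmx0 mul0mx scaler0.
have -> : -1 * 0%:Z = 0 :> int by [].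
rewrite expr0z scale1r.
suff -> : mu u *m plane_mx w x y z = plane_mx w x y z *m mu u by rewrite mulmxK ?mu_unit.
have E : forall b, mu u *m c (i, b) = u ^ s *: c (i, b) by move=> b; apply: central.
apply: (frame_ext_col cr) => -[j b].
rewrite -!mulmxA !plane_mxE /=; case: (eqVneq j i) => [->|ji].
  rewrite E -scalemxAr plane_mxE eqxx /=.
  by case: b; rewrite mulmxDr -!scalemxAr !E scalerDr !scalerA ![u ^ s * _]mulrC.
have := (planar_commute p_prime e_basis (mu u) pl pl).1 (fun x => mu_sc x u0) => H.
rewrite [mu u *m _](frame_decomp cr) mulmx_sumr; apply: eq_bigr => -[j' b'] _.
rewrite -scalemxAr plane_mxE /=; case: eqP => // E'.
by rewrite H ?scale0r //= E' eq_sym.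
Qed.

(** If mu is scalar on V_i, then P contains the SL(2) of V_i. Its two root subgroups persist in
    every term of the series, being generated by commutators with a torus element. *)
Lemma central_not_solvable : ~ solvable_subgroup (parP e mu).
Proof.
move=> [m [D [D0 Dm Dg Dc]]]; have [cr _ _] := pl.
(* The commutator of diag(s0, 1/s0) with a root element multiplies its parameter by s0^2 - 1 or
   s0^-2 - 1; both must be invertible. *)
have [s0 s00 s0n] : exists2 t : k, t != 0 & t ^+ 2 - 1 != 0.
  apply: contrapT => H; have : ('X * ('X ^+ 2 - 1) : {poly k}) = 0.
    apply: horner_fun0 => t; rewrite !hornerE.
    case: (eqVneq t 0) => [->|t0]; first by rewrite mul0r.
    by apply/eqP; rewrite mulf_eq0 (negPf t0) /=; apply: contrapT => /negP tn; apply: H; exists t.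
  move/eqP; rewrite mulf_eq0 polyX_eq0 /= subr_eq0 => /eqP/(congr1 (size : {poly k} -> nat)).
  by rewrite size_polyXn size_poly1.
have H j : (j <= m)%N -> forall x, D j (plane_mx 1 x 0 1) /\ D j (plane_mx 1 0 x 1).
  elim: j => [_ x|j IH jm x].
    by rewrite D0; split; apply: plane_mx_parP; ring.
  have Du y := (IH (ltnW jm) y).1; have Dl y := (IH (ltnW jm) y).2.
  have [_ DM _ _] := Dg j.
  have hD : D j (plane_mx s0 0 0 s0^-1).
    (* The torus element is a product of two Weyl elements, each a product of three root elements,
       hence lies in the same term of the series. *)
    have -> : plane_mx s0 0 0 s0^-1 =
       (plane_mx 1 s0 0 1 *m plane_mx 1 0 (- s0^-1) 1 *m plane_mx 1 s0 0 1) *m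
       (plane_mx 1 (-1) 0 1 *m plane_mx 1 0 1 1 *m plane_mx 1 (-1) 0 1).
      by rewrite !plane_mxM; apply: eq_plane_mx; field.
    have D3 A B C : D j A -> D j B -> D j C -> D j (A *m B *m C).
      by move=> DA DB DC; apply: (DM _ _ _ DC); apply: DM.
    by apply: (DM); apply: D3.
  have hV : invmx (plane_mx s0 0 0 s0^-1) = plane_mx s0^-1 0 0 s0.
    have [|-> _] := @plane_mxV s0 0 0 s0^-1; first by rewrite divff // mulr0 subr0.
    by rewrite oppr0.
  have s2 : s0 ^- 2 - 1 != 0.
    by rewrite subr_eq0 -[X in _ == X]invr1 (inj_eq invr_inj) -subr_eq0.
  have Vu y : invmx (plane_mx 1 y 0 1) = plane_mx 1 (- y) 0 1.
    by have [|-> _] := @plane_mxV 1 y 0 1; rewrite ?oppr0 //; ring.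
  have Vl y : invmx (plane_mx 1 0 y 1) = plane_mx 1 0 (- y) 1.
    by have [|-> _] := @plane_mxV 1 0 y 1; rewrite ?oppr0 //; ring.
  have Cu y : plane_mx s0 0 0 s0^-1 *m plane_mx 1 y 0 1 *m plane_mx s0^-1 0 0 s0 *m
      plane_mx 1 (- y) 0 1 = plane_mx 1 ((s0 ^+ 2 - 1) * y) 0 1.
    by rewrite !plane_mxM; apply: eq_plane_mx; field.
  have Cl y : plane_mx s0 0 0 s0^-1 *m plane_mx 1 0 y 1 *m plane_mx s0^-1 0 0 s0 *m
      plane_mx 1 0 (- y) 1 = plane_mx 1 0 ((s0 ^- 2 - 1) * y) 1.
    by rewrite !plane_mxM; apply: eq_plane_mx; field.
  split.
    have := Dc j _ (plane_mx 1 (x / (s0 ^+ 2 - 1)) 0 1) jm hD (Du _).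
    by rewrite hV Vu Cu mulrCA divff // mulr1.
  have := Dc j _ (plane_mx 1 0 (x / (s0 ^- 2 - 1)) 1) jm hD (Dl _).
  by rewrite hV Vl Cl mulrCA divff // mulr1.
have := (H m (leqnn m) 1).1; rewrite Dm /= => /(congr1 (fun g => g *m c (i, true))).
rewrite plane_mxE eqxx mul1mx /= !scale1r => /(congr1 (fun v => v - c (i, true))).
by rewrite addrK subrr => /eqP; rewrite (negPf (frame_colI cr _)).
Qed.

End Central.

Lemma row_eigen (c : Ix -> 'cV[k]_(d + d)) r (g : 'M[k]_(d + d)) (l : Ix -> k) : dual_frame c r ->
  (forall a, g *m c a = l a *: c a) -> forall a, r a *m g = l a *: r a.
Proof.
move=> cr gc a; rewrite [LHS](frame_decompl cr) (bigD1 a) //= big1 ?addr0.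
  by rewrite dotMA gc dotZr (frame_dual cr) eqxx mulr1.
by move=> b ba; rewrite dotMA gc dotZr (frame_dual cr) eq_sym (negPf ba) mulr0 scale0r.
Qed.

Lemma plane_dot0 (c : Ix -> 'cV[k]_(d + d)) r (v : 'cV[k]_(d + d)) (j : 'I_d) (a : Ix) :
  planar e tau c r ->
  (forall x, sc x *m v = emb tau j x *: v) -> a.1 != j -> dot (r a) v = 0.
Proof.
move=> [_ _ rr] vj aj; apply: (emb_sep p_prime e_basis (tau := tau) aj) => x.
by rewrite -dotZl -rr dotMA vj dotZr.
Qed.

Hypothesis mu_cochar : cocharacter (resGL2 k e) mu.
Hypothesis P_solv : solvable_subgroup (parP e mu).

Lemma mu_unit x : x != 0 -> mu x \in unitmx.
Proof. by move=> x0; have [/(_ x x0)[]] := mu_cochar. Qed.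
Lemma mu_sc x y : y != 0 -> mu y *m sc x = sc x *m mu y.
Proof. by move=> y0; have [/(_ y y0)[_]] := mu_cochar. Qed.

Lemma plane_weights (i : 'I_d) : exists (v : bool -> 'cV[k]_(d + d)) (n : bool -> int),
  [/\ n false < n true, forall b x, sc x *m v b = emb tau i x *: v b,
      forall b x, x != 0 -> mu x *m v b = x ^ n b *: v b &
      forall t t' : k, t *: v false + t' *: v true = 0 -> t = 0 /\ t' = 0].
Proof.
have [_ muM [N [A muA]]] := mu_cochar.
pose c := std_col e tau.
have pl : planar e tau c (std_row e tau) := planar_std p_prime k_char e_basis tau.
have [cr cc _] := pl.
have := two_weights mu_unit muM muA (c (i, true)) (frame_colI cr (i, false)).
case=> [[s Hs]|[s [t [u [u' [sM tM st Eu [Eu' [u0 u'0]]]]]]]].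
  exfalso; apply: (central_not_solvable pl mu_unit mu_sc (i := i) (s := s)) P_solv => x b x0.
  by have [] := Hs x x0; case: b.
set C := weight_mx A in Eu Eu'.
have Csc q (w : 'cV[k]_(d + d)) x : (q < \max_i \max_j size (A i j))%N ->
    w = C q *m c (i, false) \/ w = C q *m c (i, true) -> sc x *m w = emb tau i x *: w.
  move=> qM Ew; have com : C q *m sc x = sc x *m C q.
    by apply: (weight_mx_comm muA) => // y y0; apply: mu_sc.
  by case: Ew => ->; rewrite mulmxA -com -mulmxA cc -scalemxAr.
have CC q q' (w : 'cV[k]_(d + d)) : (q < \max_i \max_j size (A i j))%N ->
    (q' < \max_i \max_j size (A i j))%N ->
    w = C q *m c (i, false) \/ w = C q *m c (i, true) -> C q' *m w = (q' == q)%:R *: w.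
  by move=> qM q'M [] ->; rewrite mulmxA (weight_mxM muM muA) // -scalemxAl.
have Cmu q (w : 'cV[k]_(d + d)) x : (q < \max_i \max_j size (A i j))%N -> x != 0 ->
    w = C q *m c (i, false) \/ w = C q *m c (i, true) -> mu x *m w = x ^ (q%:Z - N%:Z) *: w.
  by move=> qM x0 [] ->; rewrite mulmxA (mu_weight_mx muM muA) // -scalemxAl.
have indep : forall a a' : k, a *: u + a' *: u' = 0 -> a = 0 /\ a' = 0.
  move=> a a' E; split.
    have := congr1 (mulmx (C s)) E; rewrite mulmxDr -!scalemxAr (CC s s u) // (CC t s u') //.
    rewrite eqxx (negPf st) scale1r scale0r scaler0 addr0 mulmx0 => /eqP.
    by rewrite scaler_eq0 (negPf u0) orbF => /eqP.
  have := congr1 (mulmx (C t)) E; rewrite mulmxDr -!scalemxAr (CC s t u) // (CC t t u') //.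
  rewrite eqxx eq_sym (negPf st) scale1r scale0r scaler0 add0r mulmx0 => /eqP.
  by rewrite scaler_eq0 (negPf u'0) orbF => /eqP.
case: (ltngtP s t) st => // lt _.
  exists (fun b => if b then u' else u), (fun b => if b then t%:Z - N%:Z else s%:Z - N%:Z).
  split=> //; first by rewrite ltrD2r ltz_nat.
    by case=> x; [apply: Csc Eu' | apply: Csc Eu].
  by case=> x x0; [apply: Cmu Eu' | apply: Cmu Eu].
exists (fun b => if b then u else u'), (fun b => if b then s%:Z - N%:Z else t%:Z - N%:Z).
split=> //; first by rewrite ltrD2r ltz_nat.
- by case=> x; [apply: Csc Eu | apply: Csc Eu'].
- by case=> x x0; [apply: Cmu Eu | apply: Cmu Eu'].
- by move=> a a'; rewrite addrC => /indep[].
Qed.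

Theorem adapted_frame : exists (c : Ix -> 'cV[k]_(d + d)) r (n : Ix -> int),
  [/\ planar e tau c r, forall i, n (i, false) < n (i, true) &
      forall x a, x != 0 -> mu x *m c a = x ^ n a *: c a].
Proof.
have [v Hv] := choice plane_weights; have [n Hn] := choice Hv.
pose c (a : Ix) := v a.1 a.2; pose sr := std_row e tau; pose s0 := std_col e tau.
have pl : planar e tau s0 sr := planar_std p_prime k_char e_basis tau.
have [cr _ _] := pl.
pose K i b b' := dot (sr (i, b)) (v i b').
pose D i := K i false false * K i true true - K i false true * K i true false.
have vE i b : v i b = K i false b *: s0 (i, false) + K i true b *: s0 (i, true).
  have [_ sv _ _] := Hn i; apply: plane_decomp => // a.
  by apply: (plane_dot0 pl) => x; apply: sv.
have D0 i : D i != 0.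
  have [_ _ _ ind] := Hn i.
  by apply: (det2_neq0 (x := s0 (i, false)) (y := s0 (i, true))) => t u; rewrite -!vE; apply: ind.
(* The dual rows by Cramer's rule, [K i] being the matrix of the weight vectors in the standard
   frame of V_i and [D i] its determinant. *)
pose r (a : Ix) := (D a.1)^-1 *: (if a.2 then K a.1 false false *: sr (a.1, true) - K a.1 true false *: sr (a.1, false)
  else K a.1 true true *: sr (a.1, false) - K a.1 false true *: sr (a.1, true)).
have cr' : dual_frame c r.
  apply: dual_complete => -[i b] [j b']; rewrite xpair_eqE /r /c /=.
  case: (eqVneq i j) => [<-|ij] /=; last first.
    have [_ sv _ _] := Hn j.
    by rewrite dotZl; case: b; rewrite dotDl dotNl !dotZl !(plane_dot0 pl (sv b')) //= !mulr0 subr0 mulr0.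
  have KE s t : dot (sr (i, s)) (v i t) = K i s t by [].
  have := D0 i; rewrite dotZl /D => Di.
  by case: b b' => [] [] /=; rewrite dotDl dotNl !dotZl /= !KE; field.
exists c, r, (fun a => n a.1 a.2); split.
- have cc : forall x a, sc x *m c a = emb tau a.1 x *: c a.
    by move=> x [i b]; have [_ sv _ _] := Hn i; apply: sv.
  split=> // x a; exact: (row_eigen cr' (cc x)).
- by move=> i; have [] := Hn i.
- by move=> x [i b] x0; have [_ _ wv _] := Hn i; apply: wv.
Qed.

End Regularity.

Local Notation cycle := Defs.cycle.

Lemma mult_cat (k : closedFieldType) (V : vectType k) (a b : cycle V) Z :
  mult (a ++ b) Z = mult a Z + mult b Z.
Proof. by rewrite /mult big_cat. Qed.

Lemma mult_seq (k : closedFieldType) (V : vectType k) (J : Type) (s : seq J) (q : J -> rat)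
    (Y : J -> set V) Z :
  mult [seq (q j, Y j) | j <- s] Z = \sum_(j <- s) q j * (`[< Y j = Z >])%:R.
Proof.
rewrite /mult big_map big_mkcond; apply: eq_bigr => j _ /=.
by case: asboolP => _; rewrite ?mulr1 ?mulr0.
Qed.

Lemma rat_equiv_mult (k : closedFieldType) (V : vectType k) (X : set V) (H : Type)
    (act : H -> V -> V) (a b : cycle V) :
  (forall D, inv_subvariety X act D -> mult a D = mult b D) -> rat_equiv X act a b.
Proof.
move=> ab; exists 0%N, (fun=> 0), (fun=> RatFun classical_sets.set0 0 0); split=> [[]//|D iD].
by rewrite big_ord0 addr0 ab.
Qed.

Lemma sum_enum_val (T : finType) (f : T -> rat) :
  \sum_(x : T) f x = \sum_(j < #|{: T}|) f (enum_val j).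
Proof. by rewrite -big_enum_val; apply: eq_bigl. Qed.

(** * The Grothendieck relation for a bundle filtered by line bundles *)
Section HornerScheme.
Variables (k : closedFieldType) (V : vectType k) (X : set V) (G : Type) (act : G -> V -> V).
Variables (p d : nat) (chi : G -> k) (ys : seq ('I_d * bool)).
Variable Y : {set 'I_d} -> nat -> set V.
Local Notation inv := (inv_subvariety X act).
Local Notation ind D Z := ((`[< Z = D >])%:R : rat).

Definition flag_mult D j (x : sqfree 'I_d) : rat := \sum_(K : {set 'I_d}) x K * ind D (Y K j).
Local Notation fn := flag_mult.

Hypothesis Y_end : forall I D, inv D -> Y I (size ys) <> D.
Variables (sec tri : {set 'I_d} -> nat -> ratfun V) (den : rat) (bet : {set 'I_d} -> nat -> cycle V).
Hypothesis sec_dom : forall I j, (j < size ys)%N -> rf_dom (sec I j) = Y I j.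
Hypothesis sec_rat : forall I j, (j < size ys)%N -> rat_section X act chi (sec I j).
Hypothesis tri_rat : forall I j, (j < size ys)%N -> rat_section X act (fun=> 1) (tri I j).
Hypothesis sec_mult : forall I j D, (j < size ys)%N -> inv D ->
  mult (bet I j) D = div_mult X (sec I j) D.
Variable y0 : 'I_d * bool.
Hypothesis sec_div : forall I j D, (j < size ys)%N -> inv D ->
  div_mult X (sec I j) D = ind D (Y I j.+1) -
    fn D j (cap_basis p (nth y0 ys j) I) + den * div_mult X (tri I j) D.

Let tl j m : sqfree 'I_d := chern_vec p (drop j.+1 ys) m.

Definition horner_index m := ({set 'I_d} * 'I_m.+1)%type.
(** In terms of classes this is the sum over j of [Y_j] c_(m-j)(y_(j+1), ...), where [Y_j] stands
    for the product of the xi + y_t with t < j: a partial evaluation of the product of all xi +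
    y_t. *)
Definition horner_cycle (m : nat) : cycle V :=
  [seq (tl x.2 (m - x.2) x.1, Y x.1 x.2) | x : horner_index m <- enum {: horner_index m}].

Lemma flag_multD D j x x' : fn D j (x + x') = fn D j x + fn D j x'.
Proof. by rewrite -big_split; apply: eq_bigr => K _; rewrite sqaddE mulrDl. Qed.

Lemma flag_mult_basis D j I : fn D j (stratum_basis I) = ind D (Y I j).
Proof.
rewrite /flag_mult (bigD1 I) //= ffunE eqxx mul1r big1 ?addr0 // => K KI.
by rewrite ffunE (negPf KI) mul0r.
Qed.

Lemma mult_horner_cycle m D : mult (horner_cycle m) D = \sum_(j < m.+1) fn D j (tl j (m - j)).
Proof.
rewrite mult_seq big_enum /= /flag_mult [RHS]exchange_big /=.
by rewrite (pair_bigA _ (fun I (j : 'I_m.+1) => tl j (m - j) I * ind D (Y I j))).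
Qed.

Lemma horner_cycle0 (c0 : cycle V) : (forall D, inv D -> mult c0 D = ind D (Y finset.set0 0)) ->
  rat_equiv X act (horner_cycle 0) c0.
Proof.
move=> c00; apply: rat_equiv_mult => D iD; rewrite c00 // mult_horner_cycle.
by rewrite big_ord1 /tl /= chern_vec0 flag_mult_basis.
Qed.

(** With r lines, a term j < r has degree r - j but only r - j - 1 lines left; for j = r no
    invariant subvariety equals [Y I r]. *)
Lemma horner_cycle_last : rat_equiv X act (horner_cycle (size ys)) [::].
Proof.
apply: rat_equiv_mult => D iD; rewrite [RHS]/mult big_nil mult_horner_cycle big1 // => j _.
rewrite /flag_mult big1 // => K _; have := ltn_ord j; rewrite ltnS leq_eqVlt => /orP[/eqP ->|jr].
  by have := @Y_end K D iD; case: asboolP => // _ _; rewrite mulr0.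
by rewrite /tl chern_vec_oversize ?sqzeroE ?mul0r // size_drop; lia.
Qed.

(** Each xi [Y_j] is replaced by [Y_(j+1)] - y_j [Y_j], up to the divisors of the functions [tri].
    The recursion defining [chern_vec] then makes the sum over j telescope. *)
Lemma horner_cycle_step (c : nat -> cycle V) m : (m < size ys)%N ->
  (forall D, inv D -> mult (c m.+1) D = fn D 0 (chern_vec p ys m.+1)) ->
  exists2 b', c1_cap X act chi (horner_cycle m) b' &
    rat_equiv X act (horner_cycle m.+1) (b' ++ c m.+1).
Proof.
move=> mr cm; pose T := horner_index m.
have jr (x : T) : (x.2 < size ys)%N by apply: leq_ltn_trans mr; rewrite -ltnS.
pose q (x : T) := tl x.2 (m - x.2) x.1.
pose b' : cycle V := flatten [seq [seq (q x * z.1, z.2) | z <- bet x.1 x.2] | x <- enum {: T}].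
have b'E D : inv D -> mult b' D = \sum_(x : T) q x * div_mult X (sec x.1 x.2) D.
  move=> iD; rewrite /b' /mult big_flatten big_map big_enum /=; apply: eq_bigr => x _.
  rewrite -sec_mult // /mult big_map mulr_sumr.
  by apply: eq_bigr.
pose en (j : 'I_#|{: T}|) : T := enum_val j.
have enumT (f : T -> rat) := sum_enum_val f.
exists b'.
  exists #|{: T}|, (fun j => q (en j)), (fun j => sec (en j).1 (en j).2).
  split=> [j|D iD|D iD]; first exact: sec_rat.
    rewrite !mult_seq !big_enum /= enumT; apply: eq_bigr => j _.
    by rewrite sec_dom.
  by rewrite b'E // enumT.
exists #|{: T}|, (fun j => - den * q (en j)), (fun j => tri (en j).1 (en j).2).
split=> [j|D iD]; first exact: tri_rat.
rewrite mult_cat b'E // cm // -(enumT (fun x => - den * q x * div_mult X (tri x.1 x.2) D)).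
rewrite addrAC -big_split /=.
pose g (x : T) := q x * (ind D (Y x.1 x.2.+1) - fn D x.2 (cap_basis p (nth y0 ys x.2) x.1)).
rewrite (eq_bigr g); last first.
  by move=> x _; rewrite sec_div // /g; ring.
(* The telescoping quantity: at [Y_j], the Chern coefficients of all lines from j on, including the
   j-th; [b j] is the same without the j-th line. *)
pose a j := fn D j (chern_vec p (drop j ys) (m.+1 - j)).
pose b j := fn D j (tl j (m.+1 - j)).
have -> : \sum_(x : T) g x = \sum_(j < m.+1) (a j.+1 - a j + b j).
  rewrite -(pair_bigA _ (fun I j => g (I, j))) exchange_big /=.
  apply: eq_bigr => j _; have jm : (j <= m)%N by rewrite -ltnS.
  have jr' : (j < size ys)%N by apply: leq_ltn_trans mr.
  have -> : a j.+1 = fn D j.+1 (tl j (m - j)) by rewrite /a subSS.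
  have -> : a j = b j + fn D j (cap_line p (nth y0 ys j) (tl j (m - j))).
    by rewrite /a /b -flag_multD subSn // (drop_nth y0 jr').
  rewrite (eq_bigr (fun I : {set 'I_d} => tl j (m - j) I * ind D (Y I j.+1) -
      tl j (m - j) I * fn D j (cap_basis p (nth y0 ys j) I))); last first.
    by move=> I _; rewrite /g mulrBr.
  have -> : forall u v w : rat, u - (v + w) + v = u - w by move=> u v w; ring.
  rewrite sumrB; congr (_ - _); rewrite /flag_mult.
  under eq_bigr => I _ do rewrite mulr_sumr.
  rewrite exchange_big; apply: eq_bigr => K _ /=.
  rewrite /cap_line sum_ffunE mulr_suml; apply: eq_bigr => I _.
  by rewrite (sqscaleE (tl j (m - j) I)) mulrA.
have tele n : \sum_(j < n) (a j.+1 - a j + b j) = a n - a 0%N + \sum_(j < n) b j.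
  elim: n => [|n IH]; first by rewrite !big_ord0 subrr addr0.
  by rewrite !big_ord_recr /= IH; ring.
rewrite tele mult_horner_cycle big_ord_recr /=.
have -> : fn D 0 (chern_vec p ys m.+1) = a 0%N by rewrite /a drop0 subn0.
have -> : a m.+1 = b m.+1 by rewrite /a /b subnn /tl !chern_vec0.
by rewrite /b /tl; ring.
Qed.
End HornerScheme.

(** * Subspaces described by the vanishing of coordinates *)

Section CoordinateSpaces.
Variables (k : fieldType) (V : vectType k) (I : finType).
Variables (eps : I -> V) (phi : I -> V -> k).
Hypothesis phi_lin : forall i a u v, phi i (a *: u + v) = a * phi i u + phi i v.
Hypothesis phi_dual : forall i j, phi i (eps j) = (i == j)%:R.
Hypothesis phi_complete : forall v, v = \sum_i phi i v *: eps i.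
Variable P : pred I.

Let phi0 i : phi i 0 = 0.
Proof. by have := phi_lin i (-1) 0 0; rewrite scaler0 addr0 mulN1r addNr. Qed.
Let phi_sum i (J : finType) (a : J -> k) (w : J -> V) :
  phi i (\sum_j a j *: w j) = \sum_j a j * phi i (w j).
Proof.
by elim/big_rec2: _ => [|j y1 y2 _ <-]; [exact: phi0 | rewrite phi_lin].
Qed.

Let X : #|P|.-tuple V := [tuple eps (enum_val j) | j < #|P|].
Definition coord_space : {vspace V} := <<X>>%VS.

Let XE (j : 'I_#|P|) : X`_j = eps (enum_val j).
Proof. by rewrite -tnth_nth tnth_mktuple. Qed.

Lemma memv_coord_space v : v \in coord_space <-> forall i, ~~ P i -> phi i v = 0.
Proof.
split=> [/coord_span -> i Pi|v0].
  rewrite phi_sum big1 // => j _; rewrite XE phi_dual.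
  case: eqP => [E|_]; last by rewrite mulr0.
  by move: Pi; rewrite E; have := enum_valP j; rewrite unfold_in => ->.
rewrite [v]phi_complete; apply: memv_suml => i _; case: (boolP (P i)) => Pi; last first.
  by rewrite v0 // scale0r mem0v.
apply: memvZ; apply: memv_span; apply/mapP.
have iP : i \in P by [].
by exists (enum_rank_in iP i); rewrite ?mem_enum // enum_rankK_in.
Qed.

Lemma dim_coord_space : \dim coord_space = #|P|.
Proof.
apply/eqP; rewrite -[X in _ == X](size_tuple X); apply/freeP => a a0 j.
have := congr1 (phi (enum_val j)) a0; rewrite phi0 phi_sum.
rewrite (bigD1 j) //= XE phi_dual eqxx mulr1 big1 ?addr0 // => l lj.
by rewrite XE phi_dual (inj_eq enum_val_inj) eq_sym (negPf lj) mulr0.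
Qed.
End CoordinateSpaces.

Lemma vspace_ofP (k : fieldType) (T : vectType k) (S : set T) (U : {vspace T}) :
  (forall v, v \in U <-> S v) -> vspace_of S = U.
Proof.
move=> US; rewrite /vspace_of; case: xgetP => [W -> WS|/(_ U)[]]; last exact: US.
by apply/vspaceP => v; apply/idP/idP => [/WS/US|/US/WS].
Qed.

Lemma expz_inj (k : closedFieldType) (m m' : int) :
  (forall x : k, x != 0 -> x ^ m = x ^ m') -> m = m'.
Proof.
have H (j : nat) : (forall x : k, x != 0 -> x ^+ j = 1) -> j = 0%N.
  move=> j1; have : ('X * ('X ^+ j - 1) : {poly k}) = 0.
    apply: horner_fun0 => t; rewrite !hornerE.
    by case: (eqVneq t 0) => [->|/j1 ->]; rewrite ?mul0r ?subrr ?mulr0.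
  move/eqP; rewrite mulf_eq0 polyX_eq0 /= subr_eq0 => /eqP/(congr1 (size : {poly k} -> nat)).
  by rewrite size_polyXn size_poly1 => -[].
have K m1 m2 : m1 <= m2 -> (forall x : k, x != 0 -> x ^ m1 = x ^ m2) -> m1 = m2.
  move=> le E; suff : `|m2 - m1|%N = 0%N by lia.
  apply: H => x x0; rewrite exprnP gez0_abs ?subr_ge0 // expfzDr // -E // -expfzDr //.
  by rewrite subrr expr0z.
move=> E; case: (leP m m') => [le|/ltW le]; first exact: K.
by apply/esym/K => // x x0; rewrite E.
Qed.

Section ZeroSpace.
Variables (k : fieldType) (V : vectType k) (A : finType) (phi : A -> V -> k).
Hypothesis phi_lin : forall i a u v, phi i (a *: u + v) = a * phi i u + phi i v.

Definition zero_space : {vspace V} := vspace_of [set v | forall a, phi a v = 0].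

Lemma memv_zero_space v : v \in zero_space <-> forall a, phi a v = 0.
Proof.
pose f (v : V) : 'rV[k]_#|A| := \row_j phi (enum_val j) v.
have fL : linear f by move=> a u w; apply/rowP => j; rewrite !mxE phi_lin.
pose g : {linear V -> 'rV[k]_#|A|} :=
  HB.pack f (GRing.isLinear.Build k V 'rV[k]_#|A| *:%R f fL).
have gP w : w \in lker (linfun g) <-> forall a, phi a w = 0.
  rewrite memv_ker lfunE /=; split=> [/eqP/rowP E a|w0].
    by have := E (enum_rank a); rewrite !mxE enum_rankK.
  by apply/eqP/rowP => j; rewrite !mxE w0.
by rewrite /zero_space (vspace_ofP gP).
Qed.
End ZeroSpace.

(** * The zip group, its characters and its orbits in adapted coordinates *)

Section AdaptedFrame.
Variables (p : nat) (p_prime : prime p) (k : closedFieldType) (k_char : p \in [pchar k]).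
Variables (d : nat) (d_gt0 : (0 < d)%N).
Variables (F : fieldExtType 'F_p) (e : d.-tuple F) (e_basis : basis_of fullv e).
Variable tau : {rmorphism F -> k}.
Variables (mu : k -> 'M[k]_(d + d)).
Local Notation Ix := ('I_d * bool)%type.
Local Notation sc := (scalar_mx2 k e).
Variables (c : Ix -> 'cV[k]_(d + d)) (r : Ix -> 'rV[k]_(d + d)) (n : Ix -> int).
Hypothesis pl : planar e tau c r.
Hypothesis n_lt : forall i, n (i, false) < n (i, true).
Hypothesis mu_c : forall x a, x != 0 -> mu x *m c a = x ^ n a *: c a.
Hypothesis mu_unit : forall x, x != 0 -> mu x \in unitmx.

Let cr : dual_frame c r. Proof. by have [] := pl. Qed.
Let q := frob_cols p c.
Let rq := frob_rows p r.
Lemma planar_q : planar e tau q rq. Proof. exact: (planar_frob p_prime k_char e_basis pl). Qed.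
Let plq := planar_q.
Let qrq : dual_frame q rq. Proof. by have [] := plq. Qed.

Lemma mu_r x a : x != 0 -> r a *m mu x = x ^ n a *: r a.
Proof. by move=> x0; apply: (row_eigen (l := fun a => x ^ n a) cr) => b; apply: mu_c. Qed.

Lemma inv_mu_c x b : x != 0 -> invmx (mu x) *m c b = x ^ (- n b) *: c b.
Proof.
move=> x0; have {1}-> : c b = x ^ (- n b) *: (mu x *m c b).
  by rewrite mu_c // scalerA -expfzDr // addNr expr0z scale1r.
by rewrite -scalemxAr mulKmx // mu_unit.
Qed.

Definition ent (g : 'M[k]_(d + d)) a b := dot (r a) (g *m c b).
(** Elements of G preserve each plane, and mu has distinct weights there, so the Levi factor is a
    torus and this is the projection to it. *)
Definition diag_part g : 'M[k]_(d + d) := \sum_a ent g a a *: (c a *m r a).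

Lemma ent_diag_part g a b : ent (diag_part g) a b = (a == b)%:R * ent g a a.
Proof.
rewrite /ent mulmx_suml dot_sumr (bigD1 a) //= big1 ?addr0.
  by rewrite -scalemxAl dotZr dot_mul !(frame_dual cr) eqxx mul1r mulrC.
by move=> x xa; rewrite -scalemxAl dotZr dot_mul (frame_dual cr) eq_sym (negPf xa) mul0r mulr0.
Qed.

Lemma G_ent (g : 'M[k]_(d + d)) a b : resGL2 k e g -> a.1 != b.1 -> ent g a b = 0.
Proof. by move=> [_ /(planar_commute p_prime e_basis g pl pl) H] /H. Qed.

Lemma ad_weightP m A : ad_weight mu m A <->
  forall a b, ent A a b != 0 -> n a - n b = m.
Proof.
split=> [wA a b nz|H x x0].
  apply: (@expz_inj k) => x x0; apply: (mulIf nz).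
  rewrite -[RHS]dotZr scalemxAl -(wA x x0) -!mulmxA.
  rewrite inv_mu_c //.
  by rewrite -!scalemxAr dotZr -dotMA mu_r // dotZl mulrA expfzDr // [x ^ n a * _]mulrC.
apply: (frame_ext cr cr) => a b.
have -> : mu x *m A *m invmx (mu x) *m c b = x ^ (- n b) *: (mu x *m (A *m c b)).
  by rewrite -mulmxA inv_mu_c // -!scalemxAr -mulmxA.
rewrite dotZr -(dotMA _ (mu x)) mu_r // dotZl -scalemxAl dotZr mulrA -expfzDr // -/(ent A a b).
case: (eqVneq (ent A a b) 0) => [->|/H <-]; first by rewrite !mulr0.
by rewrite addrC.
Qed.

Definition sg (s : bool) : int := if s then 1 else -1.

Lemma ent_same_weight (g : 'M[k]_(d + d)) a b : resGL2 k e g -> n a = n b ->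
  ent g a b = (a == b)%:R * ent g a a.
Proof.
move=> Gg nab; case: (eqVneq a b) => [<-|ab]; rewrite ?mul1r // mul0r.
apply: G_ent => //; apply: contraNneq ab; case: a b nab => i s [j t] /= + E.
by rewrite -{}E; have := n_lt i; case: s t => [] [] // + E; rewrite E ltxx.
Qed.

Lemma weight_diff_sign s g a b : resGL2 k e g -> (forall i, ent g (i, ~~ s) (i, s) = 0) ->
  ent g a b != 0 -> n a - n b = sg s * `|n a - n b|%:Z.
Proof.
move=> Gg g0 nz; have : a.1 = b.1 by apply/eqP; apply: contraNT nz => ab; rewrite G_ent.
case: a b nz => i x [j y] /= + E; rewrite -{}E {j}; have := n_lt i; have := g0 i.
by case: s {g0} x y => [] [] [] /= E; rewrite ?E ?eqxx // /sg; lia.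
Qed.

Lemma weight_projP s g l : resGL2 k e g ->
  weight_proj mu (sg s) g l <->
  (forall i, ent g (i, ~~ s) (i, s) = 0) /\ l = diag_part g.
Proof.
move=> Gg; split=> [[N [A [wA Eg El]]]|[g0 El]].
  have wt t a b : ent (A t) a b != 0 -> n a - n b = sg s * t%:Z by exact: ((ad_weightP _ _).1 (wA t) a b).
  have gE a b : ent g a b = \sum_(t < N.+1) ent (A t) a b.
    by rewrite /ent Eg mulmx_suml dot_sumr.
  split=> [i|].
    rewrite gE big1 // => t _; apply/eqP/negPn/negP => /wt E.
    by have := n_lt i; move: E; case: s {wA wt} => /=; rewrite /sg; lia.
  apply: (frame_ext cr cr) => a b; rewrite -/(ent _ a b) -/(ent _ a b) ent_diag_part El.
  have g0 a' b' : n a' = n b' -> ent (A 0%N) a' b' = ent g a' b'.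
    move=> nab; rewrite gE (bigD1 ord0) //= big1 ?addr0 // => t t0.
    apply/eqP/negPn/negP => /wt E.
    by move: t0; rewrite -val_eqE /=; move: E; rewrite nab; case: s {wA wt} => /=; rewrite /sg; lia.
  case: (eqVneq (n a) (n b)) => nab; first by rewrite g0 // ent_same_weight.
  have -> : (a == b) = false by apply: contraNF nab => /eqP ->.
  by rewrite mul0r; apply/eqP/negPn/negP => /wt E; move: nab; rewrite -subr_eq0 E mulr0 eqxx.
pose A (t : nat) := frame_mx c r (fun a b => if n a - n b == sg s * t%:Z then ent g a b else 0).
have AE t a b : ent (A t) a b = if n a - n b == sg s * t%:Z then ent g a b else 0.
  by rewrite /ent /A (frame_mxE cr cr).
(* Any bound on the absolute values of the weight differences serves; their sum is one. *)
exists (\sum_a \sum_b `|n a - n b|)%N, A; split.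
- by move=> t; apply/ad_weightP => a b; rewrite AE; case: (eqVneq (n a - n b) (sg s * t%:Z)) => // _; rewrite eqxx.
- apply: (frame_ext cr cr) => a b; rewrite mulmx_suml dot_sumr -/(ent g a b).
  rewrite (eq_bigr (fun t : 'I__ => if n a - n b == sg s * t%:Z then ent g a b else 0)); last first.
    by move=> t _; rewrite -AE.
  case: (eqVneq (ent g a b) 0) => [->|nz]; first by rewrite big1 // => t _; rewrite if_same.
  have sgn := weight_diff_sign Gg g0 nz.
  have lt : (`|n a - n b| < (\sum_a \sum_b `|n a - n b|).+1)%N.
    by rewrite ltnS (bigD1 a) //= (bigD1 (P := xpredT) b) //= -addnA leq_addr.
  rewrite (bigD1 (Ordinal lt)) //= -sgn eqxx big1 ?addr0 // => t tn.
  case: eqP => // E; case/negP: tn; rewrite -val_eqE /= E.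
  by case: (s); rewrite /sg ?mul1r ?mulN1r ?abszN absz_nat.
rewrite El; apply: (frame_ext cr cr) => a b; rewrite -/(ent _ a b) -/(ent _ a b) ent_diag_part AE.
rewrite mulr0 subr_eq0; case: (eqVneq (n a) (n b)) => nab; first by rewrite -ent_same_weight.
by have -> : (a == b) = false; [apply: contraNF nab => /eqP -> | rewrite mul0r].
Qed.

Lemma parabolicP s g : parabolic (resGL2 k e) mu (sg s) g <->
  resGL2 k e g /\ forall i, ent g (i, ~~ s) (i, s) = 0.
Proof.
split=> [[Gg [l /weight_projP[]]]|[Gg g0]] //; split=> //.
by exists (diag_part g); apply/weight_projP.
Qed.

Lemma leviE a : parP e mu a -> levi mu a = diag_part a.
Proof.
move=> Pa; have [Ga a0] := (parabolicP false a).1 Pa; rewrite /levi.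
case: xgetP => [l -> /(weight_projP false _ Ga)[] //|/(_ (diag_part a))[]].
exact/(weight_projP false _ Ga).
Qed.

Lemma frob_inj m : injective (@frob k p d m).
Proof.
move=> A B /matrixP E; apply/matrixP => i j; have := E i j; rewrite !mxE => H.
apply/eqP; rewrite -subr_eq0; have : (A i j - B i j) ^+ p == 0.
  have -> : (A i j - B i j) ^+ p = A i j ^+ p - B i j ^+ p.
    exact: (rmorphB (pFrobenius_aut k_char)).
  by rewrite H subrr.
by rewrite expf_eq0 => /andP[].
Qed.

Lemma frobZ m (t : k) (v : 'M[k]_(d + d, m)) : frob p (t *: v) = t ^+ p *: frob p v.
Proof. by apply/matrixP => i j; rewrite !mxE exprMn. Qed.

Lemma frobDm m (v w : 'M[k]_(d + d, m)) : frob p (v + w) = frob p v + frob p w.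
Proof. by apply/matrixP => i j; rewrite !mxE; apply: (rmorphD (pFrobenius_aut k_char)). Qed.

(** Frobenius is injective on matrices, so the condition on Levi parts becomes equality of diagonal
    entries before the twist. *)
Lemma zip_groupP ab : zip_group e mu ab <->
  parP e mu ab.1 /\ exists b0, [/\ resGL2 k e b0, forall i, ent b0 (i, false) (i, true) = 0,
     ab.2 = frob p b0 & forall x, ent ab.1 x x = ent b0 x x].
Proof.
split=> [[Pa [b0 [bb [Pb Eb wb /frob_inj El]]]]|[Pa [b0 [Gb b00 Eb Ed]]]]; split=> //.
  have [Gb b00] := (parabolicP true b0).1 Pb.
  exists b0; split=> // x; have [_ Ebb] := (weight_projP true bb Gb).1 wb.
  move: El; rewrite leviE // Ebb => /(congr1 (fun g => ent g x x)).
  by rewrite !ent_diag_part eqxx !mul1r.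
exists b0, (diag_part b0); split=> //; first exact/(parabolicP true).
  exact/(weight_projP true).
congr frob; rewrite leviE //; apply: (frame_ext cr cr) => a b.
by rewrite -!/(ent _ a b) !ent_diag_part Ed.
Qed.

Lemma G_frob g : resGL2 k e g -> resGL2 k e (frob p g).
Proof.
move=> [gU gc]; split.
  by rewrite /frob (_ : map_mx _ g = map_mx (pFrobenius_aut k_char) g) ?map_unitmx //;
     apply/matrixP => i j; rewrite !mxE.
by move=> x; rewrite -(frob_scal p_prime k_char) -!frobM // gc.
Qed.

Lemma parP_col a i : parP e mu a -> a *m c (i, false) = ent a (i, false) (i, false) *: c (i, false).
Proof.
move=> Pa; have [Ga a0] := (parabolicP false a).1 Pa.
rewrite [LHS](plane_decomp (i := i) cr); last by move=> x xi; apply: (G_ent (b := (i, false))).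
by rewrite -/(ent a (i, true) (i, false)) a0 scale0r addr0.
Qed.

Lemma frob_qcol b i : parabolic (resGL2 k e) mu (sg true) b ->
  frob p b *m q (i, false) =
  ent b (ord_pred i, true) (ord_pred i, true) ^+ p *: q (i, false).
Proof.
move=> Pb; have [Gb b0] := (parabolicP true b).1 Pb.
rewrite /q /frob_cols /= -frobM // -frobZ; congr frob; set j := ord_pred i.
rewrite [LHS](plane_decomp (i := j) cr); last by move=> x xi; apply: (G_ent (b := (j, true))).
by rewrite -/(ent b (j, false) (j, true)) b0 scale0r add0r.
Qed.

Section ZipElement.
Variable h : zipE e mu.
Let a := (sval h).1.
Let b := (sval h).2.
(** The diagonal entries of a are characters of E; every line bundle that occurs is built from them
    and the scaling character of O(1). *)
Definition chi (x : Ix) : k := ent a x x.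

Lemma zipE_G : resGL2 k e a /\ resGL2 k e b.
Proof.
have [[Ga _] [b0 [Gb _ Eb _]]] := (zip_groupP (sval h)).1 (svalP h).
by split=> //; rewrite /b Eb; apply: G_frob.
Qed.

Lemma zipE_col i : a *m c (i, false) = chi (i, false) *: c (i, false).
Proof. by have [Pa _] := (zip_groupP (sval h)).1 (svalP h); apply: parP_col. Qed.

Lemma zipE_row i : r (i, true) *m a = chi (i, true) *: r (i, true).
Proof.
have [Pa _] := (zip_groupP (sval h)).1 (svalP h); have [Ga a0] := (parabolicP false a).1 Pa.
rewrite [LHS](frame_decompl cr) (bigD1 (i, true)) //= dotMA big1 ?addr0 // => -[j s].
case: (eqVneq j i) => [->|ji] E; rewrite dotMA.
  by case: s E => [|_]; rewrite ?eqxx // -/(ent a (i, true) (i, false)) a0 scale0r.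
by rewrite -/(ent a (i, true) (j, s)) G_ent ?scale0r //= eq_sym.
Qed.

(** The condition on Levi parts enters here: eigenvalues of b are p-th powers of characters of a one
    index earlier. *)
Lemma zipE_qcol i : b *m q (i, false) = chi (ord_pred i, true) ^+ p *: q (i, false).
Proof.
have [_ [b0 [Gb b00 Eb Ed]]] := (zip_groupP (sval h)).1 (svalP h).
by rewrite /chi /a Ed /b Eb; apply: frob_qcol; apply/(parabolicP true).
Qed.

Lemma zipE_qrow i : rq (i, true) *m b = chi (ord_pred i, false) ^+ p *: rq (i, true).
Proof.
have [_ [b0 [Gb b00 Eb Ed]]] := (zip_groupP (sval h)).1 (svalP h).
rewrite /b Eb /rq /frob_rows /frob_row /frob -map_frob_mul //=.
rewrite (_ : r _ *m b0 = chi (ord_pred i, false) *: r (ord_pred i, false)).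
  by apply/matrixP => x y; rewrite !mxE exprMn.
rewrite /chi /a Ed; set j := ord_pred i.
rewrite [LHS](frame_decompl cr) (bigD1 (j, false)) //= dotMA big1 ?addr0 // => -[l s].
case: (eqVneq l j) => [->|ji] E; rewrite dotMA.
  by case: s E => [_|]; rewrite ?eqxx // -/(ent b0 (j, false) (j, true)) b00 scale0r.
by rewrite -/(ent b0 (j, false) (l, s)) G_ent ?scale0r //= eq_sym.
Qed.

Lemma chi_neq0 x : chi x != 0.
Proof.
have [[aU _] _] := zipE_G; case: x => i [].
  apply/eqP => E; have := zipE_row i; rewrite E scale0r => /(congr1 (mulmx^~ (invmx a))).
  rewrite mulmxK // mul0mx => E'; have := frame_dual cr (i, true) (i, true).
  by rewrite E' /dot mul0mx mxE eqxx => /esym/eqP; rewrite oner_eq0.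
apply/eqP => E; have := zipE_col i; rewrite E scale0r => /(congr1 (mulmx (invmx a))).
by rewrite mulKmx // mulmx0 => /eqP; rewrite (negPf (frame_colI cr _)).
Qed.

Lemma zipE_levi x : r x *m levi mu a = chi x *: r x.
Proof.
have [Pa _] := (zip_groupP (sval h)).1 (svalP h); rewrite leviE //.
rewrite [LHS](frame_decompl cr) (bigD1 x) //= dotMA -/(ent _ x x) ent_diag_part eqxx mul1r.
rewrite big1 ?addr0 // => y yx; rewrite dotMA -/(ent _ x y) ent_diag_part eq_sym (negPf yx).
by rewrite mul0r scale0r.
Qed.
End ZipElement.

Lemma G_mul g h : resGL2 k e g -> resGL2 k e h -> resGL2 k e (g *m h).
Proof.
move=> [gU gc] [hU hc]; split=> [|x]; first by rewrite unitmx_mul gU.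
by rewrite -mulmxA hc !mulmxA gc.
Qed.

Lemma G_inv g : resGL2 k e g -> resGL2 k e (invmx g).
Proof.
move=> [gU gc]; split=> [|x]; first by rewrite unitmx_inv.
by rewrite -[LHS](mulmxK gU) -(mulmxA (invmx g)) -gc mulKmx.
Qed.

Definition gent (g : 'M[k]_(d + d)) i s t := dot (r (i, s)) (g *m q (i, t)).

Lemma G_gent g x y : resGL2 k e g -> x.1 != y.1 -> dot (r x) (g *m q y) = 0.
Proof. by move=> [_ /(planar_commute p_prime e_basis g pl plq) H] /H. Qed.

Lemma G_q g i t : resGL2 k e g ->
  g *m q (i, t) = gent g i false t *: c (i, false) + gent g i true t *: c (i, true).
Proof. by move=> Gg; apply: (plane_decomp cr) => x xi; apply: (G_gent (y := (i, t))). Qed.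

Definition gdet g i := gent g i false false * gent g i true true -
  gent g i false true * gent g i true false.

Lemma gdet_neq0 g i : resGL2 k e g -> gdet g i != 0.
Proof.
move=> Gg; have [gU _] := Gg.
rewrite /gdet; apply: (det2_neq0 (x := c (i, false)) (y := c (i, true))) => u w.
rewrite -!G_q // !scalemxAr -mulmxDr => /(congr1 (mulmx (invmx g))).
rewrite mulKmx // mulmx0 => E; split.
  have := congr1 (dot (rq (i, false))) E; rewrite dotDr !dotZr !(frame_dual qrq) dot0r.
  by rewrite !xpair_eqE !eqxx mulr1 mulr0 addr0.
have := congr1 (dot (rq (i, true))) E; rewrite dotDr !dotZr !(frame_dual qrq) dot0r.
by rewrite !xpair_eqE !eqxx mulr1 mulr0 add0r.
Qed.

Lemma G_build c1 r1 c2 r2 (A : 'I_d -> bool -> bool -> k) :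
  planar e tau c1 r1 -> planar e tau c2 r2 ->
  (forall i, A i false false * A i true true - A i false true * A i true false != 0) ->
  exists2 g, resGL2 k e g & forall i s t, dot (r1 (i, s)) (g *m c2 (i, t)) = A i s t.
Proof.
move=> p1 p2 D0; have [cr1 _ _] := p1; have [cr2 _ _] := p2.
pose g := frame_mx c1 r2 (fun x y => if x.1 == y.1 then A x.1 x.2 y.2 else 0).
have gE x y : dot (r1 x) (g *m c2 y) = if x.1 == y.1 then A x.1 x.2 y.2 else 0.
  by rewrite (frame_mxE cr1 cr2).
exists g; last by move=> i s t; rewrite gE eqxx.
split; last first.
  by apply/(planar_commute p_prime e_basis g p1 p2) => x y xy; rewrite gE (negPf xy).
rewrite -unitmx_tr -row_free_unit; apply: inj_row_free => v v0.
have {}v0 : g *m v^T = 0 by rewrite -[LHS]trmxK trmx_mul trmxK v0 trmx0.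
apply: trmx_inj; rewrite trmx0; apply: (frame_extv cr2) => -[i t]; rewrite dot0r.
have E s : A i s false * dot (r2 (i, false)) v^T + A i s true * dot (r2 (i, true)) v^T = 0.
  have := congr1 (dot (r1 (i, s))) v0; rewrite dot0r (entry_mul cr2) => E.
  have tf : (i, true) != (i, false) by rewrite xpair_eqE andbF.
  rewrite -[RHS]E (bigD1 (i, false)) //= (bigD1 (i, true)) //= !gE eqxx big1 ?addr0 //.
  move=> -[j u] /andP[]; rewrite gE /=; case: (eqVneq i j) => [<-|]; last by rewrite mul0r.
  by case: u; rewrite eqxx.
apply: (mulfI (D0 i)); rewrite mulr0; case: t.
  transitivity (A i false false * (A i true false * dot (r2 (i, false)) v^T + A i true true * dot (r2 (i, true)) v^T)
     - A i true false * (A i false false * dot (r2 (i, false)) v^T + A i false true * dot (r2 (i, true)) v^T)).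
    by ring.
  by rewrite !E !mulr0 subrr.
transitivity (A i true true * (A i false false * dot (r2 (i, false)) v^T + A i false true * dot (r2 (i, true)) v^T)
   - A i false true * (A i true false * dot (r2 (i, false)) v^T + A i true true * dot (r2 (i, true)) v^T)).
  by ring.
by rewrite !E !mulr0 subrr.
Qed.

Lemma root_power (u : k) m : u != 0 -> (1 < m)%N -> exists2 x, x != 0 & x = u * x ^+ m.
Proof.
move=> u0; case: m => [|[|m]] // _.
have sz : size ('X^(m.+1) - (u^-1)%:P : {poly k}) != 1%N by rewrite size_XnsubC.
have [x] := elimT (closed_rootP _) sz; rewrite rootE !hornerE subr_eq0 => /eqP E.
have x0 : x != 0.
  by apply: contra_eq_neq E => ->; rewrite expr0n eq_sym invr_eq0.
by exists x => //; rewrite exprS E mulrCA divff // mulr1.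
Qed.

(** A system of Lang type for the torus: values propagate from index to index by a p-th power and a
    scalar, with a possible swap of the two lines, and must close up after one turn. *)
Lemma torus_system (sw : 'I_d -> bool) (u : 'I_d -> bool -> k) : (forall i b, u i b != 0) ->
  exists2 z : Ix -> k, (forall x, z x != 0) &
    forall i b, z (i, b) = u i b * z (ord_pred i, b (+) sw i) ^+ p.
Proof.
move=> u0; pose od m : 'I_d := Ordinal (ltn_pmod m d_gt0).
pose st (W : bool -> k) := fix st (m : nat) : bool -> k :=
  if m is m'.+1 then fun b => u (od m') b * st m' (b (+) sw (od m')) ^+ p else W.
have stE m : exists (C : bool -> k) (par : bool), (forall b, C b != 0) /\
    forall (W : bool -> k) b, st W m b = C b * W (b (+) par) ^+ (p ^ m).
  elim: m => [|m [C [par [C0 IH]]]].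
    by exists (fun=> 1), false; split=> [b|W' b]; rewrite ?oner_neq0 // addbF expr1 mul1r.
  exists (fun b => u (od m) b * C (b (+) sw (od m)) ^+ p), (sw (od m) (+) par).
  split=> [b|W' b]; first by rewrite mulf_neq0 // expf_neq0.
  by rewrite /= IH exprMn mulrA -exprM -expnSr addbA.
have [C [par [C0 HC]]] := stE d.
have pd1 : (1 < p ^ d)%N by rewrite -(exp1n d) ltn_exp2r // prime_gt1.
(* If the turn preserves the lines, each gives an equation x = u x^(p^d). If it swaps them,
   substituting one equation into the other gives the exponent p^2d. *)
have [W W0 HW] : exists2 W : bool -> k, (forall b, W b != 0) & forall b, st W d b = W b.
  case: par HC => HC; last first.
    have [x x0 Ex] := root_power (C0 false) pd1; have [y y0 Ey] := root_power (C0 true) pd1.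
    exists (fun b : bool => if b then y else x); first by case.
    by case; rewrite HC /= -?Ey -?Ex.
  have pd2 : (1 < p ^ d * p ^ d)%N by apply: (leq_trans pd1); rewrite leq_pmulr // ltnW.
  have [|x x0 Ex] := @root_power (C false * C true ^+ (p ^ d)) _ _ pd2.
    by rewrite mulf_neq0 // expf_neq0.
  exists (fun b : bool => if b then C true * x ^+ (p ^ d) else x).
    by case=> //; rewrite mulf_neq0 // expf_neq0.
  by case; rewrite HC //= exprMn -exprM mulrA -Ex.
have st0 m b : st W m b != 0.
  by elim: m b => [|m IH] b //=; rewrite mulf_neq0 // expf_neq0.
exists (fun x : Ix => st W x.1.+1 x.2) => [x|i b]; first exact: st0.
have odi : od i = i by apply: ord_inj; rewrite /= modn_small.
have key b' : st W i b' = st W (ord_pred i).+1 b'.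
  have [i0|i0] := posnP i.
    have -> : (ord_pred i).+1 = d by rewrite /= i0 add0n modn_small ?prednK.
    by rewrite i0 HW.
  congr (st W _ b'); have := ltn_ord i; rewrite /=; move: (val i) i0 => [//|m] _ md.
  by rewrite addSn /= modnDr modn_small // ltnW.
by rewrite -key /= odi.
Qed.

Lemma pth_root (x : k) : exists y, y ^+ p = x.
Proof.
have sz : size ('X^p - x%:P : {poly k}) != 1%N.
  by rewrite size_XnsubC ?prime_gt0 //; case: p p_prime.
have [y] := elimT (closed_rootP _) sz; rewrite rootE !hornerE subr_eq0 => /eqP E.
by exists y.
Qed.

(** The equation a g = g' b is solved block by block: [torus_system] finds the diagonal entries,
    after which the unipotent entries satisfy linear equations. *)
Lemma zip_transporter g g' : resGL2 k e g -> resGL2 k e g' ->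
  (forall i, (gent g i true false == 0) = (gent g' i true false == 0)) ->
  exists h : zipE e mu, (sval h).1 *m g = g' *m (sval h).2.
Proof.
move=> Gg Gg' al; have D0 i := gdet_neq0 i Gg; have D0' i := gdet_neq0 i Gg'.
pose sw i := gent g i true false == 0.
have sw' i : sw i = (gent g' i true false == 0) by exact: al.
(* In an aligned block the diagonal entries of a g = g' b link a line to the opposite line one index
   earlier. Otherwise the (2,1) entry and the determinant link lines with equal labels. *)
pose u i b := if sw i then gent g' i b b / gent g i b b
  else if b then gent g' i true false / gent g i true false
  else (gdet g' i / gent g' i true false) / (gdet g i / gent g i true false).
have diag f i b : gdet f i != 0 -> gent f i true false == 0 -> gent f i b b != 0.
  move=> + /eqP E; rewrite /gdet E mulr0 subr0 mulf_eq0 negb_or => /andP[].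
  by case: b.
have u0 i b : u i b != 0.
  rewrite /u; case: ifP => s.
    have n1 := diag g i b (D0 i) s; have n2 : gent g' i b b != 0 by apply: diag; rewrite -?sw'.
    by rewrite mulf_neq0 ?invr_eq0.
  have n1 : gent g i true false != 0 by apply/negbT.
  have n2 : gent g' i true false != 0 by apply/negbT; rewrite -sw'.
  by case: b; rewrite ?mulf_neq0 ?invr_eq0 ?mulf_neq0 ?invr_eq0.
have [z z0 Hz] := torus_system sw u0.
pose x i := z (i, false); pose y i := z (i, true).
pose X i := z (ord_pred i, false) ^+ p; pose Y i := z (ord_pred i, true) ^+ p.
(* The unipotent entries of a and b as forced by the remaining entries of the block; in an aligned
   block one equation is left, and [be] is set to 0. *)
pose al' i := if sw i then (gent g' i false true * X i - x i * gent g i false true) / gent g i true true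
  else (gent g' i false false * Y i - x i * gent g i false false) / gent g i true false.
pose be i := if sw i then 0 else (y i * gent g i true true - gent g' i true true * X i) / gent g' i true false.
(* The factor b is the twist of an element at the preceding index, so its unipotent entry must be
   written as a p-th power, with the index shifted. *)
have [be0 Hbe] := choice (fun i => pth_root (be (ordS i))).
have [|a Ga Ea] := @G_build c r c r (fun i s t => match s, t with
  | false, false => x i | false, true => al' i | true, false => 0 | true, true => y i end)
  pl pl.
  by move=> i; rewrite mulr0 subr0 mulf_neq0 ?z0.
have [|b0 Gb Eb] := @G_build c r c r (fun i s t => match s, t with
  | false, false => x i | false, true => 0 | true, false => be0 i | true, true => y i end)
  pl pl.
  by move=> i; rewrite mul0r subr0 mulf_neq0 ?z0.
have Zab : zip_group e mu (a, frob p b0).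
  apply/zip_groupP; split; first by apply/(parabolicP false); split=> // i; apply: Ea.
  exists b0; split=> // [i|[i []]]; first exact: Eb.
    by rewrite /= /ent Ea Eb.
  by rewrite /= /ent Ea Eb.
exists (exist _ (a, frob p b0) Zab) => /=.
have b0c i t : b0 *m c (i, t) = if t then y i *: c (i, true) else x i *: c (i, false) + be0 i *: c (i, true).
  rewrite [LHS](plane_decomp (i := i) cr); last by move=> w wi; apply: (G_ent (b := (i, t))).
  by rewrite !Eb; case: t; rewrite ?scale0r ?add0r.
have bq i t : frob p b0 *m q (i, t) = if t then X i *: q (i, true) + be i *: q (i, false) else Y i *: q (i, false).
  rewrite /q /frob_cols -frobM //= b0c; case: t => /=; last by rewrite frobZ.
  by rewrite frobDm !frobZ Hbe ord_predK.
apply: (frame_ext cr qrq) => -[i s] [j t].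
case: (eqVneq i j) => [<-{j}|ij]; last first.
  have Gab := G_mul Ga Gg; have Ggb := G_mul Gg' (G_frob Gb).
  by rewrite !(G_gent (x := (i, s)) (y := (j, t))).
rewrite -!mulmxA bq G_q // mulmxDr -!scalemxAr dotDr !dotZr !Ea.
have Ex : x i = u i false * z (ord_pred i, false (+) sw i) ^+ p := Hz i false.
have Ey : y i = u i true * z (ord_pred i, true (+) sw i) ^+ p := Hz i true.
have [n1 n2] := (D0 i, D0' i).
case: (boolP (sw i)) => si.
  have g0 : gent g i true false = 0 by apply/eqP.
  have g0' : gent g' i true false = 0 by apply/eqP; rewrite -sw'.
  have df1 := diag g i false n1 si; have df2 := diag g i true n1 si.
  move: Ex Ey; rewrite si /= -/(X i) -/(Y i) /u si => Ex Ey.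
  case: s t => [] []; rewrite /be /al' ?si ?scale0r ?addr0 -?scalemxAr ?mulmxDr -?scalemxAr
     ?dotDr ?dotZr ?dot0r -?/(gent g' i _ _) ?g0 ?g0'.
  - by rewrite Ey; field.
  - by ring.
  - by field.
  - by rewrite Ex; field; rewrite df1 df2.
have h1 : gent g i true false != 0 by [].
have h2 : gent g' i true false != 0 by rewrite -sw'.
move: Ex Ey; rewrite (negPf si) /= -/(X i) -/(Y i) /u (negPf si) => Ex Ey.
case: s t => [] []; rewrite /be /al' ?(negPf si) -?scalemxAr ?mulmxDr -?scalemxAr
   ?dotDr ?dotZr ?dot0r -?/(gent g' i _ _).
- by field.
- by rewrite Ey; field.
- rewrite Ex Ey; move: n1; rewrite /gdet => n1; field.
  by rewrite h1 h2 n1.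
- by field.
Qed.

Lemma inv_eigencol (b : 'M[k]_(d + d)) (v : 'cV[k]_(d + d)) t : b \in unitmx -> t != 0 ->
  b *m v = t *: v -> invmx b *m v = t^-1 *: v.
Proof.
move=> bU t0 bv; rewrite -{1}[v](scalerK t0) -bv -scalemxAr mulKmx //.
Qed.

Lemma inv_eigenrow (b : 'M[k]_(d + d)) (v : 'rV[k]_(d + d)) t : b \in unitmx -> t != 0 ->
  v *m b = t *: v -> v *m invmx b = t^-1 *: v.
Proof.
move=> bU t0 bv; rewrite -{1}[v](scalerK t0) -bv -scalemxAl mulmxK //.
Qed.

Lemma gent_act (h : zipE e mu) g i :
  gent ((sval h).1 *m g *m invmx (sval h).2) i true false =
  chi h (i, true) * (chi h (ord_pred i, true) ^+ p)^-1 * gent g i true false.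
Proof.
have [[aU _] [bU _]] := zipE_G h.
rewrite /gent -!mulmxA (inv_eigencol bU _ (zipE_qcol h i)) ?expf_neq0 ?chi_neq0 //.
rewrite -!scalemxAr dotZr -(dotMA (r _) (sval h).1) zipE_row dotZl.
by rewrite mulrCA mulrA.
Qed.

Lemma zip_orbitP g g' : resGL2 k e g -> zip_orbit e mu g g' <->
  resGL2 k e g' /\ forall i, (gent g i true false == 0) = (gent g' i true false == 0).
Proof.
move=> Gg; split=> [[h _ <-]|[Gg' al]].
  have [Ga Gb] := zipE_G h; split; first by apply: G_mul (G_mul Ga Gg) (G_inv Gb).
  move=> i; rewrite gent_act !mulf_eq0 invr_eq0 expf_eq0 !(negPf (chi_neq0 h _)).
  by rewrite andbF.
have [h E] := zip_transporter Gg Gg' al; have [_ [bU _]] := zipE_G h.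
by exists h => //; rewrite E mulmxK.
Qed.

Lemma emb_modn i x : emb tau (i %% d) x = emb tau i x.
Proof.
rewrite {2}(divn_eq i d); elim: (i %/ d)%N => [|m IH]; first by rewrite mul0n add0n.
by rewrite mulSn -addnA [(d + _)%N]addnC (emb_per p_prime e_basis).
Qed.

Lemma frame_phi_lin (r' : Ix -> 'rV[k]_(d + d)) a (t : k) u v :
  dot (r' a) (t *: u + v) = t * dot (r' a) u + dot (r' a) v.
Proof. by rewrite dotDr dotZr. Qed.

Lemma memv_frame_space (c' : Ix -> 'cV[k]_(d + d)) r' (P : pred Ix) v : dual_frame c' r' ->
  v \in @coord_space _ _ _ c' P <-> forall a, ~~ P a -> dot (r' a) v = 0.
Proof.
move=> cr'.
exact: (memv_coord_space (frame_phi_lin r') (frame_dual cr') (frame_decomp cr')).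
Qed.

Lemma planeP c' r' i (j : 'I_d) v : planar e tau c' r' -> j = (i %% d)%N :> nat ->
  v \in plane e tau i <-> forall a, a.1 != j -> dot (r' a) v = 0.
Proof.
move=> pl' ji; have [cr' cc' _] := pl'.
rewrite /plane (vspace_ofP (U := @coord_space _ _ _ c' (fun a => a.1 == j))).
  exact: memv_frame_space.
move=> w; rewrite (memv_frame_space _ _ cr') /=; split=> [w0 x|wj a aj].
  rewrite -/(emb tau i x) -emb_modn -ji [w](frame_decomp cr') mulmx_sumr scaler_sumr.
  apply: eq_bigr => a _; rewrite -scalemxAr cc' scalerA [RHS]scalerA mulrC.
  by case: (eqVneq a.1 j) => [->//|/w0 ->]; rewrite !mulr0.
apply: (plane_dot0 p_prime e_basis pl' (j := j)) => // x.
by rewrite wj ji emb_modn.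
Qed.

Lemma parQ_col b i : parQ e mu b -> exists t, b *m q (i, false) = t *: q (i, false).
Proof. by move=> [b0 Pb <-]; eexists; apply: frob_qcol. Qed.

(** A unipotent element of P, or of Q, has only one eigenline in a plane; this identifies the stable
    lines as c (j, false) and q (j, false). *)
Lemma alignedP g i (j : 'I_d) : resGL2 k e g -> j = (i %% d)%N :> nat ->
  aligned e mu tau g i <-> gent g j true false = 0.
Proof.
move=> Gg ji; have [gU _] := Gg; rewrite /aligned; split.
  move=> /asboolP[v [/(planeP v plq ji) vj [v0 Qv] [gv0 Pv]]].
  have Ev := plane_decomp qrq vj.
  set be := dot (rq (j, true)) v in Ev; set al' := dot (rq (j, false)) v in Ev.
  have be0 : be = 0.
    have det1 : 1 * 1 - 0 * 1 = 1 :> k by ring.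
    pose b0 := plane_mx c r (ord_pred j) 1 0 1 1.
    have Pb0 : parabolic (resGL2 k e) mu (sg true) b0.
      apply/(parabolicP true); split; first exact: (plane_mx_G pl).
      move=> i'; rewrite /ent (plane_mxE pl) /=; case: eqP => [->|_].
        by rewrite scale0r scale1r add0r (frame_dual cr) xpair_eqE andbF.
      by rewrite (frame_dual cr) xpair_eqE andbF.
    have [t Et] := Qv (frob p b0) (ex_intro2 _ _ b0 Pb0 erefl).
    have Eq s : frob p b0 *m q (j, s) = if s then q (j, false) + q (j, true) else q (j, false).
      rewrite /q /frob_cols -frobM //= (plane_mxE pl) /= eqxx.
      case: s => /=; last by rewrite scale0r scale1r add0r.
      by rewrite !scale1r frobDm addrC.
    move: Et; rewrite Ev mulmxDr -!scalemxAr !Eq => Et.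
    have := congr1 (dot (rq (j, true))) Et; have := congr1 (dot (rq (j, false))) Et.
    rewrite !(dotDr, dotZr, frame_dual qrq) !xpair_eqE !eqxx /= ?mulr1n !mulr0 !mulr1 !add0r !addr0 ?mulr1 ?mulr0 ?add0r => E1 E2.
    apply/eqP/negPn/negP => nz; have t1 : t = 1 by apply: (mulIf nz); rewrite mul1r -E2.
    by move: E1; rewrite t1 mul1r -[RHS]addr0 => /addrI E1; rewrite E1 eqxx in nz.
  have {}Ev : v = al' *: q (j, false) by rewrite Ev be0 scale0r addr0.
  have al0 : al' != 0 by apply: contraNneq v0 => E; rewrite Ev E scale0r.
  have det1 : 1 * 1 - 1 * 0 = 1 :> k by ring.
  pose a := plane_mx c r j 1 1 0 1.
  have Pa : parP e mu a.
    apply/(parabolicP false); split; first exact: (plane_mx_G pl).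
    move=> i'; rewrite /ent (plane_mxE pl) /=; case: eqP => [->|_].
      by rewrite scale0r scale1r addr0 (frame_dual cr) xpair_eqE andbF.
    by rewrite (frame_dual cr) xpair_eqE andbF.
  have [t] := Pv a Pa; rewrite Ev -scalemxAr G_q //.
  set x := gent g j false false; set y := gent g j true false.
  rewrite -!scalemxAr mulmxDr -!scalemxAr !(plane_mxE pl) /= !eqxx => Et.
  have := congr1 (dot (r (j, true))) Et; have := congr1 (dot (r (j, false))) Et.
  rewrite !(dotDr, dotZr, frame_dual cr) !xpair_eqE !eqxx /= ?mulr1n !mulr0 !mulr1 !add0r !addr0 ?mulr1 ?mulr0 ?add0r => E1 E2.
  apply/eqP/negPn/negP => nz; have nz' : al' * y != 0 by rewrite mulf_neq0.
  have t1 : t = 1 by apply: (mulIf nz'); rewrite mul1r -E2.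
  move: E1; rewrite t1 mul1r mulrDr -[RHS]addr0 => /addrI E1.
  by rewrite E1 eqxx in nz'.
move=> g0; apply/asboolP; exists (q (j, false)); split.
- apply/(planeP _ plq ji) => x xj; rewrite (frame_dual qrq).
  by case: eqP => // E; rewrite E eqxx in xj.
- split; first exact: (frame_colI qrq).
  by move=> b Qb; apply: parQ_col.
have Egq : g *m q (j, false) = gent g j false false *: c (j, false).
  by rewrite G_q // g0 scale0r addr0.
split.
  apply/eqP => /(congr1 (mulmx (invmx g))); rewrite mulKmx // mulmx0 => /eqP.
  by rewrite (negPf (frame_colI qrq _)).
move=> a Pa; exists (ent a (j, false) (j, false)).
by rewrite Egq -scalemxAr parP_col // !scalerA mulrC.
Qed.

(** * The Griffiths module of a subrepresentation in coordinates *)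

Section Griffiths.
Variables (W : {vspace 'cV[k]_(d + d)}) (W_sub : subrep e W).
Variable S : seq int.
Definition in_rep (i : 'I_d) : bool := c (i, false) \in W.

(** For a root element u of the SL(2) of V_i, the operator u - 1 extracts one coordinate and puts it
    on the other basis vector. So a subrepresentation is a sum of whole planes. *)
Lemma plane_in_rep v a : v \in W -> dot (r a) v != 0 ->
  c (a.1, false) \in W /\ c (a.1, true) \in W.
Proof.
case: a => i s vW nz /=.
have det1 : 1 * 1 - 1 * 0 = 1 :> k by ring.
have det2 : 1 * 1 - 0 * 1 = 1 :> k by ring.
have up u : u \in W -> dot (r (i, true)) u != 0 -> c (i, false) \in W.
  move=> uW u0; have G1 := plane_mx_G pl i det1.
  have : plane_mx c r i 1 1 0 1 *m u - u \in W by rewrite memvB // W_sub.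
  rewrite /plane_mx mulmxDl mul1mx addrC addKr subrr !scale0r !addr0 add0r scale1r.
  rewrite -mulmxA dotE mul_mx_scalar => H.
  by rewrite -[c _](scalerK u0) memvZ.
have down u : u \in W -> dot (r (i, false)) u != 0 -> c (i, true) \in W.
  move=> uW u0; have G1 := plane_mx_G pl i det2.
  have : plane_mx c r i 1 0 1 1 *m u - u \in W by rewrite memvB // W_sub.
  rewrite /plane_mx mulmxDl mul1mx addrC addKr subrr !scale0r !addr0 !add0r scale1r.
  rewrite -mulmxA dotE mul_mx_scalar => H.
  by rewrite -[c _](scalerK u0) memvZ.
have n1 b : dot (r (i, b)) (c (i, b)) != 0 by rewrite (frame_dual cr) eqxx oner_neq0.
case: s nz => nz; first by have H := up v vW nz; split=> //; apply: (down _ H).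
by have H := down v vW nz; split=> //; apply: (up _ H).
Qed.

Lemma memv_rep v : v \in W <-> forall a, ~~ in_rep a.1 -> dot (r a) v = 0.
Proof.
split=> [vW a na|v0].
  by apply/eqP/negPn/negP => /(plane_in_rep vW)[H _]; rewrite /in_rep H in na.
rewrite [v](frame_decomp cr); apply: memv_suml => -[i s] _.
case: (boolP (in_rep i)) => ri; last by rewrite v0 // scale0r mem0v.
apply: memvZ; case: s => //.
by have [] := plane_in_rep (a := (i, false)) ri _; rewrite ?(frame_dual cr) ?eqxx ?oner_neq0.
Qed.

Definition fil_pred (m : int) (a : Ix) : bool := in_rep a.1 && (n a <= - m).

Lemma weight_dot m u a : weight mu m u -> dot (r a) u != 0 -> n a = m.
Proof.
move=> wu nz; apply: (@expz_inj k) => x x0; apply: (mulIf nz).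
by rewrite -dotZl -mu_r // dotMA wu // dotZr.
Qed.

Lemma memv_fil m v : v \in fil mu W m <-> forall a, ~~ fil_pred m a -> dot (r a) v = 0.
Proof.
rewrite /fil (vspace_ofP (U := @coord_space _ _ _ c (fil_pred m))).
  exact: memv_frame_space.
move=> {}v; rewrite (memv_frame_space _ _ cr); split=> [v0|[N [u [Hu ->]]] a na].
  pose N := (\sum_a `|(n a + m)%R|).+1%N.
  exists N, (fun t => \sum_(a | fil_pred m a && (n a == - (m + t%:Z))) dot (r a) v *: c a).
  split=> [t|].
    split.
      apply/memv_rep => a na; rewrite dot_sumr big1 // => b /andP[/andP[rb _] _].
      rewrite dotZr (frame_dual cr); case: eqP => [E|_]; last by rewrite mulr0.
      by rewrite E rb in na.
    move=> x x0; rewrite mulmx_sumr scaler_sumr; apply: eq_bigr => a /andP[_ /eqP <-].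
    by rewrite -scalemxAr mu_c // !scalerA mulrC.
  rewrite {1}[v](frame_decomp cr) (bigID (fil_pred m)) /= [X in _ + X]big1 ?addr0; last first.
    by move=> a na; rewrite v0 // scale0r.
  rewrite (eq_bigr (fun t : 'I_N => \sum_(a | fil_pred m a)
      (if n a == - (m + t%:Z) then dot (r a) v *: c a else 0))); last first.
    by move=> t _; rewrite big_mkcondr.
  rewrite exchange_big /=; apply: eq_bigr => a /andP[_ le].
  have lt : (`|(n a + m)%R| < N)%N by rewrite ltnS (bigD1 a) //= leq_addr.
  rewrite (bigD1 (Ordinal lt)) //= [X in if X then _ else _](_ : _ = true); last by apply/eqP; lia.
  rewrite big1 ?addr0 // => t tn; case: eqP => // E; case/negP: tn.
  by rewrite -val_eqE /=; apply/eqP; lia.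
rewrite dot_sumr big1 // => t _; have [uW wu] := Hu t.
apply/eqP/negPn/negP => nz; case/negP: na; rewrite /fil_pred.
have := weight_dot wu nz => ->; apply/andP; split; last by lia.
by apply: contraNT nz => /((memv_rep _).1 uW) ->.
Qed.

(** A retained step meets V_j in a line exactly when it contains the vector of smaller weight but
    not the other one. *)
Lemma grif_multE i (j : 'I_d) : j = (i %% d)%N :> nat ->
  grif_mult e mu tau W S i = count (fun m => fil_pred m (j, false) && ~~ fil_pred m (j, true)) S.
Proof.
move=> ji; rewrite /grif_mult; apply: eq_count => m.
pose P := [pred a | fil_pred m a && (a.1 == j)].
have -> : (fil mu W m :&: plane e tau i)%VS = @coord_space _ _ _ c P.
  apply/vspaceP => v; rewrite memv_cap; apply/idP/idP.
    move=> /andP[/memv_fil vf /(planeP v pl ji) vp].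
    apply/(memv_frame_space _ _ cr) => a; rewrite negb_and => /orP[/vf//|/vp//].
  move=> /(memv_frame_space _ _ cr) vP; apply/andP; split.
    by apply/memv_fil => a na; apply: vP; rewrite negb_and na.
  by apply/(planeP v pl ji) => a na; apply: vP; rewrite negb_and na orbT.
rewrite (dim_coord_space (phi := fun a => dot (r a))); first last.
- exact: frame_dual.
- exact: frame_phi_lin.
have -> : #|P| = (fil_pred m (j, false) + fil_pred m (j, true))%N.
  have -> : #|P| = (\sum_i \sum_s P (i, s))%N.
    rewrite pair_bigA -sum1_card big_mkcond; apply: eq_bigr => -[i' s'] _ /=.
    by rewrite unfold_in /=; case: (_ && _).
  rewrite (bigD1 j) //= [X in (_ + X)%N]big1 ?addn0; last first.
    by move=> i' ij; rewrite big1 // => s _; rewrite (negPf ij) andbF.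
  by rewrite big_bool /= eqxx !andbT addnC.
have : fil_pred m (j, true) -> fil_pred m (j, false).
  by move=> /andP[rj le]; apply/andP; split=> //; have := n_lt j; lia.
by case: (fil_pred m (j, true)); case: (fil_pred m (j, false)) => // /(_ isT).
Qed.

Definition grif_index := ('I_(size S) * Ix)%type.
Definition grif_pred (x : grif_index) : bool := fil_pred (S`_x.1) x.2.
Definition grif_coord (x : grif_index) (w : 'M[k]_(d + d, size S)) : k := dot (r x.2) (col x.1 w).
Definition grif_vec (x : grif_index) : 'M[k]_(d + d, size S) := c x.2 *m delta_mx 0 x.1.

Lemma col_lin j t (w w' : 'M[k]_(d + d, size S)) : col j (t *: w + w') = t *: col j w + col j w'.
Proof. by apply/matrixP => a b; rewrite !mxE. Qed.

Lemma grif_coord_lin x t w w' :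
  grif_coord x (t *: w + w') = t * grif_coord x w + grif_coord x w'.
Proof. by rewrite /grif_coord col_lin dotDr dotZr. Qed.

Lemma grif_coord_vec x y : grif_coord x (grif_vec y) = (x == y)%:R.
Proof.
case: x y => j a [l b]; rewrite /grif_coord /grif_vec /=.
have -> : col j (c b *m delta_mx 0 l) = (j == l)%:R *: c b.
  apply/colP => i; rewrite !mxE big_ord1 !mxE eqxx /= mulrC.
  by rewrite (eq_sym j).
by rewrite dotZr (frame_dual cr) xpair_eqE; case: eqP; case: eqP; rewrite ?mulr1 ?mul0r ?mulr0.
Qed.

Lemma grif_decomp w : w = \sum_x grif_coord x w *: grif_vec x.
Proof.
rewrite -(pair_bigA _ (fun j a => grif_coord (j, a) w *: grif_vec (j, a))) /=.
transitivity (\sum_j col j w *m delta_mx 0 j : 'M[k]_(d + d, size S)).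
  apply/matrixP => i l; rewrite summxE (bigD1 l) //= big1 ?addr0.
    by rewrite !mxE big_ord1 !mxE !eqxx mulr1.
  by move=> l' ll; rewrite !mxE big_ord1 !mxE eqxx [l == l']eq_sym (negPf ll) mulr0.
apply: eq_bigr => j _; rewrite {1}[col j w](frame_decomp cr) mulmx_suml.
by apply: eq_bigr => a _; rewrite scalemxAl.
Qed.

Lemma memv_grif w : w \in grif mu W S <-> forall x, ~~ grif_pred x -> grif_coord x w = 0.
Proof.
have M v := memv_coord_space grif_coord_lin grif_coord_vec grif_decomp grif_pred v.
rewrite /grif (vspace_ofP (U := @coord_space _ _ _ grif_vec grif_pred)) // => v.
rewrite M; split=> [v0 j|H [j a] na]; last by have /memv_fil := H j; apply.
by apply/memv_fil => a na; apply: (v0 (j, a)).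
Qed.

Lemma dim_grif : \dim (grif mu W S) = #|grif_pred|.
Proof.
rewrite -(dim_coord_space grif_coord_lin grif_coord_vec grif_pred).
congr (\dim _); apply/vspaceP => w; apply/idP/idP.
  by move/memv_grif => H; apply/(memv_coord_space grif_coord_lin grif_coord_vec grif_decomp).
by move=> /(memv_coord_space grif_coord_lin grif_coord_vec grif_decomp) H; apply/memv_grif.
Qed.

Lemma grif_coord_act h x w :
  grif_coord x (@grif_act k p d F e mu _ h w) = chi h x.2 * grif_coord x w.
Proof.
rewrite /grif_coord /grif_act.
have -> : col x.1 (levi mu (sval h).1 *m w) = levi mu (sval h).1 *m col x.1 w.
  by apply/colP => i; rewrite !mxE; apply: eq_bigr => j _; rewrite !mxE.
by rewrite -dotMA zipE_levi dotZl.
Qed.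

End Griffiths.

Lemma dot_mulmx_lin (u : 'rV[k]_(d + d)) (v : 'cV[k]_(d + d)) (t : k) (g h : 'M[k]_(d + d)) :
  dot u ((t *: g + h) *m v) = t * dot u (g *m v) + dot u (h *m v).
Proof. by rewrite mulmxDl -scalemxAl dotDr dotZr. Qed.

(* Coordinates vanishing on the commutant of the scalars and, for i in I, at the
   entry of g_i that measures the relative position of P and g Q g^-1. *)
Definition strat_coord (I : {set 'I_d}) (xy : Ix * Ix) (g : 'M[k]_(d + d)) : k :=
  if (xy.1.1 != xy.2.1) || [&& xy.1.2, ~~ xy.2.2 & xy.1.1 \in I]
  then dot (r xy.1) (g *m q xy.2) else 0.

Lemma strat_coord_lin I xy t g h :
  strat_coord I xy (t *: g + h) = t * strat_coord I xy g + strat_coord I xy h.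
Proof. by rewrite /strat_coord; case: ifP => _; rewrite ?dot_mulmx_lin // mulr0 addr0. Qed.

Lemma strat_coordP I g : (forall xy, strat_coord I xy g = 0) <->
  (forall x, g *m sc x = sc x *m g) /\ (forall i, i \in I -> gent g i true false = 0).
Proof.
split=> [g0|[/(planar_commute p_prime e_basis g pl plq) gc gI] [[i s] [j t]]].
  split=> [|i iI].
    apply/(planar_commute p_prime e_basis g pl plq) => x y xy.
    by have := g0 (x, y); rewrite /strat_coord xy.
  by have := g0 ((i, true), (i, false)); rewrite /strat_coord /= iI orbT.
rewrite /strat_coord /=; case: ifP => // /orP[ij|/and3P[s1 t1 iI]]; first exact: gc.
have [ij|ij] := eqVneq i j; last exact: gc.
by rewrite -ij; move: s1 t1 (gI i iI); case: s; case: t.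
Qed.

Definition aligned_set (g : 'M[k]_(d + d)) : {set 'I_d} :=
  finset.finset (fun i => gent g i true false == 0).

Lemma aligned_setP g i : reflect (gent g i true false = 0) (i \in aligned_set g).
Proof. by rewrite finset.inE; apply: eqP. Qed.

Lemma peval_polyfun_gent i s t :
  polyfun (fun g : 'M[k]_(d + d) => gent g i s t).
Proof. by apply: polyfun_linear => a u v; apply: dot_mulmx_lin. Qed.

(** The block matrices vanishing at the (2,1) entries in I form a linear space L, in which the orbit
    is a nonempty open subset, hence dense. *)
Lemma zclosure_orbit g : resGL2 k e g ->
  zclosure_in (resGL2 k e) (zip_orbit e mu g) =
  [set g' | resGL2 k e g' /\ forall i, i \in aligned_set g -> gent g' i true false = 0].
Proof.
move=> Gg; rewrite predeqE => g'; split=> [[Gg' cl]|[Gg' g0]]; split=> //.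
  move=> i /aligned_setP gi; have [f Ef] := peval_polyfun_gent i true false.
  rewrite -Ef; apply: cl => h /(zip_orbitP _ Gg)[_ al].
  by rewrite Ef; apply/eqP; rewrite -al gi.
move=> f f0; pose I := aligned_set g.
pose L := zero_space (strat_coord I).
have LP h : h \in L <-> (forall x, h *m sc x = sc x *m h) /\ (forall i, i \in I -> gent h i true false = 0).
  by rewrite -strat_coordP; apply: (memv_zero_space (strat_coord_lin I)).
(* Nonvanishing of D on L singles out the orbit: g must be invertible with nonzero (2,1) entries
   outside I. *)
have [D ED] : polyfun (fun h : 'M[k]_(d + d) =>
    \det h * \prod_(i | i \notin I) gent h i true false).
  apply: polyfunM.
    by apply: polyfun_det => a b; apply: polyfun_linear => t u v; rewrite !mxE.
  by apply: polyfun_prod => i; apply: peval_polyfun_gent.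
have fD h : h \in L -> peval f h * peval D h = 0.
  move=> /LP[hc hI]; have [->|] := eqVneq (peval D h) 0; first by rewrite mulr0.
  rewrite ED mulf_eq0 negb_or => /andP[hd /prodf_neq0 hp].
  rewrite f0 ?mul0r //; apply/(zip_orbitP _ Gg); split.
    by split=> //; rewrite unitmxE unitfE.
  move=> i; case: (boolP (i \in I)) => iI.
    by rewrite hI //; move/aligned_setP: iI => ->.
  by rewrite (negPf (hp i iI)); apply/negbTE; apply: contra iI => /eqP/aligned_setP.
have [H|H] := peval_lin_irred fD.
  by apply: H; apply/LP; case: Gg' => _ gc; split.
have gL : g \in L by apply/LP; split=> [|i /aligned_setP//]; case: Gg.
suff : peval D g != 0 by rewrite H ?eqxx.
rewrite ED mulf_neq0 //; first by have [gU _] := Gg; rewrite -unitfE -unitmxE.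
by apply/prodf_neq0 => i; apply: contra => /eqP/aligned_setP.
Qed.

Lemma stratum_rep (I : {set 'I_d}) : exists2 g, resGL2 k e g & aligned_set g = I.
Proof.
(* The identity block at i in I, the antidiagonal block elsewhere. *)
pose A (i : 'I_d) (s t : bool) : k := (s (+) t (+) (i \in I))%:R.
have [i|g Gg gE] := @G_build c r q rq A pl plq.
  rewrite /A; case: (i \in I) => /=; rewrite ?mulr1 ?mulr0 ?mul0r ?subr0 ?sub0r ?oppr_eq0 ?oner_neq0 //.
exists g => //; apply/setP => i; rewrite finset.inE /gent gE /A /=.
by case: (i \in I); rewrite ?eqxx ?oner_eq0.
Qed.

(** * The projective bundle of the Griffiths module *)
Section ZipBundle.
Variables (W : {vspace 'cV[k]_(d + d)}) (W_sub : subrep e W) (S : seq int) (N : nat).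
Local Notation V' := (zip_ambient k d N * 'M[k]_(d + d, size S))%type.
Implicit Types (x : V') (I : {set 'I_d}).

Definition gm x : 'M[k]_(d + d) := x.1.1.
Definition pm x : 'M[k]_(d + d, d + d + N) := x.1.2.1.
Definition qm x : 'M[k]_(d + d, d + d + N) := x.1.2.2.
Definition wm x : 'M[k]_(d + d, size S) := x.2.

Lemma gm_lin t x x' : gm (t *: x + x') = t *: gm x + gm x'. Proof. by []. Qed.
Lemma pm_lin t x x' : pm (t *: x + x') = t *: pm x + pm x'. Proof. by []. Qed.
Lemma qm_lin t x x' : qm (t *: x + x') = t *: qm x + qm x'. Proof. by []. Qed.
Lemma wm_lin t x x' : wm (t *: x + x') = t *: wm x + wm x'. Proof. by []. Qed.

(** E acts on the module through the torus L, so each coordinate is an eigenvector and the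
    enumeration order yields a stable flag. *)
Definition zs : seq (grif_index S) := enum (grif_pred W (S := S)).
Definition ys : seq Ix := [seq z.2 | z <- zs].

Definition flag_coord I (j : nat) (a : (Ix * Ix) + grif_index S) x : k :=
  match a with
  | inl xy => strat_coord I xy (gm x)
  | inr z => if ~~ grif_pred W z || (index z zs < j)%N then grif_coord z (wm x) else 0
  end.

Lemma flag_coord_lin I j a t x x' :
  flag_coord I j a (t *: x + x') = t * flag_coord I j a x + flag_coord I j a x'.
Proof.
case: a => [xy|z] /=; first by rewrite gm_lin strat_coord_lin.
by case: ifP => _; rewrite ?wm_lin ?grif_coord_lin ?mulr0 ?addr0.
Qed.

Definition flag_space I j : {vspace V'} := zero_space (flag_coord I j).

Lemma memv_flag_space I j x : x \in flag_space I j <->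
  [/\ forall t, gm x *m sc t = sc t *m gm x,
      forall i, i \in I -> gent (gm x) i true false = 0 &
      forall z, ~~ grif_pred W z || (index z zs < j)%N -> grif_coord z (wm x) = 0].
Proof.
rewrite (memv_zero_space (flag_coord_lin I j)); split=> [x0|[x1 x2 x3] [xy|z] /=].
- have [x1 x2] := (strat_coordP I (gm x)).1 (fun xy => x0 (inl xy)).
  by split=> // z nz; have := x0 (inr z); rewrite /= nz.
- exact: (strat_coordP I (gm x)).2.
- by case: ifP => // /x3.
Qed.

Definition zip_open : set V' := [set x |
  [/\ gm x \in unitmx, \rank (pm x) = (d + d)%N, \rank (qm x) = (d + d)%N & wm x != 0]].

Lemma grif_coord_neq0 (w : 'M[k]_(d + d, size S)) : w != 0 -> exists z, grif_coord z w != 0.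
Proof.
move=> w0; apply/existsP; apply: contraNT w0 => /existsPn H.
rewrite [w]grif_decomp big1 // => z _; have := H z; rewrite negbK => /eqP ->.
by rewrite scale0r.
Qed.

(** Full rank is witnessed by a one-sided inverse: some product with a constant matrix has nonzero
    determinant, so the set is a union of principal open sets. *)
Lemma zip_open_open : exists F0 : set (coord_ring V'),
  forall x, zip_open x <-> exists2 f, F0 f & peval f x != 0.
Proof.
pose Q (N1 N2 : 'M[k]_(d + d + N, d + d)) z x :=
  \det (gm x) * \det (pm x *m N1) * \det (qm x *m N2) * grif_coord z (wm x).
exists [set f | exists N1 N2 z, forall x, peval f x = Q N1 N2 z x].
move=> x; split=> [[xU px qx wx]|[f [N1 [N2 [z Ef]]]]].
  have /row_freeP[N1 E1] : row_free (pm x) by rewrite /row_free px.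
  have /row_freeP[N2 E2] : row_free (qm x) by rewrite /row_free qx.
  have [z zw] := grif_coord_neq0 wx.
  have [f Ef] : polyfun (Q N1 N2 z).
    do 3 ?apply: polyfunM.
    - apply: polyfun_det => a b; apply: polyfun_linear => t u v.
      by rewrite gm_lin !mxE.
    - apply: polyfun_det => a b; apply: polyfun_linear => t u v.
      by rewrite pm_lin mulmxDl -scalemxAl !mxE.
    - apply: polyfun_det => a b; apply: polyfun_linear => t u v.
      by rewrite qm_lin mulmxDl -scalemxAl !mxE.
    - by apply: polyfun_linear => t u v; rewrite wm_lin grif_coord_lin.
  exists f; first by exists N1, N2, z.
  by rewrite Ef /Q E1 E2 !det1 !mulr1 mulf_neq0 // -unitfE -unitmxE.
rewrite Ef /Q !mulf_eq0 !negb_or => /andP[/andP[/andP[g0 p0] q0] w0].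
have rk (M : 'M[k]_(d + d, d + d + N)) M1 : \det (M *m M1) != 0 -> \rank M = (d + d)%N.
  rewrite -unitfE -unitmxE => MU; apply/eqP; rewrite eqn_leq rank_leq_row /=.
  by rewrite -{1}(mxrank_unit MU) mxrankM_maxl.
split; [by rewrite unitmxE unitfE | exact: rk p0 | exact: rk q0 |].
by apply: contraNneq w0 => ->; rewrite /grif_coord col0 dot0r.
Qed.

Definition flag I j : set V' := lin_sect zip_open (flag_space I j).
Let X : set V' := @proj_total k (zip_ambient k d N) (zip_space (N := N) (resGL2 k e)) _ (grif mu W S).
Let act := @proj_act k (zip_ambient k d N) _ (@zip_act k p d F e mu N) _ (@grif_act k p d F e mu (size S)).

Lemma flag_total : X = flag finset.set0 0.
Proof.
rewrite predeqE => x; split.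
  move=> [[[gU gc] px qx] /(memv_grif W_sub) wW w0]; split; last by split.
  by apply/memv_flag_space; split=> // [i|z]; rewrite ?finset.inE // ltn0 orbF; apply: wW.
move=> [/memv_flag_space[gc _ wW] [gU px qx w0]]; split=> //.
by apply/(memv_grif W_sub) => z nz; apply: wW; rewrite nz.
Qed.

Lemma flag_space_sub I j : (flag_space I j <= flag_space finset.set0 0)%VS.
Proof.
apply/subvP => x /memv_flag_space[x1 x2 x3]; apply/memv_flag_space; split=> //.
  by move=> i; rewrite finset.inE.
by move=> z; rewrite ltn0 orbF => nz; apply: x3; rewrite nz.
Qed.

Lemma flag_end I x : ~ flag I (size zs) x.
Proof.
move=> [/memv_flag_space[_ _ x0] [_ _ _ w0]]; have [z] := grif_coord_neq0 w0.
rewrite x0 ?eqxx // index_mem mem_enum.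
by case: (boolP (grif_pred W z)) => // gz; apply/orP; right.
Qed.

Lemma gm_act h x : gm (act h x) = (sval h.1).1 *m gm x *m invmx (sval h.1).2.
Proof. by rewrite /act /proj_act /zip_act /gm /=; case: (sval h.1). Qed.
Lemma pm_act h x : pm (act h x) = (sval h.1).1 *m pm x.
Proof. by rewrite /act /proj_act /zip_act /pm /=; case: (sval h.1). Qed.
Lemma qm_act h x : qm (act h x) = (sval h.1).2 *m qm x.
Proof. by rewrite /act /proj_act /zip_act /qm /=; case: (sval h.1). Qed.
Lemma wm_act h x z : grif_coord z (wm (act h x)) = sval h.2 * chi h.1 z.2 * grif_coord z (wm x).
Proof.
rewrite /act /proj_act /wm /= -[sval _ *: _]addr0 grif_coord_lin grif_coord_act mulrA.
by rewrite /grif_coord col0 dot0r addr0.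
Qed.

Lemma rank_unit_mul m (a : 'M[k]_(d + d)) (M : 'M[k]_(d + d, m)) : a \in unitmx ->
  \rank (a *m M) = \rank M.
Proof.
move=> aU; apply/eqP; rewrite eqn_leq mxrankM_maxr /=.
by rewrite -{1}[M](mulKmx aU) mxrankM_maxr.
Qed.

Lemma flag_act h I j x : flag I j x -> flag I j (act h x).
Proof.
move=> [/memv_flag_space[x1 x2 x3] [gU px qx w0]].
have [Ga Gb] := zipE_G h.1; have [aU _] := Ga; have [bU _] := Gb.
have [Gg' gc'] := G_mul (G_mul Ga (conj gU x1 : resGL2 k e (gm x))) (G_inv Gb).
split.
  apply/memv_flag_space; split=> [t|i iI|z nz]; first by rewrite gm_act.
    by rewrite gm_act gent_act x2 // mulr0.
  by rewrite wm_act x3 // mulr0.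
split; [by rewrite gm_act | by rewrite pm_act rank_unit_mul | by rewrite qm_act rank_unit_mul |].
have [z zw] := grif_coord_neq0 w0.
have : grif_coord z (wm (act h x)) != 0.
  by rewrite wm_act !mulf_neq0 ?chi_neq0 // (svalP h.2).
by apply: contraNneq => ->; rewrite /grif_coord col0 dot0r.
Qed.

(** The unknowns [al] and [be] are unipotent entries of a and of the inverse of b. They cancel in
    the determinant, and drop out of the diagonal entries where the (2,1) entry vanishes. *)
Lemma gent_act_all (h : zipE e mu) g i : resGL2 k e g -> exists al be : k,
  let g' := (sval h).1 *m g *m invmx (sval h).2 in
  let xi := (chi h (ord_pred i, false) ^+ p)^-1 in
  let yi := (chi h (ord_pred i, true) ^+ p)^-1 in
  [/\ gent g' i false false = yi * (chi h (i, false) * gent g i false false + al * gent g i true false),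
      gent g' i true false = yi * chi h (i, true) * gent g i true false,
      gent g' i false true = chi h (i, false) * (be * gent g i false false + xi * gent g i false true)
        + al * (be * gent g i true false + xi * gent g i true true) &
      gent g' i true true = chi h (i, true) * (be * gent g i true false + xi * gent g i true true)].
Proof.
move=> Gg; have [Ga Gb] := zipE_G h; have [bU _] := Gb.
set a := (sval h).1; set b := (sval h).2.
have bf : invmx b *m q (i, false) = (chi h (ord_pred i, true) ^+ p)^-1 *: q (i, false).
  by apply: inv_eigencol (zipE_qcol h i) => //; rewrite expf_neq0 ?chi_neq0.
have Gb' := G_inv Gb; set be := dot (rq (i, false)) (invmx b *m q (i, true)).
have bt : invmx b *m q (i, true) = be *: q (i, false) + (chi h (ord_pred i, false) ^+ p)^-1 *: q (i, true).
  rewrite [LHS](plane_decomp (i := i) qrq); last first.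
    move=> y yi; have [_ bc] := Gb'.
    by apply: (planar_commute p_prime e_basis (invmx b) plq plq).1.
  congr (_ + _ *: _); rewrite -dotMA.
  rewrite (inv_eigenrow bU _ (zipE_qrow h i)) ?expf_neq0 ?chi_neq0 //.
  by rewrite dotZl (frame_dual qrq) eqxx mulr1.
set al := dot (r (i, false)) (a *m c (i, true)).
have at_ : a *m c (i, true) = al *: c (i, false) + chi h (i, true) *: c (i, true).
  by rewrite [LHS](plane_decomp (i := i) cr) // => y yi; apply: (G_ent (b := (i, true))).
have af_ : a *m c (i, false) = chi h (i, false) *: c (i, false) := zipE_col h i.
exists al, be; rewrite /gent -!mulmxA bf bt !mulmxDr -!scalemxAr !G_q // !mulmxDr -!scalemxAr.
rewrite ?mulmxDr -?scalemxAr ?mulmxDr -?scalemxAr at_ af_ !(dotDr, dotZr, frame_dual cr) !xpair_eqE !eqxx /=.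
by rewrite /gent; split; ring.
Qed.

Lemma gdet_act (h : zipE e mu) g i : resGL2 k e g ->
  gdet ((sval h).1 *m g *m invmx (sval h).2) i =
  chi h (i, false) * chi h (i, true) *
  ((chi h (ord_pred i, false) ^+ p)^-1 * (chi h (ord_pred i, true) ^+ p)^-1) * gdet g i.
Proof.
move=> Gg; have [al [be [E1 E2 E3 E4]]] := gent_act_all h i Gg.
by rewrite /gdet E1 E2 E3 E4; ring.
Qed.

Lemma mx_col0 : (0 < d + d + N)%N.
Proof. by rewrite !addn_gt0 d_gt0. Qed.
Definition col0i : 'I_(d + d + N) := Ordinal mx_col0.

(* None: a coordinate of the bundle; (i, inl (s, t)): the entries of the component
   g_i, with the determinant at (false, true); (i, inr b): sections supported away
   from the strata, used to trivialise the line bundles generically. *)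
Definition atom := option ('I_d * (bool * bool + bool)).
Definition a21 i : atom := Some (i, inl (true, false)).
Definition adet i : atom := Some (i, inl (false, true)).
Definition adiag i s : atom := Some (i, inl (s, s)).
Definition aP i : atom := Some (i, inr true).
Definition aQ i : atom := Some (i, inr false).

Section FixedStratum.
Variables (I : {set 'I_d}) (j : nat).
Hypothesis jz : (j < size zs)%N.
Variable z : grif_index S.
Hypothesis zE : forall z0, z = nth z0 zs j.
Let y : Ix := z.2.

Lemma z_pred : grif_pred W z.
Proof.
have : z \in zs by rewrite (zE z) mem_nth.
by rewrite mem_enum.
Qed.
Lemma z_index : index z zs = j.
Proof. by rewrite (zE z) index_uniq // enum_uniq. Qed.

(** For i in I the (2,1) entry is zero and the diagonal entries are units; outside I the (2,1) entry
    is a linear form. A slot without such a role is the constant 1, so that on [flag I j] each atom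
    is a nonzero linear form or a unit. *)
Definition atom_fun (a : atom) (x : V') : k :=
  match a with
  | None => grif_coord z (wm x)
  | Some (i, inr true) => dot (r (i, true)) (col col0i (pm x))
  | Some (i, inr false) => dot (rq (i, true)) (col col0i (qm x))
  | Some (i, inl (true, false)) => if i \in I then 1 else gent (gm x) i true false
  | Some (i, inl (false, true)) => gdet (gm x) i
  | Some (i, inl (s, _)) => if i \in I then gent (gm x) i s s else 1
  end.

Definition atom_lin (a : atom) : bool :=
  match a with
  | None | Some (_, inr _) => true
  | Some (i, inl (true, false)) => i \notin I
  | _ => false
  end.

Definition atom_char (a : atom) (h : proj_group k (zipE e mu)) : k :=
  match a with
  | None => sval h.2 * chi h.1 y
  | Some (i, inr true) => chi h.1 (i, true)
  | Some (i, inr false) => chi h.1 (ord_pred i, false) ^+ p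
  | Some (i, inl (true, false)) =>
      if i \in I then 1 else chi h.1 (i, true) * (chi h.1 (ord_pred i, true) ^+ p)^-1
  | Some (i, inl (false, true)) => chi h.1 (i, false) * chi h.1 (i, true) *
      ((chi h.1 (ord_pred i, false) ^+ p)^-1 * (chi h.1 (ord_pred i, true) ^+ p)^-1)
  | Some (i, inl (s, _)) =>
      if i \in I then chi h.1 (i, s) * (chi h.1 (ord_pred i, ~~ s) ^+ p)^-1 else 1
  end.

Lemma atom_char_neq0 a h : atom_char a h != 0.
Proof.
have C := chi_neq0 h.1; have Hl := svalP h.2.
case: a => [[i [[[] []]|[]]]|] /=; try case: ifP => _;
  by rewrite ?oner_neq0 ?mulf_neq0 ?invr_eq0 ?expf_neq0 ?mulf_neq0 ?invr_eq0 ?expf_neq0.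
Qed.

Lemma flag_G x : flag I j x -> resGL2 k e (gm x).
Proof. by move=> [/memv_flag_space[gc _ _] [gU _ _ _]]. Qed.

Lemma gent_diag_act h x i s : flag I j x -> i \in I ->
  gent (gm (act h x)) i s s =
  chi h.1 (i, s) * (chi h.1 (ord_pred i, ~~ s) ^+ p)^-1 * gent (gm x) i s s.
Proof.
move=> Yx iI; have Gx := flag_G Yx; have [/memv_flag_space[_ g0 _] _] := Yx.
have [al [be [E1 E2 E3 E4]]] := gent_act_all h.1 i Gx.
by rewrite gm_act; case: s; rewrite ?E1 ?E4 g0 //=; ring.
Qed.

Lemma atom_fun_act a h x : flag I j x -> atom_fun a (act h x) = atom_char a h * atom_fun a x.
Proof.
move=> Yx; have Gx := flag_G Yx.
case: a => [[i [[[] []]|[]]]|] /=.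
- by case: ifP => iI; rewrite ?mul1r // (gent_diag_act h true Yx iI).
- by case: ifP => iI; rewrite ?mul1r // gm_act gent_act.
- by rewrite gm_act gdet_act.
- by case: ifP => iI; rewrite ?mul1r // (gent_diag_act h false Yx iI).
- rewrite pm_act (_ : col _ _ = (sval h.1).1 *m col col0i (pm x)).
    by rewrite -dotMA zipE_row dotZl.
  by apply/colP => l; rewrite !mxE; apply: eq_bigr => m _; rewrite !mxE.
- rewrite qm_act (_ : col _ _ = (sval h.1).2 *m col col0i (qm x)).
    by rewrite -dotMA zipE_qrow dotZl.
  by apply/colP => l; rewrite !mxE; apply: eq_bigr => m _; rewrite !mxE.
- by rewrite wm_act.
Qed.

Lemma atom_fun_lin a : atom_lin a ->
  forall t x x', atom_fun a (t *: x + x') = t * atom_fun a x + atom_fun a x'.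
Proof.
have colD m (A B : 'M[k]_(d + d, m)) t l : col l (t *: A + B) = t *: col l A + col l B.
  by apply/colP => i; rewrite !mxE.
case: a => [[i [[[] []]|[]]]|] //= iI t x x'.
- by rewrite (negPf iI) gm_lin /gent dot_mulmx_lin.
- by rewrite pm_lin colD dotDr dotZr.
- by rewrite qm_lin colD dotDr dotZr.
- exact: grif_coord_lin.
Qed.

Lemma atom_polyfun a : polyfun (atom_fun a).
Proof.
have gl i s t : polyfun (fun x => gent (gm x) i s t).
  by apply: polyfun_linear => l u v; rewrite gm_lin /gent dot_mulmx_lin.
have [la|] := boolP (atom_lin a).
  by apply: polyfun_linear => t u v; apply: atom_fun_lin.
case: a => [[i [[[] []]|[]]]|] //=; rewrite /atom_fun.
- by case: (i \in I) => _; [apply: gl | apply: polyfun_const].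
- by case: (i \in I) => // _; apply: polyfun_const.
- move=> _; rewrite /gdet; apply: polyfunD; first exact: polyfunM.
  have [f Ef] := polyfunM (gl i false true) (gl i true false).
  by exists (- f) => v; rewrite pevalN Ef.
- by case: (i \in I) => _; [apply: gl | apply: polyfun_const].
Qed.

Lemma stratum_point : exists g, [/\ resGL2 k e g, forall i, i \in I -> gent g i true false = 0 &
  forall i, i \notin I -> gent g i true false != 0].
Proof.
have [g Gg EI] := stratum_rep I; exists g; split=> // i; rewrite -EI; first by move/aligned_setP.
by apply: contra => /eqP/aligned_setP.
Qed.

Lemma flag_space_point g (P Q : 'M[k]_(d + d, d + d + N)) : resGL2 k e g ->
  (forall i, i \in I -> gent g i true false = 0) -> (g, (P, Q), grif_vec z) \in flag_space I j.
Proof.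
move=> [_ gc] g0; apply/memv_flag_space; split=> // z' nz'; rewrite /wm /= grif_coord_vec.
case: eqP nz' => // ->; rewrite z_pred /= z_index ltnn //.
Qed.

Lemma flag_nonempty : flag I j !=set0.
Proof.
have [g [Gg g0 _]] := stratum_point; pose P : 'M[k]_(d + d, d + d + N) := row_mx 1%:M 0.
have rP : \rank P = (d + d)%N.
  have E : P *m col_mx 1%:M 0 = 1%:M by rewrite mul_row_col mulmx1 mul0mx addr0.
  have := mxrankM_maxl P (col_mx 1%:M 0); rewrite E mxrank1 => H.
  by apply/eqP; rewrite eqn_leq rank_leq_row H.
exists (g, (P, P), grif_vec z); split; first exact: flag_space_point.
split=> //; first by case: Gg.
apply/eqP => w0; have := grif_coord_vec z z; rewrite /wm /= in w0 *.
by rewrite w0 /grif_coord col0 dot0r eqxx => /esym/eqP; rewrite oner_eq0.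
Qed.

Lemma atom_lin_n0 a : atom_lin a -> exists2 x, x \in flag_space I j & atom_fun a x != 0.
Proof.
have [g [Gg g0 g1]] := stratum_point.
have cd (v : 'cV[k]_(d + d)) : col col0i (v *m (delta_mx 0 col0i : 'rV[k]_(d + d + N))) = v.
  by apply/colP => l; rewrite !mxE big_ord1 !mxE !eqxx mulr1.
case: a => [[i [[[] []]|[]]]|] //= la.
- exists (g, (0, 0), grif_vec z); first exact: flag_space_point.
  by rewrite (negPf la) g1.
- exists (g, (c (i, true) *m delta_mx 0 col0i, 0), grif_vec z); first exact: flag_space_point.
  by rewrite /pm /= cd (frame_dual cr) eqxx oner_neq0.
- exists (g, (0, q (i, true) *m delta_mx 0 col0i), grif_vec z); first exact: flag_space_point.
  by rewrite /qm /= cd (frame_dual qrq) eqxx oner_neq0.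
- exists (g, (0, 0), grif_vec z); first exact: flag_space_point.
  by rewrite /wm /= grif_coord_vec eqxx oner_neq0.
Qed.

Lemma atom_unit a : ~~ atom_lin a -> forall x, flag I j x -> atom_fun a x != 0.
Proof.
move=> na x Yx; have Gx := flag_G Yx; have [/memv_flag_space[_ g0 _] _] := Yx.
have D i := gdet_neq0 i Gx.
have Dd i s : i \in I -> gent (gm x) i s s != 0.
  move=> iI; have := D i; rewrite /gdet g0 // mulr0 subr0 mulf_eq0 negb_or => /andP[].
  by case: s.
case: a na => [[i [[[] []]|[]]]|] //=; try by case: ifP => iI _; rewrite ?oner_neq0 ?Dd.
by rewrite negbK => ->; rewrite oner_neq0.
Qed.

Local Notation expo := {ffun atom -> int}.
Definition adelta (a : atom) : expo := [ffun b => (b == a)%:Z].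

Definition ev (z0 : expo) (h : proj_group k (zipE e mu)) : k :=
  \prod_(a : atom) atom_char a h ^ z0 a.

Lemma evD z1 z2 h : ev (z1 + z2) h = ev z1 h * ev z2 h.
Proof.
rewrite /ev -big_split; apply: eq_bigr => a _.
by rewrite ffunE expfzDr // atom_char_neq0.
Qed.
Lemma ev0 h : ev 0 h = 1.
Proof. by rewrite /ev big1 // => a _; rewrite ffunE expr0z. Qed.
Lemma evN z1 h : ev (- z1) h = (ev z1 h)^-1.
Proof.
have E : ev z1 h * ev (- z1) h = 1 by rewrite -evD subrr ev0.
have n0 : ev z1 h != 0 by apply: contra_eq_neq E => ->; rewrite mul0r eq_sym oner_neq0.
by apply: (mulfI n0); rewrite E mulfV.
Qed.
Lemma evMn z1 m h : ev (z1 *+ m) h = ev z1 h ^+ m.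
Proof. by elim: m => [|m IH]; rewrite ?mulr0n ?ev0 ?expr0 // mulrS evD IH exprS. Qed.
Lemma ev_delta a h : ev (adelta a) h = atom_char a h.
Proof.
rewrite /ev (bigD1 a) //= ffunE eqxx expr1z big1 ?mulr1 // => b ba.
by rewrite ffunE (negPf ba) expr0z.
Qed.

Definition step_expo (x : Ix) : expo :=
  if x.1 \in I then adelta (adiag x.1 x.2)
  else if x.2 then adelta (a21 x.1) else adelta (adet x.1) - adelta (a21 x.1).

(** A monomial whose character is exactly x. The P-coordinate is an eigenfunction only for the
    labels [true]; for [false] one corrects a diagonal entry, or the quotient of the determinant by
    the (2,1) entry, by the p-th power character of the preceding index. *)
Definition triv_expo (x : Ix) : expo :=
  if x.2 then adelta (aP x.1)
  else if x.1 \in I then adelta (adiag x.1 false) + adelta (aP (ord_pred x.1)) *+ p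
  else adelta (adet x.1) - adelta (a21 x.1) + adelta (aQ x.1).

Lemma ev_step (x : Ix) h : ev (step_expo x) h = chi h.1 x * (chi h.1 (prev_line I x) ^+ p)^-1.
Proof.
have C u : chi h.1 u != 0 by apply: chi_neq0.
case: x => i s; rewrite /step_expo /prev_line /=; case: ifP => iI.
  by rewrite ev_delta /= iI addbT; case: s.
rewrite addbF; case: s; first by rewrite ev_delta /= iI.
rewrite evD evN !ev_delta /= iI; field.
by rewrite ?expf_neq0 ?C.
Qed.

Lemma ev_triv (x : Ix) h : ev (triv_expo x) h = chi h.1 x.
Proof.
have C u : chi h.1 u != 0 by apply: chi_neq0.
case: x => i s; rewrite /triv_expo /=; case: s; first by rewrite ev_delta.
case: ifP => iI.
  rewrite evD evMn !ev_delta /= iI; field; by rewrite ?expf_neq0 ?C.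
rewrite !evD evN !ev_delta /= iI; field.
by rewrite ?expf_neq0 ?C.
Qed.

(** No auxiliary section occurs among the steps, so the divisor is a combination of smaller strata;
    the character telescopes to 1 - p^2d times x, written additively. *)
Definition norm_expo (x : Ix) : expo :=
  \sum_(s < d + d) step_expo (iter s (prev_line I) x) *+ (p ^ s).

Lemma ev_norm (x : Ix) h : ev (norm_expo x) h = chi h.1 x * (chi h.1 x ^+ (p ^ (d + d)))^-1.
Proof.
have C u : chi h.1 u != 0 by apply: chi_neq0.
have E m : ev (\sum_(s < m) step_expo (iter s (prev_line I) x) *+ (p ^ s)) h =
    chi h.1 x * (chi h.1 (iter m (prev_line I) x) ^+ (p ^ m))^-1.
  elim: m => [|m IH]; first by rewrite big_ord0 ev0 expr1 mulfV.
  rewrite big_ord_recr evD IH evMn ev_step iterS exprMn exprVn -exprM -expnS.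
  by rewrite mulrA divfK // expf_neq0.
by rewrite /norm_expo E iter_prev_line.
Qed.

Definition sec_expo : expo := adelta None - triv_expo y.
(** The two monomials for y are combined so that the characters cancel. Dividing the resulting
    divisor by 1 - p^2d replaces the divisor of [triv_expo y] by [cap_basis]. *)
Definition tri_expo : expo := norm_expo y - triv_expo y + triv_expo y *+ (p ^ (d + d)).

Lemma ev_sec h : ev sec_expo h = char_O1 h.
Proof.
have C u : chi h.1 u != 0 by apply: chi_neq0.
by rewrite /sec_expo evD evN ev_delta ev_triv /= mulfK.
Qed.

Lemma ev_tri h : ev tri_expo h = 1.
Proof.
have C u : chi h.1 u != 0 by apply: chi_neq0.
rewrite /tri_expo !evD evN evMn ev_norm ev_triv; field.
by rewrite ?expf_neq0 ?C.
Qed.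

Definition atom_locus (a : atom) : set V' := [set x | flag I j x /\ atom_fun a x = 0].
Definition adiv (z0 : expo) (D : set V') : rat :=
  \sum_(a : atom | atom_lin a && `[< D = atom_locus a >]) (z0 a)%:~R.

Lemma adivD z1 z2 D : adiv (z1 + z2) D = adiv z1 D + adiv z2 D.
Proof. by rewrite /adiv -big_split; apply: eq_bigr => a _; rewrite ffunE intrD. Qed.
Lemma adiv0 D : adiv 0 D = 0.
Proof. by rewrite /adiv big1 // => a _; rewrite ffunE. Qed.
Lemma adivN z1 D : adiv (- z1) D = - adiv z1 D.
Proof. by rewrite /adiv -sumrN; apply: eq_bigr => a _; rewrite ffunE rmorphN. Qed.
Lemma adivMn z1 m D : adiv (z1 *+ m) D = m%:R * adiv z1 D.
Proof.
elim: m => [|m IH]; first by rewrite mulr0n adiv0 mul0r.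
by rewrite mulrS adivD IH -natr1 mulrDl mul1r addrC.
Qed.
Lemma adiv_delta a D : adiv (adelta a) D = (atom_lin a && `[< D = atom_locus a >])%:R.
Proof.
rewrite /adiv big_mkcond (bigD1 a) //= big1 ?addr0; last first.
  by move=> b ba; rewrite ffunE (negPf ba); case: ifP.
by rewrite ffunE eqxx; case: ifP.
Qed.

Lemma locus_None : atom_locus None = flag I j.+1.
Proof.
rewrite predeqE => x; split.
  move=> [[/memv_flag_space[x1 x2 x3] Ox] x0]; split=> //.
  apply/memv_flag_space; split=> // z' /orP[nz'|]; first by apply: x3; rewrite nz'.
  rewrite ltnS leq_eqVlt => /orP[/eqP zj|zj]; last by apply: x3; rewrite zj orbT.
  have <- : z = z' by rewrite (zE z') -zj nth_index // -index_mem zj.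
  exact: x0.
move=> [/memv_flag_space[x1 x2 x3] Ox]; split; last first.
  by apply: x3; rewrite z_index ltnSn orbT.
split=> //; apply/memv_flag_space; split=> // z' /orP[nz'|zj]; apply: x3; rewrite ?nz' //.
by rewrite ltnW ?orbT.
Qed.

Lemma locus_a21 i : i \notin I -> atom_locus (a21 i) = flag (finset.setU (finset.set1 i) I) j.
Proof.
move=> iI; rewrite predeqE => x; split.
  move=> [[/memv_flag_space[x1 x2 x3] Ox] /=]; rewrite (negPf iI) => x0; split=> //.
  by apply/memv_flag_space; split=> // i'; rewrite !finset.inE => /orP[/eqP ->|/x2].
move=> [/memv_flag_space[x1 x2 x3] Ox]; split.
  split=> //; apply/memv_flag_space; split=> // i' iI'.
  by apply: x2; rewrite !finset.inE iI' orbT.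
by rewrite /= (negPf iI); apply: x2; rewrite !finset.inE eqxx.
Qed.

Local Notation fnY D := (flag_mult flag D j).

Lemma adiv_step (x : Ix) D : adiv (step_expo x) D = fnY D (line_step I x).
Proof.
have fnZ t v : fnY D (t *: v) = t * fnY D v.
  by rewrite /flag_mult mulr_sumr; apply: eq_bigr => K _; rewrite sqscaleE mulrA.
have sym K : `[< D = flag K j >] = `[< flag K j = D >].
  by apply/asbool_equiv_eq; split=> ->.
case: x => i s; rewrite /step_expo /line_step /=; case: ifP => iI.
  rewrite adiv_delta /= [X in X && _](_ : _ = false); last by case: s.
  by rewrite /flag_mult big1 // => K _; rewrite sqzeroE mul0r.
rewrite fnZ flag_mult_basis -sym -locus_a21 ?iI //; case: s => /=.
  by rewrite adiv_delta /= iI /= expr0 mul1r.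
by rewrite adivD adivN !adiv_delta /= iI /= expr1 mulN1r sub0r.
Qed.

Lemma adiv_norm (x : Ix) D : adiv (norm_expo x) D =
  (1 - p%:R ^+ (d + d)) * fnY D (cap_basis p x I).
Proof.
have p1 := prime_gt1 p_prime.
have E : fnY D (cap_basis p x I) = (1 - p%:R ^+ (d + d))^-1 *
    \sum_(s < d + d) p%:R ^+ s * fnY D (line_step I (iter s (prev_line I) x)).
  rewrite /flag_mult /cap_basis mulr_sumr.
  transitivity (\sum_(K : {set 'I_d}) \sum_(s < d + d) (1 - p%:R ^+ (d + d))^-1 *
     (p%:R ^+ s * (line_step I (iter s (prev_line I) x) K * (`[< flag K j = D >])%:R))).
    apply: eq_bigr => K _; rewrite sqscaleE sum_ffunE mulr_sumr mulr_suml.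
    by apply: eq_bigr => s _; rewrite sqscaleE !mulrA.
  rewrite exchange_big; apply: eq_bigr => s _ /=.
  by rewrite -!mulr_sumr.
rewrite E mulrA divff ?mul1r ?(cap_norm_neq0 p1 d_gt0) //.
have E2 m : adiv (\sum_(s < m) step_expo (iter s (prev_line I) x) *+ (p ^ s)) D =
    \sum_(s < m) p%:R ^+ s * fnY D (line_step I (iter s (prev_line I) x)).
  elim: m => [|m IH]; first by rewrite !big_ord0 adiv0.
  by rewrite !big_ord_recr /= adivD IH adivMn adiv_step natrX.
exact: E2.
Qed.

(** Divisors are compared only at invariant subvarieties. The auxiliary loci are among these, and
    their contributions to s are cancelled by those of t. *)
Lemma zip_sections : exists (s t : ratfun V') (beta : Defs.cycle V'),
  [/\ rf_dom s = flag I j,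
      rat_section X act (@char_O1 k (zipE e mu)) s, rat_section X act (fun=> 1) t,
      forall D, inv_subvariety X act D -> Defs.mult beta D = div_mult X s D &
      forall D, inv_subvariety X act D -> div_mult X s D =
        (`[< flag I j.+1 = D >])%:R - fnY D (cap_basis p y I) +
        (1 - p%:R ^+ (d + d))^-1 * div_mult X t D].
Proof.
have p1 := prime_gt1 p_prime.
have [P EP] := choice atom_polyfun.
have /choice[lam Elam] a : exists l : 'Hom(V', k^o), atom_lin a -> forall x, l x = atom_fun a x.
  case: (boolP (atom_lin a)) => la; last by exists 0.
  by have [l El] := linear_lfun (atom_fun_lin la); exists l.
rewrite flag_total.
have H1 := zip_open_open; have H2 := flag_space_sub I j; have H3 := flag_nonempty.
have H4 a : atom_lin a -> forall v, v \in flag_space I j -> peval (P a) v = lam a v.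
  by move=> la v _; rewrite EP Elam.
have H5 a : atom_lin a -> exists2 v, v \in flag_space I j & lam a v != 0.
  by move=> la; have [v vL v0] := atom_lin_n0 la; exists v => //; rewrite Elam.
have H6 a : ~~ atom_lin a -> forall v, lin_sect zip_open (flag_space I j) v -> peval (P a) v != 0.
  by move=> na v Yv; rewrite EP atom_unit.
have H7 h v : flag I j v -> flag I j (act h v) by apply: flag_act.
have H8 a h : atom_char a h != 0 by apply: atom_char_neq0.
have H9 a h v : flag I j v -> peval (P a) (act h v) = atom_char a h * peval (P a) v.
  by move=> Yv; rewrite !EP atom_fun_act.
have locE a : atom_lin a -> lin_sect zip_open (flag_space I j :&: lker (lam a)) = atom_locus a.
  move=> la; rewrite predeqE => v; split.
    by move=> /lin_sect_hyperE[Yv]; rewrite Elam.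
  by move=> [Yv v0]; apply/lin_sect_hyperE; rewrite Elam.
have divE (z0 : expo) D : monomial_div zip_open (flag_space I j) atom_lin lam z0 D = adiv z0 D.
  apply: eq_bigl => a; case: (boolP (atom_lin a)) => //= la; by rewrite locE.
have dE (z0 : expo) D : inv_subvariety (flag finset.set0 0) act D ->
    div_mult (flag finset.set0 0) (monomial_section zip_open (flag_space I j) P z0) D = adiv z0 D.
  by move=> [vD _]; rewrite (div_monomial_section H1 H2 H3 H4 H5 H6).
exists (monomial_section zip_open (flag_space I j) P sec_expo),
  (monomial_section zip_open (flag_space I j) P tri_expo),
  [seq (((sec_expo a)%:~R * (atom_lin a)%:R : rat), atom_locus a) | a <- enum {: atom}].
split=> //.
- apply: (rat_section_monomial H1 H2 H3 H4 H5 H6 H7 H8 H9) => h.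
  exact: esym (ev_sec h).
- apply: (rat_section_monomial H1 H2 H3 H4 H5 H6 H7 H8 H9) => h.
  exact: esym (ev_tri h).
- move=> D iD; rewrite dE // mult_seq big_enum /= /adiv [in RHS]big_mkcond /=.
  apply: eq_bigr => a _; rewrite -mulrA -natrM mulnb.
  have -> : `[< atom_locus a = D >] = `[< D = atom_locus a >].
    by apply/asbool_equiv_eq; split=> ->.
  by case: ifP => _; rewrite ?mulr1 ?mulr0.
move=> D iD; rewrite !dE // /sec_expo /tri_expo !adivD !adivN adivMn adiv_norm natrX.
rewrite adiv_delta /= locus_None.
have -> : `[< D = flag I j.+1 >] = `[< flag I j.+1 = D >].
  by apply/asbool_equiv_eq; split=> ->.
have n0 := cap_norm_neq0 p1 d_gt0; move: n0; set nn := p%:R ^+ (d + d).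
by move=> n0; field.
Qed.

End FixedStratum.

(** * The strata cycles satisfy the Grothendieck relation *)

Section ChernClasses.
Variable rep : {set 'I_d} -> 'M[k]_(d + d).
Hypothesis rep_G : forall I, resGL2 k e (rep I).
Hypothesis rep_aligned : forall I, aligned_set (rep I) = I.
Local Notation G_space := (zip_space (N := N) (resGL2 k e)).

Lemma stratum_closureP I (x : zip_ambient k d N) : stratum_closure e mu (N := N) (rep I) x <->
  G_space x /\ forall i, i \in I -> gent x.1 i true false = 0.
Proof.
rewrite /stratum_closure /zip_space /= zclosure_orbit // rep_aligned /=.
by split=> [[[H1 H2] H3 H4]|[[H1 H3 H4] H2]].
Qed.

Definition chern_cycle m : Defs.cycle (zip_ambient k d N) :=
  [seq (chern_vec p ys m (enum_val j), stratum_closure e mu (rep (enum_val j)))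
  | j <- enum 'I_#|{: {set 'I_d}}|].

(** The closed stratum of I pulls back to the linear section [flag I 0], which starts the flag used
    by the Horner cycles. *)
Lemma pull_chern_cycle m D : Defs.mult (proj_pull (grif mu W S) (chern_cycle m)) D = flag_mult flag D 0 (chern_vec p ys m).
Proof.
rewrite /proj_pull /chern_cycle -map_comp mult_seq big_enum /=.
rewrite /flag_mult [RHS]sum_enum_val.
apply: eq_bigr => j _; congr (_ * (nat_of_bool `[< _ = D >])%:R); rewrite predeqE => x.
set K := enum_val j; split.
  move=> [/stratum_closureP[[[gU gc] px qx] gK] /(memv_grif W_sub) wW w0].
  by split=> //; apply/memv_flag_space; split=> // z; rewrite ltn0 orbF; apply: wW.
move=> [/memv_flag_space[gc gK wW] [gU px qx w0]]; split=> //.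
  by apply/stratum_closureP.
by apply/(memv_grif W_sub) => z nz; apply: wW; rewrite nz.
Qed.

Lemma size_ys : size ys = \dim (grif mu W S).
Proof. by rewrite size_map dim_grif // cardE. Qed.

Lemma line_section (Ij : {set 'I_d} * nat) :
  exists o : ratfun V' * ratfun V' * Defs.cycle V', (Ij.2 < size ys)%N -> let: (s, t, bt) := o in
  [/\ rf_dom s = flag Ij.1 Ij.2,
      rat_section X act (@char_O1 k (zipE e mu)) s, rat_section X act (fun=> 1) t,
      forall D, inv_subvariety X act D -> Defs.mult bt D = div_mult X s D &
      forall D, inv_subvariety X act D -> div_mult X s D =
        (`[< flag Ij.1 Ij.2.+1 = D >])%:R -
        flag_mult flag D Ij.2 (cap_basis p (nth (Ordinal d_gt0, false) ys Ij.2) Ij.1) +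
        (1 - p%:R ^+ (d + d))^-1 * div_mult X t D].
Proof.
case: Ij => I j /=.
case: (boolP (j < size ys)%N) => [|nj]; last first.
  (* Dummy data beyond the rank, so that choice yields total functions. *)
  by exists (RatFun classical_sets.set0 0 0, RatFun classical_sets.set0 0 0, [::]) => jz; case/negP: nj.
rewrite size_map => jz; have [z1 _] : exists z1, z1 \in zs.
  by case E: zs jz => [//|z1 s] _; exists z1; rewrite inE eqxx.
have zE z0 : nth z1 zs j = nth z0 zs j by apply: set_nth_default.
have [s [t [bt H]]] := zip_sections I jz zE.
exists (s, t, bt) => _; rewrite (nth_map z1) //.
Qed.

Lemma chern_classes_grif :
  chern_classes G_space (@zip_act k p d F e mu N) (@grif_act k p d F e mu (size S))
    (grif mu W S) chern_cycle.
Proof.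
have [o Ho] := choice line_section.
pose sec I j := (o (I, j)).1.1; pose tri I j := (o (I, j)).1.2; pose bt I j := (o (I, j)).2.
have Y_end I D : inv_subvariety X act D -> flag I (size ys) <> D.
  move=> [[_ [x Dx] _] _] E; apply: (@flag_end I x); rewrite -/(flag _ _).
  by move: Dx; rewrite -E size_map.
split.
- apply: rat_equiv_mult => D _; rewrite mult_seq big_enum /= /mult big_cons big_nil addr0 /=.
  rewrite (eq_bigr (fun j => (fun K : {set 'I_d} => (K == finset.set0)%:R *
     (`[< stratum_closure e mu (N := N) (rep K) = D >])%:R) (enum_val j))); last first.
    by move=> j _; rewrite chern_vec0 ffunE.
  rewrite -(sum_enum_val (fun K : {set 'I_d} => (K == finset.set0)%:R *
     (`[< stratum_closure e mu (N := N) (rep K) = D >])%:R)) /= (bigD1 finset.set0) //=.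
  rewrite eqxx mul1r big1 ?addr0 => [|K K0]; last by rewrite (negPf K0) mul0r.
  rewrite [stratum_closure _ _ _](_ : _ = G_space); first by case: asboolP.
  rewrite predeqE => x; split=> [/stratum_closureP[]//|Gx]; apply/stratum_closureP.
  by split=> // i; rewrite finset.inE.
- move=> j; rewrite -size_ys => rj; apply: rat_equiv_mult => D _.
  rewrite mult_seq /mult big_nil big1 // => i _.
  by rewrite chern_vec_oversize // sqzeroE mul0r.
rewrite -size_ys; exists (horner_cycle p ys flag); split; last exact: horner_cycle_last.
- by apply: horner_cycle0 => D _; rewrite pull_chern_cycle chern_vec0 flag_mult_basis.
- move=> m mr; apply: (@horner_cycle_step _ _ _ _ _ p d _ _ flag sec tri
    (1 - p%:R ^+ (d + d))^-1 bt _ _ _ _ (Ordinal d_gt0, false) _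
    (fun m => proj_pull (grif mu W S) (chern_cycle m)) m mr) => [I j jr|I j jr|I j jr|I j D jr iD|I j D jr iD|D iD];
    last exact: pull_chern_cycle.
  all: have := Ho (I, j) jr; rewrite /sec /tri /bt; case: (o _) => [[s t] b'] [] //=.
  all: by move=> _ _ _ H1 H2; rewrite ?H1 ?H2.
Qed.
End ChernClasses.

End ZipBundle.

(** * From the line classes to the explicit nonnegative coefficients *)

Lemma prod_square_zero (T : Type) (A : comAlgType rat) (v : A) (Q : pred T) (s : seq T) : v * v = 0 ->
  \prod_(m <- s) (1 + (Q m)%:R *: v) = 1 + (count Q s)%:R *: v.
Proof.
move=> v2; elim: s => [|m s IH]; first by rewrite big_nil scale0r addr0.
rewrite big_cons IH /= natrD scalerDl mulrDl mul1r mulrDr mulr1.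
by rewrite -scalerAl -scalerAr v2 !scaler0 addr0 -addrA [_%:R *: v + _]addrC.
Qed.

(** A retained step containing both weight lines of V_i contributes (1 + l_i)(1 - l_i) = 1, so only
    the steps that meet V_i in a line count. *)
Lemma prod_line_classes (W : {vspace 'cV[k]_(d + d)}) (S : seq int) : subrep e W ->
  \prod_(y <- ys W S) (1 + line_class y) =
  \prod_(i < d) (1 + (grif_mult e mu tau W S i)%:R *: sqvar i).
Proof.
move=> W_sub; rewrite big_map big_enum /= big_mkcond /=.
pose f (m : int) (x : Ix) : sqfree 'I_d := if fil_pred W m x then 1 + line_class x else 1.
rewrite -(pair_bigA _ (fun j x => f S`_(nat_of_ord j) x)) /=.
rewrite (eq_bigr (fun j : 'I_(size S) => \prod_i \prod_b f S`_j (i, b))); last first.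
  by move=> j _; rewrite pair_bigA; apply: eq_bigr => -[].
rewrite exchange_big; apply: eq_bigr => i _ /=.
rewrite (grif_multE W_sub _ (j := i)); last by rewrite modn_small.
rewrite -prod_square_zero ?sqvar2 // (big_nth 0) big_mkord; apply: eq_bigr => j _; move: (S`_j) => m.
have : fil_pred W m (i, true) -> fil_pred W m (i, false).
  by move=> /andP[rj le]; apply/andP; split=> //; apply: le_trans (ltW (n_lt i)) le.
rewrite big_bool /f /line_class /=.
case: (fil_pred W m (i, true)); case: (fil_pred W m (i, false)) => /= H.
- by rewrite scale0r addr0 mulrDl mul1r mulrDr mulr1 mulNr sqvar2 oppr0 addr0 addrK.
- by have := H isT.
- by rewrite mul1r scale1r.
- by rewrite scale0r addr0 mul1r.
Qed.

Lemma grif_mult_periodic (W : {vspace 'cV[k]_(d + d)}) (S : seq int) i : subrep e W ->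
  grif_mult e mu tau W S (i + d) = grif_mult e mu tau W S i.
Proof.
move=> W_sub; have j0 := ltn_pmod i d_gt0.
by rewrite !(grif_multE W_sub _ (j := Ordinal j0)) //= modnDr.
Qed.

Lemma zip_orbit_eq g g' : resGL2 k e g -> resGL2 k e g' ->
  zip_orbit e mu g = zip_orbit e mu g' <-> aligned_set g = aligned_set g'.
Proof.
move=> Gg Gg'; split=> [E|/setP E].
  have : zip_orbit e mu g g' by rewrite E; apply/(zip_orbitP _ Gg').
  by move=> /(zip_orbitP _ Gg)[_ al]; apply/setP => i; rewrite !finset.inE al.
have {}E i : (gent g i true false == 0) = (gent g' i true false == 0).
  by have := E i; rewrite !finset.inE.
rewrite predeqE => h; split.
  by move=> /(zip_orbitP _ Gg)[Gh al]; apply/(zip_orbitP _ Gg'); split=> // i; rewrite -E.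
by move=> /(zip_orbitP _ Gg')[Gh al]; apply/(zip_orbitP _ Gg); split=> // i; rewrite E.
Qed.

Lemma chern_vec_grif_coef (W : {vspace 'cV[k]_(d + d)}) (S : seq int) m
    (rep : {set 'I_d} -> 'M[k]_(d + d)) I :
  subrep e W -> (forall K, resGL2 k e (rep K)) -> (forall K, aligned_set (rep K) = K) ->
  chern_vec p (ys W S) m I = grif_coef e mu tau W S m (rep I) /\ 0 <= chern_vec p (ys W S) m I.
Proof.
move=> W_sub rG ral; have p1 := prime_gt1 p_prime.
have AE K i (j : 'I_d) : j = (i %% d)%N :> nat -> aligned e mu tau (rep K) i = (j \in K).
  move=> ji; apply/idP/idP => [/(alignedP (rG K) ji)/aligned_setP|]; first by rewrite ral.
  by rewrite -{1}(ral K) => /aligned_setP/(alignedP (rG K) ji).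
have E : chern_vec p (ys W S) m I =
    gap_coef p d (grif_mult e mu tau W S) (aligned e mu tau (rep I)) m.
  apply: (@gap_coef_expansion p d p1 d_gt0 _ _ (fun K => aligned e mu tau (rep K))).
  - by move=> i; apply: grif_mult_periodic.
  - move=> K i; have j0 := ltn_pmod i d_gt0.
    by rewrite !(AE _ _ (Ordinal j0)) //= modnDr.
  - by move=> K i; apply: AE; rewrite modn_small.
  - exact: prod_line_classes.
by rewrite E; split=> //; apply: gap_coef_ge0.
Qed.

Lemma strata_effective_grif (W : {vspace 'cV[k]_(d + d)}) (S : seq int) : subrep e W ->
  exists (m : nat) (w : 'I_m -> 'M[k]_(d + d)),
    zip_reps e mu w /\
    forall i : nat, exists a : 'I_m -> rat,
      [/\ forall j, 0 <= a j,
          forall j, a j = grif_coef e mu tau W S i (w j) &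
          forall N, is_chern_grif e mu W S (N := N) i
            [seq (a j, stratum_closure e mu (N := N) (w j)) | j <- enum 'I_m]].
Proof.
move=> W_sub.
have /choice[rep Hrep] I : exists g, resGL2 k e g /\ aligned_set g = I.
  by have [g Gg gI] := stratum_rep I; exists g.
have rG I : resGL2 k e (rep I) by have [] := Hrep I.
have ral I : aligned_set (rep I) = I by have [] := Hrep I.
exists #|{: {set 'I_d}}|, (fun j => rep (enum_val j)); split.
  split=> [j|j j' /(zip_orbit_eq (rG _) (rG _))|g Gg] //.
    by rewrite !ral => /enum_val_inj.
  by exists (enum_rank (aligned_set g)); apply/zip_orbit_eq; rewrite // enum_rankK ral.
move=> i; exists (fun j => chern_vec p (ys W S) i (enum_val j)); split=> [j|j|N].
- by have [] := chern_vec_grif_coef S i (enum_val j) W_sub rG ral.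
- by have [] := chern_vec_grif_coef S i (enum_val j) W_sub rG ral.
exists (chern_cycle W S N rep); first exact: chern_classes_grif.
exact: rat_equiv_mult.
Qed.

End AdaptedFrame.

Unset Implicit Arguments.

Theorem theorem1p4p3
  (p : nat) (p_prime : prime p)
  (* k is an algebraic closure of F_p *)
  (k : closedFieldType) (k_char : p \in [pchar k])
  (k_alg : forall x : k, exists2 n : nat, (0 < n)%N & x ^+ (p ^ n) = x)
  (* F is the field with p^d elements *)
  (d : nat) (d_gt0 : (0 < d)%N)
  (F : fieldExtType 'F_p) (e : d.-tuple F) (e_basis : basis_of fullv e)
  (* tau only serves to number the factors of G_k by Z/d in grif_coef *)
  (tau : {rmorphism F -> k})
  (mu : k -> 'M[k]_(d + d)) (mu_cochar : cocharacter (resGL2 k e) mu)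
  (* P contains a Borel subgroup of G defined over F_p *)
  (B : set 'M[k]_(d + d)) (B_borel : borel (resGL2 k e) B)
  (B_rational : [set frob p g | g in B] = B) (B_sub : B `<=` parP e mu)
  (P_borel : borel (resGL2 k e) (parP e mu))
  (r : {vspace 'cV[k]_(d + d)}) (r_subrep : subrep e r)
  (S : seq int) (S_retained : retained mu r S) :
  exists (m : nat) (w : 'I_m -> 'M[k]_(d + d)),
    zip_reps e mu w /\
    forall i : nat, exists a : 'I_m -> rat,
      [/\ forall j, 0 <= a j,
          forall j, a j = grif_coef e mu tau r S i (w j) &
          forall N, (i <= N)%N ->
            is_chern_grif e mu r S (N := N) i
              [seq (a j, stratum_closure e mu (N := N) (w j)) | j <- enum 'I_m]].
Proof.
have [[_ _ _ P_solv] _] := P_borel.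
have [c [c' [n [pl n_lt mu_c]]]] := adapted_frame p_prime k_char e_basis tau mu_cochar P_solv.
have [m [w [w_reps Hw]]] := strata_effective_grif p_prime k_char d_gt0 e_basis pl n_lt mu_c
  (mu_unit mu_cochar) S r_subrep.
exists m, w; split=> // i; have [a [a_ge0 aE Ha]] := Hw i.
by exists a; split=> // N _; apply: Ha.
Qed.
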